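(* Let $d\ge2$. Every extreme point of the set $(\Sigma^*_d)$ is a Suffridge polynomial in $(\Sigma_d)$, i.e. if $f$ is an extreme point of $(\Sigma^*_d)$ then the curve $f(\mathbb T)$ has exactly $d+1$ cusps and $d-2$ double points.
   Context: $(\Sigma_d)$ is the set of functions $f(z)=z+\frac{a_1}{z}+\dots+\frac{a_d}{z^d}$ univalent in $\Delta=\widehat{\mathbb C}\setminus\overline{\mathbb D}$, and $(\Sigma^*_d)=\{f\in(\Sigma_d): a_d=-1/d\}$, regarded as a subset of a finite-dimensional real vector space; an extreme point is one not expressible as $\frac12(f_1+f_2)$ with $f_1\ne f_2$ in $(\Sigma^*_d)$. $\mathbb T$ is the unit circle. A cusp of $f(\mathbb T)$ is a point $f(\zeta)$ with $|\zeta|=1$, $f'(\zeta)=0$; a double point is a point $f(\zeta_1)=f(\zeta_2)$ with $|\zeta_1|=|\zeta_2|=1$, $\zeta_1\ne\zeta_2$. A Suffridge polynomial in $(\Sigma_d)$ is an $f\in(\Sigma_d)$ for which $f(\mathbb T)$ has $d+1$ cusps and $d-2$ double points. *)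

(* Defs.v *)
From HB Require Import structures.
From mathcomp Require Import all_boot all_order all_algebra.
From mathcomp Require Import complex reals.
Set Implicit Arguments. Unset Strict Implicit. Unset Printing Implicit Defensive.
Import Order.TTheory GRing.Theory Num.Theory.
Local Open Scope ring_scope.
Local Open Scope complex_scope.

Section Defs.
Variable R : realType.
Local Notation C := R[i].

(* A coefficient sequence a : nat -> C encodes f(z) = z + a 1/z + ... + a d/z^d;
   coefficients with index 0 or > d must vanish. *)
Definition laur (d : nat) (a : nat -> C) (z : C) : C :=
  z + \sum_(1 <= k < d.+1) a k * z ^- k.

Definition laur' (d : nat) (a : nat -> C) (z : C) : C :=
  1 - \sum_(1 <= k < d.+1) (k%:R * a k) * z ^- k.+1.

(* univalent in Delta = {|z| > 1} u {oo} (f(oo) = oo, f finite on |z|>1) *)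
Definition univalent_Delta (d : nat) (a : nat -> C) : Prop :=
  forall z w : C, 1 < `|z| -> 1 < `|w| -> laur d a z = laur d a w -> z = w.

Definition Sigma (d : nat) (a : nat -> C) : Prop :=
  (forall k, (k == 0)%N || (d < k)%N -> a k = 0) /\ univalent_Delta d a.

Definition Sigma_star (d : nat) (a : nat -> C) : Prop :=
  Sigma d a /\ a d = - (d%:R)^-1.

Definition extreme_Sigma_star (d : nat) (a : nat -> C) : Prop :=
  Sigma_star d a /\
  ~ (exists b c : nat -> C, Sigma_star d b /\ Sigma_star d c /\ b <> c /\
        a = (fun k => (b k + c k) / 2%:R)).

Definition cusps (d : nat) (a : nat -> C) (w : C) : Prop :=
  exists zeta : C, `|zeta| = 1 /\ laur' d a zeta = 0 /\ w = laur d a zeta.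

Definition double_points (d : nat) (a : nat -> C) (w : C) : Prop :=
  exists z1 z2 : C, `|z1| = 1 /\ `|z2| = 1 /\ z1 <> z2 /\
    w = laur d a z1 /\ w = laur d a z2.

End Defs.

Definition has_exactly {T : eqType} (n : nat) (P : T -> Prop) : Prop :=
  exists s : seq T, uniq s /\ size s = n /\ (forall x, P x <-> x \in s).

Definition Suffridge (R : realType) (d : nat) (a : nat -> R[i]) : Prop :=
  Sigma d a /\ has_exactly d.+1 (cusps d a) /\ has_exactly (d - 2) (double_points d a).

(* Main.v *)
Require Import Defs.
From HB Require Import structures.
From mathcomp Require Import all_boot all_order all_algebra.
From mathcomp Require Import complex.
From mathcomp Require Import all_classical all_reals topology normedtype sequences realfun trigo.
From mathcomp Require Import ring lra zify.
Set Implicit Arguments. Unset Strict Implicit. Unset Printing Implicit Defensive.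
Import Order.TTheory GRing.Theory Num.Theory.
Import numFieldNormedType.Exports.
Local Open Scope ring_scope.
Local Open Scope complex_scope.
Local Open Scope classical_set_scope.
Local Notation Re := complex.Re.
Local Notation Im := complex.Im.
Local Notation nm := Normc.normc.
Local Notation cj := (@conjc _).

(** Substituting x = 1/z, put phi(x) = f(1/x), p(x) = f'(1/x) and let g(x,y) be
    the divided difference with phi(x) - phi(y) = (y - x) g(x,y) / (x y);
    univalence means that g has no zeros off the diagonal of the open bidisc.
    As a_d = -1/d, all d+1 zeros of p lie on the unit circle, so p is
    self-reciprocal and the tangent direction of the boundary curve at x is
    determined by x alone.  Local analysis at the boundary shows that the zeros
    of p are simple with distinct values, and that at a double point
    phi(x) = phi(y) the normals are opposite, whence x^(d-1) = y^(d-1).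
    - At most d-2 double points: the square root of g tending to 1 at the centre
      is symmetric in (x,y), which forces the chords {x,y} of distinct double
      points not to cross; noncrossing chords of angular lengths in
      2 pi Z/(d-1) number at most d-2.
    - At least d-2: the admissible real directions b, those with
      k b_k = conj((d-1-k) b_(d-1-k)), form a space of dimension d-2.  With fewer
      double points some b <> 0 keeps the two branches at each of them at the
      same height over their common tangent.  By local convexity of the image
      and rigidity of the cusps a + e b and a - e b are then both univalent for
      small e, so a is not extreme. *)

(** * Complex moduli and limits along filters on nat *)

(** Everything is reduced to roots of polynomials. For fixed [y] the function [g(., y)] is a product
    of [d] factors [1 - w x], so a small value forces a nearby zero, as in Hurwitz's theorem. At the
    boundary, a suitably scaled pair of points turns [phi(x) = phi(y)] into a polynomial equation
    with a simple limiting root, and univalence forbids that its solutions lie in the disc. The main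
    obstacle is that univalence is not an open condition. If it fails for coefficients tending to
    [a], the failure is pushed to the first circle where injectivity breaks; these contacts converge
    to a zero of [g] on the torus. If the limit is off the diagonal, strict convexity separates the
    branches: since all zeros of [p] lie on the circle, the quadratic term relative to the normal
    has real part exactly [(3 - d)/4], below the [1/2] that the curvature of the circle tolerates.
    If the limit is a cusp, an argument count in the product formula for [p] excludes opposite
    normals. Limits are taken along an ultrafilter, so that bounded sequences of points and of root
    lists all converge at once. *)

Section ComplexModulus.
Variable R : realType.
Local Notation C := R[i].
Implicit Types (x y z : C) (r : R).

Lemma ReD x y : Re (x + y) = Re x + Re y. Proof. by case: x; case: y. Qed.
Lemma ImD x y : Im (x + y) = Im x + Im y. Proof. by case: x; case: y. Qed.
Lemma ReN x : Re (- x) = - Re x. Proof. by case: x. Qed.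
Lemma ImN x : Im (- x) = - Im x. Proof. by case: x. Qed.
Lemma ReM x y : Re (x * y) = Re x * Re y - Im x * Im y.
Proof. by case: x; case: y. Qed.
Lemma ImM x y : Im (x * y) = Re x * Im y + Im x * Re y.
Proof. by case: x => a b; case: y => c d /=; rewrite [b * c]mulrC. Qed.
Lemma Re_conjc x : Re ((cj x)) = Re x. Proof. by case: x. Qed.
Lemma Im_conjc x : Im ((cj x)) = - Im x. Proof. by case: x. Qed.
Lemma complex_ext x y : Re x = Re y -> Im x = Im y -> x = y.
Proof. by case: x; case: y => ? ? ? ? /= -> ->. Qed.

Lemma normE z : `|z| = (nm z)%:C. Proof. by []. Qed.
Lemma nm_sqr z : nm z ^+ 2 = Re z ^+ 2 + Im z ^+ 2.
Proof. by case: z => a b /=; rewrite sqr_sqrtr // addr_ge0 ?sqr_ge0. Qed.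
Lemma nm_ge0 z : 0 <= nm z. Proof. by case: z => a b; exact: sqrtr_ge0. Qed.
Lemma nmD x y : nm (x + y) <= nm x + nm y. Proof. exact: le_normcD. Qed.
Lemma nmN x : nm (- x) = nm x. Proof. exact: normcN. Qed.
Lemma nmB x y : nm (x - y) <= nm x + nm y.
Proof. by rewrite -(nmN y) nmD. Qed.
Lemma nm_distC x y : nm (x - y) = nm (y - x).
Proof. by rewrite -nmN opprB. Qed.
Lemma nmM x y : nm (x * y) = nm x * nm y. Proof. exact: Normc.normcM. Qed.
Lemma nmV x : nm x^-1 = (nm x)^-1. Proof. exact: Normc.normcV. Qed.
Lemma nm0 : nm (0 : C) = 0. Proof. exact: Normc.normc0. Qed.
Lemma nm1 : nm (1 : C) = 1. Proof. exact: Normc.normc1. Qed.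
Lemma nmX x n : nm (x ^+ n) = nm x ^+ n.
Proof. by elim: n => [|n IH]; rewrite ?expr0 ?nm1 // !exprS nmM IH. Qed.
Lemma nm_eq0 x : (nm x == 0) = (x == 0).
Proof. by apply/eqP/eqP => [/Normc.eq0_normc|->] //; rewrite nm0. Qed.
Lemma nm_gt0 x : (0 < nm x) = (x != 0).
Proof. by rewrite lt_def nm_ge0 nm_eq0 andbT. Qed.
Lemma nm_real r : nm (r%:C) = `|r|.
Proof. by rewrite /= expr0n addr0 sqrtr_sqr. Qed.
Lemma nmJ x : nm ((cj x)) = nm x.
Proof. by case: x => a b /=; rewrite sqrrN. Qed.
Lemma nm_prod (I : Type) (s : seq I) (F : I -> C) :
  nm (\prod_(i <- s) F i) = \prod_(i <- s) nm (F i).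
Proof. by apply: (big_morph _ nmM nm1). Qed.
Lemma nm_sum (I : Type) (s : seq I) (F : I -> C) :
  nm (\sum_(i <- s) F i) <= \sum_(i <- s) nm (F i).
Proof.
elim: s => [|i s IH]; first by rewrite !big_nil nm0.
by rewrite !big_cons (le_trans (nmD _ _)) // lerD2l.
Qed.
Lemma absRe_le z : `|Re z| <= nm z.
Proof.
rewrite -(@ler_pXn2r _ 2) ?nnegrE ?nm_ge0 // nm_sqr real_normK ?num_real //.
by rewrite lerDl sqr_ge0.
Qed.
Lemma absIm_le z : `|Im z| <= nm z.
Proof.
rewrite -(@ler_pXn2r _ 2) ?nnegrE ?nm_ge0 // nm_sqr real_normK ?num_real //.
by rewrite lerDr sqr_ge0.
Qed.
Lemma mulcJ z : z * (cj z) = (nm z ^+ 2)%:C.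
Proof. by rewrite -sqr_normc normE rmorphXn. Qed.
Lemma conjcM x y : (cj (x * y)) = (cj x) * (cj y).
Proof. exact: (rmorphM (@conjc R)). Qed.
Lemma conjcD x y : (cj (x + y)) = (cj x) + (cj y).
Proof. exact: (rmorphD (@conjc R)). Qed.
Lemma conjcB x y : (cj (x - y)) = (cj x) - (cj y).
Proof. exact: (rmorphB (@conjc R)). Qed.
Lemma conjcX x n : (cj (x ^+ n)) = (cj x) ^+ n.
Proof. exact: (rmorphXn (@conjc R)). Qed.
Lemma conjc_1 : (cj (1 : C)) = 1.
Proof. exact: (rmorph1 (@conjc R)). Qed.
Lemma conjc_prod (I : Type) (s : seq I) (F : I -> C) :
  (cj (\prod_(i <- s) F i)) = \prod_(i <- s) (cj (F i)).
Proof. exact: (rmorph_prod (@conjc R)). Qed.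
Lemma conjc_sum (I : Type) (s : seq I) (F : I -> C) :
  (cj (\sum_(i <- s) F i)) = \sum_(i <- s) (cj (F i)).
Proof. exact: (rmorph_sum (@conjc R)). Qed.
Lemma conjc_V x : (cj (x^-1)) = ((cj x))^-1.
Proof. exact: (fmorphV (@conjc R)). Qed.
Lemma circle_conj z : nm z = 1 -> (cj z) = z^-1.
Proof.
move=> z1; have z0 : z != 0 by rewrite -nm_eq0 z1 oner_eq0.
by apply: (mulfI z0); rewrite mulfV // mulcJ z1 expr1n.
Qed.
Lemma circle_neq0 z : nm z = 1 -> z != 0.
Proof. by move=> z1; rewrite -nm_eq0 z1 oner_eq0. Qed.
Lemma Re_le_nm z : Re z <= nm z.
Proof. exact: le_trans (ler_norm _) (absRe_le z). Qed.
Lemma nm1B_le1 z : nm z <= 1 -> 0 <= Re (1 - z).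
Proof. by move=> z1; rewrite ReD ReN /=; have := Re_le_nm z; lra. Qed.
Lemma nm_nat n : nm (n%:R : C) = n%:R.
Proof. by rewrite -(rmorph_nat (real_complex R)) nm_real normr_nat. Qed.

End ComplexModulus.

Section ComplexLimits.
Variable R : realType.
Local Notation C := R[i].

(** The filter is arbitrary so that one calculus serves both plain sequences and ultrafilters finer
    than [\oo], which replace the extraction of subsequences. *)
Definition clim (F : set_system nat) (u : nat -> C) (l : C) :=
  (fun n => Re (u n)) @ F --> Re l /\ (fun n => Im (u n)) @ F --> Im l.

Section Filter.
Variables (F : set_system nat) (FF : ProperFilter F).
Implicit Types (u v : nat -> C) (l m : C).

Lemma clim_cst l : clim F (fun=> l) l.
Proof. by split; exact: cvg_cst. Qed.

Lemma climD u v l m : clim F u l -> clim F v m -> clim F (fun n => u n + v n) (l + m).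
Proof.
move=> [u1 u2] [v1 v2]; split.
  by under eq_fun do rewrite ReD; rewrite ReD; exact: cvgD.
by under eq_fun do rewrite ImD; rewrite ImD; exact: cvgD.
Qed.

Lemma climN u l : clim F u l -> clim F (fun n => - u n) (- l).
Proof.
move=> [u1 u2]; split.
  by under eq_fun do rewrite ReN; rewrite ReN; exact: cvgN.
by under eq_fun do rewrite ImN; rewrite ImN; exact: cvgN.
Qed.

Lemma climB u v l m : clim F u l -> clim F v m -> clim F (fun n => u n - v n) (l - m).
Proof. by move=> ul vm; apply: climD => //; exact: climN. Qed.

Lemma climM u v l m : clim F u l -> clim F v m -> clim F (fun n => u n * v n) (l * m).
Proof.
move=> [u1 u2] [v1 v2]; split.
  under eq_fun do rewrite ReM; rewrite ReM.
  by apply: cvgB; apply: cvgM.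
under eq_fun do rewrite ImM; rewrite ImM.
by apply: cvgD; apply: cvgM.
Qed.

Lemma climX u l k : clim F u l -> clim F (fun n => u n ^+ k) (l ^+ k).
Proof.
move=> ul; elim: k => [|k IH].
  by under eq_fun do rewrite expr0; exact: clim_cst.
by under eq_fun do rewrite exprS; rewrite exprS; exact: climM.
Qed.

Lemma clim_sum (I : Type) (s : seq I) (f : I -> nat -> C) (h : I -> C) :
  (forall i, clim F (f i) (h i)) ->
  clim F (fun n => \sum_(i <- s) f i n) (\sum_(i <- s) h i).
Proof.
move=> fh; elim: s => [|i s IH].
  by under eq_fun do rewrite big_nil; rewrite big_nil; exact: clim_cst.
by under eq_fun do rewrite big_cons; rewrite big_cons; exact: climD.
Qed.

Lemma clim_prod (I : Type) (s : seq I) (f : I -> nat -> C) (h : I -> C) :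
  (forall i, clim F (f i) (h i)) ->
  clim F (fun n => \prod_(i <- s) f i n) (\prod_(i <- s) h i).
Proof.
move=> fh; elim: s => [|i s IH].
  by under eq_fun do rewrite big_nil; rewrite big_nil; exact: clim_cst.
by under eq_fun do rewrite big_cons; rewrite big_cons; exact: climM.
Qed.

Lemma clim_uniq u l m : clim F u l -> clim F u m -> l = m.
Proof.
move=> [u1 u2] [v1 v2]; apply: complex_ext.
  exact: (cvg_unique (@Rhausdorff R) u1 v1).
exact: (cvg_unique (@Rhausdorff R) u2 v2).
Qed.

Lemma clim_nm u l : clim F u l -> (fun n => nm (u n)) @ F --> nm l.
Proof.
move=> [u1 u2].
have E z : nm z = Num.sqrt (Re z ^+ 2 + Im z ^+ 2 : R) by case: z.
under eq_fun do rewrite E; rewrite E.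
apply: (cvg_comp (fun n => Re (u n) ^+ 2 + Im (u n) ^+ 2) (@Num.sqrt R)); last exact: sqrt_continuous.
by apply: cvgD; rewrite expr2; under eq_fun do rewrite expr2; exact: cvgM.
Qed.

Lemma clim_conj u l : clim F u l -> clim F (fun n => (cj (u n))) ((cj l)).
Proof.
move=> [u1 u2]; split.
  by under eq_fun do rewrite Re_conjc; rewrite Re_conjc.
by under eq_fun do rewrite Im_conjc; rewrite Im_conjc; exact: cvgN.
Qed.

Lemma clim_real (r : nat -> R) (s : R) : r @ F --> s -> clim F (fun n => (r n)%:C) s%:C.
Proof. by move=> rs; split=> //=; exact: cvg_cst. Qed.

Lemma climV u l : l != 0 -> clim F u l -> clim F (fun n => (u n)^-1) l^-1.
Proof.
move=> l0 ul.
have E z : z^-1 = ((nm z ^+ 2)^-1)%:C * (cj z) :> C.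
  have [->|z0] := eqVneq z 0; first by rewrite invr0 (rmorph0 (@conjc R)) mulr0.
  apply: (mulfI z0); rewrite mulfV // mulrCA mulcJ -rmorphM /= mulVf //.
  by rewrite expf_neq0 // nm_eq0.
under eq_fun do rewrite E; rewrite E.
apply: climM; last exact: clim_conj.
apply: clim_real; apply: cvgV; first by rewrite expf_neq0 // nm_eq0.
by rewrite expr2; under eq_fun do rewrite expr2; apply: cvgM; exact: clim_nm.
Qed.

Lemma clim_near u l (e : R) : 0 < e -> clim F u l -> \forall n \near F, nm (u n - l) < e.
Proof.
move=> e0 ul.
have /clim_nm := climB ul (clim_cst l).
rewrite subrr nm0 => /cvgr_lt; exact.
Qed.

Lemma clim_nm_lt u l (M : R) : clim F u l -> nm l < M -> \forall n \near F, nm (u n) < M.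
Proof. by move=> /clim_nm /cvgr_lt; apply. Qed.

Lemma clim_nm_gt u l (M : R) : clim F u l -> M < nm l -> \forall n \near F, M < nm (u n).
Proof. by move=> /clim_nm /cvgr_gt; apply. Qed.

Lemma clim_Re_gt u l (M : R) : clim F u l -> M < Re l -> \forall n \near F, M < Re (u n).
Proof. by move=> [/cvgr_gt + _]; apply. Qed.

Lemma clim_le (e : nat -> R) u l :
  e @ F --> 0 -> (\forall n \near F, nm (u n - l) <= e n) -> clim F u l.
Proof.
move=> e0 ule; split; apply/cvgrPdist_lt => d d0.
  near=> n; rewrite -ReN -ReD; apply: le_lt_trans (absRe_le _) _.
  rewrite nm_distC; apply: le_lt_trans (_ : e n < d); first by near: n.
  by near: n; exact: (cvgr_lt _ e0).
near=> n; rewrite -ImN -ImD; apply: le_lt_trans (absIm_le _) _.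
rewrite nm_distC; apply: le_lt_trans (_ : e n < d); first by near: n.
by near: n; exact: (cvgr_lt _ e0).
Unshelve. all: by end_near. Qed.

Lemma clim_nm_le u l (M : R) : clim F u l -> (\forall n \near F, nm (u n) <= M) -> nm l <= M.
Proof.
move=> /clim_nm ul uM; rewrite -(cvg_lim (@Rhausdorff R) ul).
by apply: limr_le => //; apply: cvgP ul.
Qed.

End Filter.

Lemma ultra_fmap (T V : Type) (h : T -> V) (U : set_system T) :
  UltraFilter U -> UltraFilter (fmap h U).
Proof.
move=> UU; split; first exact: fmap_proper_filter.
move=> G GF FG; apply/predeqP => A; split=> [GA|]; last exact: FG.
have [//|UnA] := in_ultra_setVsetC (h @^-1` A) UU.
have GnA : G (~` A) by exact: FG.
have : G (A `&` ~` A) by exact: filterI.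
by rewrite setICr => /filter_not_empty.
Qed.

Lemma ultra_clim (U : set_system nat) (UU : UltraFilter U) (M : R) (u : nat -> C) :
  (forall n, nm (u n) <= M) -> exists l, clim U u l.
Proof.
move=> uM.
have key (h : nat -> R) : (forall n, `|h n| <= M) -> exists l : R, h @ U --> l.
  move=> hM.
  have hU : UltraFilter (h @ U) by exact: ultra_fmap.
  have := @segment_compact R (- M) M; rewrite compact_ultra.
  move=> /(_ (h @ U) hU) [|l [_ hl]]; last by exists l.
  rewrite /= /fmap /=; apply: filterE => n /=; rewrite in_itv /=; have := hM n.
  by rewrite ler_norml.
have [a ha] := key (fun n => Re (u n)) (fun n => le_trans (absRe_le _) (uM n)).
have [b hb] := key (fun n => Im (u n)) (fun n => le_trans (absIm_le _) (uM n)).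
by exists (a +i* b).
Qed.

End ComplexLimits.

(** * The divided difference and univalence *)

Section DividedDifference.
Variables (R : realType) (d : nat).
Local Notation C := R[i].
Implicit Types (a : nat -> C) (x y : C).

(** The inner sum is [x y (x^k - y^k) / (x - y)] written as a polynomial, so that the diagonal and
    the origin need no exception. *)
Definition gfun a x y : C :=
  1 - \sum_(1 <= k < d.+1) a k * \sum_(i < k) x ^+ i.+1 * y ^+ (k - i).
Definition phi a x : C := x^-1 + \sum_(1 <= k < d.+1) a k * x ^+ k.
Definition pfun a x : C := 1 - \sum_(1 <= k < d.+1) (k%:R * a k) * x ^+ k.+1.

Lemma gfun_sym a x y : gfun a x y = gfun a y x.
Proof.
congr (1 - _); apply: eq_bigr => k _; congr (_ * _).
rewrite (reindex_inj rev_ord_inj) /=; apply: eq_bigr => i _.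
by rewrite mulrC; congr (_ ^+ _ * _ ^+ _); have := ltn_ord i; lia.
Qed.

Lemma gfun_diag a x : gfun a x x = pfun a x.
Proof.
congr (1 - _); apply: eq_big_nat => k /andP[k0 _].
rewrite [k%:R * _]mulrC -mulrA; congr (_ * _).
rewrite (eq_bigr (fun=> x ^+ k.+1)) => [|i _].
  by rewrite sumr_const card_ord mulr_natl.
by rewrite -exprD; congr (_ ^+ _); have := ltn_ord i; lia.
Qed.

Lemma gfun0 a y : gfun a 0 y = 1.
Proof.
rewrite /gfun big1 ?subr0 // => k _; rewrite big1 ?mulr0 // => i _.
by rewrite expr0n mul0r.
Qed.

Lemma pfun0 a : pfun a 0 = 1. Proof. by rewrite -gfun_diag gfun0. Qed.

Lemma sub_powers_swap k x y :
  x * y * (x ^+ k - y ^+ k) = (x - y) * \sum_(i < k) x ^+ i.+1 * y ^+ (k - i).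
Proof.
rewrite subrXX mulrCA; congr (_ * _).
rewrite mulr_sumr (reindex_inj rev_ord_inj) /=; apply: eq_bigr => i _.
have ik := ltn_ord i.
have -> : (k.-1 - (k - i.+1) = i)%N by lia.
have -> : (k - i = (k - i.+1).+1)%N by lia.
by rewrite !exprS; ring.
Qed.

Lemma phiB a x y : x != 0 -> y != 0 ->
  x * y * (phi a x - phi a y) = (y - x) * gfun a x y.
Proof.
move=> x0 y0; rewrite /phi /gfun; set S1 := \sum_(_ <= k < _) _.
set S2 := \sum_(_ <= k < _) _; set T := \sum_(_ <= k < _) _.
suff E : x * y * (S1 - S2) = (x - y) * T.
  have -> : x * y * (x^-1 + S1 - (y^-1 + S2)) = (y - x) + x * y * (S1 - S2).
    by field; rewrite x0 y0.
  by rewrite E; ring.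
rewrite /S1 /S2 /T -sumrB 2!mulr_sumr; apply: eq_bigr => k _.
by rewrite -mulrBr mulrCA sub_powers_swap mulrCA.
Qed.

Lemma phi_eq a x y : x != 0 -> y != 0 -> x != y ->
  (phi a x == phi a y) = (gfun a x y == 0).
Proof.
move=> x0 y0 xy; rewrite -subr_eq0; apply/eqP/eqP => H.
  have /eqP := phiB a x0 y0; rewrite H mulr0 eq_sym mulf_eq0 subr_eq0.
  by rewrite eq_sym (negPf xy) => /eqP.
have /eqP := phiB a x0 y0; rewrite H mulr0 !mulf_eq0 (negPf x0) (negPf y0) /=.
by move/eqP.
Qed.

(** The monic polynomial [z] is [g(., y)] with its coefficients reversed, and [w] runs through its
    roots. Reversal keeps the number of factors equal to [d] for every [y]: a drop in the degree of
    [g(., y)] only shows as roots [w = 0]. *)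
Lemma gfun_factor a y : exists om : seq C, size om = d /\
  forall x, gfun a x y = \prod_(w <- om) (1 - w * x).
Proof.
pose z : {poly C} :=
  'X^d - \sum_(1 <= k < d.+1) \sum_(i < k) (a k * y ^+ (k - i)) *: 'X^(d - i.+1).
have sz : (size (z - 'X^d)%R <= d)%N.
  rewrite /z addrAC subrr add0r size_polyN.
  rewrite big_nat; apply: leq_trans (size_sum _ _ _) _.
  apply/bigmax_leqP_seq => k _ /andP[k1 kd].
  apply: leq_trans (size_sum _ _ _) _; apply/bigmax_leqP => i _.
  apply: leq_trans (size_scale_leq _ _) _; rewrite size_polyXn.
  by have := ltn_ord i; lia.
have zX : z = 'X^d + (z - 'X^d) by rewrite addrC subrK.
have szz : size z = d.+1 by rewrite zX size_polyDl ?size_polyXn.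
have lz : lead_coef z = 1 by rewrite zX lead_coefDl ?size_polyXn // lead_coefXn.
have [om zom] := closed_field_poly_normal z; rewrite lz scale1r in zom.
have som : size om = d.
  by apply: succn_inj; rewrite -szz zom size_prod_XsubC.
exists om; split => // x; have [->|x0] := eqVneq x 0.
  by rewrite gfun0 big1 // => w _; rewrite mulr0 subr0.
transitivity (x ^+ d * z.[x^-1]).
  have xd : x ^+ d * x^-1 ^+ d = 1 by rewrite -exprMn mulfV // expr1n.
  rewrite /z !hornerE mulrBr xd; congr (_ - _).
  rewrite horner_sum mulr_sumr; apply: eq_big_nat => k /andP[k1 kd].
  rewrite mulr_sumr horner_sum mulr_sumr; apply: eq_bigr => i _.
  have ik := ltn_ord i; have ed : d = (i.+1 + (d - i.+1))%N by lia.
  have -> : x ^+ d = x ^+ i.+1 * x ^+ (d - i.+1) by rewrite -exprD -ed.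
  rewrite hornerZ hornerXn; have : x ^+ (d - i.+1) * x^-1 ^+ (d - i.+1) = 1.
    by rewrite -exprMn mulfV // expr1n.
  by move: (x ^+ (_ - _)) (x^-1 ^+ _) => u v uv; ring: uv.
rewrite zom horner_prod -som.
elim: (om) => [|w s IH]; first by rewrite !big_nil mulr1 expr0.
by rewrite !big_cons /= exprS hornerXsubC -IH mulrACA; congr (_ * _); field.
Qed.

(** A product of [d] factors that is below [eta ^ d] has a factor [1 - w * x0] below [eta], and
    [1/w] is the zero sought. *)
Lemma gfun_near_root a x0 y (eta : R) : 0 < eta -> eta <= 1 ->
  nm (gfun a x0 y) < eta ^+ d ->
  exists2 xi, gfun a xi y = 0 & nm (xi - x0) < eta * nm xi.
Proof.
move=> e0 e1; have [om [som gE]] := gfun_factor a y.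
rewrite gE nm_prod => small.
have [w wom wsmall] : exists2 w, w \in om & nm (1 - w * x0) < eta.
  apply: contrapT => nex; move: small; apply/negP; rewrite -leNgt -som.
  have : {in om, forall w, eta <= nm (1 - w * x0)}.
    by move=> w wom; rewrite leNgt; apply/negP => ?; apply: nex; exists w.
  elim: (om) => [|w s IH] H; first by rewrite big_nil expr0.
  rewrite big_cons /= exprS ler_pM ?exprn_ge0 ?(ltW e0) ?H ?mem_head //.
  by apply: IH => v vs; apply: H; rewrite in_cons vs orbT.
have w0 : w != 0.
  by apply: contraTneq wsmall => ->; rewrite mul0r subr0 nm1 -leNgt.
exists w^-1.
  rewrite gE; apply/eqP; rewrite prodf_seq_eq0; apply/hasP; exists w => //=.
  by rewrite mulfV // subrr.
have -> : w^-1 - x0 = (1 - w * x0) * w^-1 by rewrite mulrBl mul1r mulrAC mulfV // mul1r.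
by rewrite nmM ltr_pM2r // nm_gt0 invr_eq0.
Qed.

(** With [eta = 1 - nm x0] the zero satisfies [|xi| < |x0| + (1 - |x0|) |xi|], which forces
    [|xi| < 1]. *)
Lemma gfun_disc_root a x0 y : nm x0 < 1 -> nm (gfun a x0 y) < (1 - nm x0) ^+ d ->
  exists2 xi, gfun a xi y = 0 & nm xi < 1.
Proof.
move=> x1 small; have n0 := nm_ge0 x0.
have [||xi gxi dxi] := gfun_near_root _ _ small; [lra|lra|].
exists xi => //; have := nmD (xi - x0) x0; rewrite subrK => tri.
by have := nm_ge0 xi; nra.
Qed.

Definition univ a := forall x y, nm x < 1 -> nm y < 1 -> x != y -> gfun a x y != 0.

Definition ppoly a : {poly C} := 1 - \sum_(1 <= k < d.+1) (k%:R * a k) *: 'X^(k.+1).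

Lemma ppolyE a x : (ppoly a).[x] = pfun a x.
Proof.
rewrite /ppoly hornerD hornerN hornerC horner_sum; congr (_ - _).
by apply: eq_bigr => k _; rewrite hornerZ hornerXn.
Qed.

Lemma clim_gfun (F : set_system nat) (FF : ProperFilter F)
    (an : nat -> nat -> C) (xn yn : nat -> C) a x y :
  (forall k, clim F (fun n => an n k) (a k)) -> clim F xn x -> clim F yn y ->
  clim F (fun n => gfun (an n) (xn n) (yn n)) (gfun a x y).
Proof.
move=> ha hx hy; apply: climB; first exact: clim_cst.
apply: clim_sum => k; apply: climM => //; apply: clim_sum => i.
by apply: climM; exact: climX.
Qed.

Lemma clim_pfun (F : set_system nat) (FF : ProperFilter F)
    (an : nat -> nat -> C) (xn : nat -> C) a x :
  (forall k, clim F (fun n => an n k) (a k)) -> clim F xn x ->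
  clim F (fun n => pfun (an n) (xn n)) (pfun a x).
Proof.
move=> ha hx; rewrite -gfun_diag.
by under eq_fun do rewrite -gfun_diag; exact: clim_gfun.
Qed.

Lemma clim_harmonic : clim \oo (fun n => ((n.+1)%:R^-1 : R)%:C) (0 : C).
Proof. by apply: clim_real; exact: cvg_harmonic. Qed.

(** Only the diagonal is new. If [g(x, x) = 0], then [g(x, u)] is small for [u] near [x], hence
    [g(., u)] has a zero [xi] in the disc; choosing [u] with [p(u) != 0] gives [xi != u], against
    injectivity. *)
Lemma univ_neq0 a x y : univ a -> nm x < 1 -> nm y < 1 -> gfun a x y != 0.
Proof.
move=> ua x1 y1; have [<-{y y1}|] := eqVneq x y; last exact: ua.
apply/negP => /eqP gxx.
pose u n : C := x + ((n.+1)%:R^-1 : R)%:C.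
have ux : clim \oo u x.
  by rewrite -[x in clim _ _ x]addr0; apply: (climD _ (clim_cst _ _) clim_harmonic).
have gu : clim \oo (fun n => gfun a x (u n)) 0.
  by rewrite -gxx; apply: clim_gfun => // *; exact: clim_cst.
have e0 : 0 < (1 - nm x) ^+ d by rewrite exprn_gt0 // subr_gt0.
have [N _ HN] := clim_near _ e0 gu.
have x1' : 0 < 1 - nm x by rewrite subr_gt0.
have [M _ HM] := clim_near _ x1' ux.
have p0 : ppoly a != 0.
  by apply: contra_neq (oner_neq0 C) => p0; rewrite -(pfun0 a) -ppolyE p0 horner0.
have [k pk] : exists k, pfun a (u (N + M + k)%N) != 0.
  apply: contrapT => nex.
  pose s := [seq u (N + M + k)%N | k <- iota 0 (size (ppoly a))].
  have : (size s < size (ppoly a))%N.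
    apply: max_poly_roots => //.
      apply/allP => _ /mapP[k _ ->]; apply/rootP; rewrite ppolyE.
      by apply/eqP/negPn/negP => pk; apply: nex; exists k.
    rewrite map_inj_uniq ?iota_uniq // => k l /addrI/complexI/invr_inj/eqP.
    by rewrite eqr_nat eqSS => /eqP/addnI.
  by rewrite size_map size_iota ltnn.
set n := (N + M + k)%N in pk.
have un1 : nm (u n) < 1.
  have Mn : (M <= n)%N by rewrite /n; lia.
  have /= H := HM n Mn.
  by have := nmD (u n - x) x; rewrite subrK; lra.
have Nn : (N <= n)%N by rewrite /n; lia.
have := HN n Nn; rewrite /= subr0.
case/(gfun_disc_root x1) => xi gxi xi1.
have [E|ne] := eqVneq xi (u n).
  by move: pk; rewrite -gfun_diag -{1}E gxi eqxx.
by have := ua _ _ xi1 un1 ne; rewrite gxi eqxx.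
Qed.

(** Pull [y] radially into the disc: a zero of [g(., y)] in the open disc survives a small change of
    [y]. *)
Lemma univ_neq0_closed a x y : univ a -> nm x < 1 -> nm y <= 1 -> gfun a x y != 0.
Proof.
move=> ua x1 y1; apply/negP => /eqP gxy.
pose u n : C := y - ((n.+1)%:R^-1 : R)%:C * y.
have uy : clim \oo u y.
  rewrite -[y in clim _ _ y]subr0 -(mul0r y).
  by apply: (climB _ (clim_cst _ _) _); apply: (climM _ clim_harmonic (clim_cst _ _)).
have gu : clim \oo (fun n => gfun a x (u n)) 0.
  by rewrite -gxy; apply: clim_gfun => // *; exact: clim_cst.
have e0 : 0 < (1 - nm x) ^+ d by rewrite exprn_gt0 // subr_gt0.
have [N _ HN] := clim_near _ e0 gu.
have := HN N (leqnn N); rewrite subr0 => /(gfun_disc_root x1)[xi gxi xi1].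
have uN1 : nm (u N) < 1.
  rewrite /u -{1}[y]mul1r -mulrBl nmM -(rmorph1 (real_complex R)) -rmorphB nm_real.
  have h1 : 0 < (N.+1)%:R^-1 :> R by rewrite invr_gt0 ltr0n.
  have h2 : (N.+1)%:R^-1 <= 1 :> R by rewrite invf_le1 ?ltr0n // ler1n.
  rewrite ger0_norm ?subr_ge0 //; move: ((N.+1)%:R^-1) h1 h2 => h h1 h2.
  by have := nm_ge0 y; nra.
by have := univ_neq0 ua xi1 uN1; rewrite gxi eqxx.
Qed.

End DividedDifference.

(** * Boundary contact of a univalent map *)

Section RootLocation.
Variable R : realType.
Local Notation C := R[i].

Lemma deriv_prod_XsubC (K : fieldType) (rs : seq K) (x : K) : x \notin rs ->
  (\prod_(r <- rs) ('X - r%:P))^`().[x] =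
  (\prod_(r <- rs) (x - r)) * \sum_(r <- rs) (x - r)^-1.
Proof.
elim: rs => [|r s IH]; first by rewrite !big_nil mul1r derivC horner0.
rewrite in_cons negb_or => /andP[xr xs]; rewrite !big_cons derivM derivXsubC.
rewrite mul1r hornerD hornerM hornerXsubC IH // mulrDr mulrAC mulfV ?subr_eq0 //.
by rewrite mul1r horner_prod mulrA; congr (_ + _); apply: eq_bigr => ? _; rewrite hornerXsubC.
Qed.

(** If every root were farther from [x] than the bound, the logarithmic derivative, a sum of
    [1 / (x - r)] over the roots, would be too small. [size q] exceeds the number of roots by one,
    which supplies the strict inequality. *)
Lemma root_near_critical (q : {poly C}) (x : C) : q^`().[x] != 0 ->
  exists2 xi, root q xi & nm (xi - x) <= (size q)%:R * nm q.[x] / nm q^`().[x].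
Proof.
move=> q'x; have [q0|q0] := eqVneq q.[x] 0.
  exists x; first exact/rootP.
  by rewrite subrr nm0 q0 nm0 mulr0 mul0r.
have [rs qE] := closed_field_poly_normal q.
have c0 : lead_coef q != 0 by apply: contra_neq q0 => c0; rewrite qE c0 scale0r horner0.
set B := _ / _; have B0 : 0 < B.
  rewrite divr_gt0 ?nm_gt0 // mulr_gt0 ?nm_gt0 // ltr0n size_poly_gt0.
  by apply: contra_neq q0 => ->; rewrite horner0.
have rootE r : r \in rs -> root q r.
  by move=> rrs; rewrite qE rootZ // root_prod_XsubC.
have xrs : x \notin rs by apply: contra q0 => /rootE /rootP ->.
apply: contrapT => nex.
have far r : r \in rs -> B < nm (x - r).
  move=> rrs; rewrite ltNge; apply/negP => rB; apply: nex; exists r; first exact: rootE.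
  by rewrite nm_distC.
have E : q^`().[x] = q.[x] * \sum_(r <- rs) (x - r)^-1.
  rewrite [in LHS]qE derivZ hornerZ deriv_prod_XsubC // mulrA; congr (_ * _).
  by rewrite [in RHS]qE hornerZ horner_prod; congr (_ * _); apply: eq_bigr => ? _; rewrite hornerXsubC.
have sB : nm (\sum_(r <- rs) (x - r)^-1) <= (size rs)%:R / B.
  apply: le_trans (nm_sum _ _) _.
  rewrite big_seq (le_trans (_ : _ <= \sum_(r <- rs | r \in rs) B^-1)) //.
    apply: ler_sum => r rrs; rewrite nmV lef_pV2 ?posrE ?(ltW (far _ _)) //.
    exact: lt_trans (far _ rrs).
  by rewrite -big_seq big_const_seq count_predT iter_addr_0 mulr_natl.
have srs : size q = (size rs).+1 by rewrite qE size_scale // size_prod_XsubC.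
have : nm q^`().[x] <= nm q.[x] * ((size rs)%:R / B).
  by rewrite [in leLHS]E nmM ler_pM2l ?nm_gt0.
have q'0 : 0 < nm q^`().[x] by rewrite nm_gt0.
have qx0 : 0 < nm q.[x] by rewrite nm_gt0.
have -> : nm q.[x] * ((size rs)%:R / B) = nm q^`().[x] * ((size rs)%:R / (size q)%:R).
  have N0 : (size q)%:R != 0 :> R by rewrite srs pnatr_eq0.
  by rewrite /B; field; rewrite N0 !gt_eqF.
rewrite -[leLHS]mulr1 ler_pM2l // ler_pdivlMr ?mul1r ?ltr0n ?srs //.
by rewrite ler_nat ltnn.
Qed.

Lemma clim_horner (F : set_system nat) (FF : ProperFilter F) (q : {poly C})
    (xn : nat -> C) x :
  clim F xn x -> clim F (fun n => q.[xn n]) q.[x].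
Proof.
move=> hx; rewrite horner_coef.
under eq_fun do rewrite horner_coef.
by apply: clim_sum => i; apply: climM (climX _ _ hx); exact: clim_cst.
Qed.

End RootLocation.

Section Tangency.
Variables (R : realType) (d : nat).
Local Notation C := R[i].
Implicit Types (a : nat -> C).

Definition psi a (w : C) : {poly C} :=
  1 + \sum_(1 <= k < d.+1) a k *: 'X^(k.+1) - w *: 'X.

Lemma psiE a w x : x != 0 -> (psi a w).[x] = x * (phi d a x - w).
Proof.
move=> x0; rewrite /psi /phi hornerD hornerN hornerD hornerC horner_sum hornerZ hornerX.
rewrite mulrBr mulrDr mulfV // [w * x]mulrC; congr (_ + _ - _).
rewrite mulr_sumr; apply: eq_bigr => k _.
by rewrite hornerZ hornerXn exprS mulrCA.
Qed.

(** From [psi = x (phi - w)] one gets [psi - x psi' = - x^2 phi' = p]. The term [w x] cancels, so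
    the order of vanishing of [psi] at a point controls that of [p] whatever the value [w] is. *)
Lemma psi_pfun a w : psi a w - 'X * (psi a w)^`() = ppoly d a.
Proof.
rewrite /psi /ppoly derivB derivD derivC derivZ derivX linear_sum add0r mulrBr.
have -> : 'X * (w *: 1) = w *: 'X by rewrite -scalerAr mulr1.
set T := \sum_(_ <= k < _) _; set S := \sum_(_ <= k < _) _.
have -> : 1 + S - w *: 'X - ('X * T - w *: 'X) = 1 + (S - 'X * T) by ring.
congr (_ + _); rewrite /S /T mulr_sumr -sumrB -sumrN; apply: eq_bigr => k _.
rewrite /= derivZ derivXn -scalerAr mulrnAr -exprS -scaler_nat scalerA -scalerBl.
rewrite -[RHS]scaleNr; congr (_ *: _).
by rewrite -natr1; ring.
Qed.

(** [|1 - e s|^2 = 1 - 2 e Re s + e^2 |s|^2] is below 1 once [e |s|^2 < 2 Re s]; near the limit this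
    follows from [Re s > Re u / 2], [|s| < M] and [e M^2 < Re u]. *)
Lemma near_disc (s : nat -> C) u k : clim \oo s u -> 0 < Re u ->
  \forall n \near \oo, nm (1 - ((n.+1)%:R^-1 : R)%:C ^+ k.+1 * s n) < 1.
Proof.
move=> su u0.
have ch : clim \oo (fun n => ((n.+1)%:R^-1 : R)%:C ^+ k.+1) (0 ^+ k.+1).
  exact: (climX _ k.+1 (clim_harmonic R)).
pose M := nm u + 1; have M0 : 0 < M by have := nm_ge0 u; rewrite /M; lra.
have e0 : 0 < Re u / M ^+ 2 by rewrite divr_gt0 ?exprn_gt0.
rewrite expr0n in ch; have e0' : nm (0 : C) < Re u / M ^+ 2 by rewrite nm0.
have A3' := clim_nm_lt _ ch e0'.
near=> n.
have A1 : Re u / 2 < Re (s n) by near: n; apply: (clim_Re_gt _ su); lra.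
have A2 : nm (s n) < M by near: n; apply: (clim_nm_lt _ su); rewrite /M; lra.
have A3 : nm (((n.+1)%:R^-1 : R)%:C ^+ k.+1) < Re u / M ^+ 2.
  by near: n; exact: A3'.
move: A3; rewrite -rmorphXn nm_real; set e := _ ^+ k.+1.
have e_gt0 : 0 < e by rewrite exprn_gt0 // invr_gt0 ltr0n.
rewrite gtr0_norm // ltr_pdivlMr ?exprn_gt0 // => A3.
rewrite -(@ltr_pXn2r _ 2) ?nnegrE ?nm_ge0 // expr1n nm_sqr.
rewrite ReD ImD ReN ImN ReM ImM /=.
have := nm_sqr (s n); have := nm_ge0 (s n); move: A1 A2.
move: (nm (s n)) (Re (s n)) (Im (s n)) => q b c A1 A2 q0 qE.
have q2 : q ^+ 2 <= M ^+ 2 by nra.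
have : e * q ^+ 2 < 2 * b by apply: le_lt_trans (_ : e * M ^+ 2 < _); [nra|lra].
by rewrite qE => H; nra.
Unshelve. all: by end_near. Qed.

(** Put [x = z1 (1 - h^(m2+1) s)] and [y = z2 (1 - h^(m1+1) v)] with [h] tending to 0. Both [psi(x)]
    and [psi(y)] carry the power [h^((m1+1)(m2+1))], and after division [phi(x) = phi(y)] becomes a
    polynomial equation in [s]. By the balance hypothesis its limit has [u] as a simple root, so
    true solutions [s] converge to [u]; as [Re u] and [Re v] are positive, both points enter the
    disc and injectivity fails. *)
Lemma univ_tangency a z1 z2 m1 m2 (Q1 Q2 : {poly C}) u v w :
  univ d a -> nm z1 = 1 -> nm z2 = 1 ->
  psi a w = ('X - z1%:P) ^+ m1.+1 * Q1 ->
  psi a w = ('X - z2%:P) ^+ m2.+1 * Q2 ->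
  Q1.[z1] != 0 -> 0 < Re u -> 0 < Re v ->
  z2 * (- z1 * u) ^+ m1.+1 * Q1.[z1] = z1 * (- z2 * v) ^+ m2.+1 * Q2.[z2] ->
  z1 != z2 \/ (m1 = m2 /\ u != v) -> False.
Proof.
have aux (m s q t : nat) : (s <= 2)%N -> (t <= (q.-1 * s.-1).+1)%N ->
    ((m.+2 + t).-1 <= m.+1 + q + 2)%N.
  by nia.
move=> ua nz1 nz2 psi1 psi2 Q1z u0 v0 bal dist.
pose h n : C := ((n.+1)%:R^-1 : R)%:C.
have h0 k : clim \oo (fun n => h n ^+ k.+1) 0.
  have -> : (0 : C) = 0 ^+ k.+1 by rewrite expr0n.
  exact: (climX _ k.+1 (clim_harmonic R)).
pose yn n : C := z2 * (1 - h n ^+ m1.+1 * v).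
(* [K n] is [y psi(x) - x psi(y)] divided by the common power of [h], as a polynomial in [s]. *)
pose K n : {poly C} :=
  (yn n * (- z1) ^+ m1.+1) *: ('X^(m1.+1) * (Q1 \Po (z1%:P - (z1 * h n ^+ m2.+1) *: 'X)))
  - (z1 * (- z2 * v) ^+ m2.+1 * Q2.[yn n]) *: (1 - (h n ^+ m2.+1) *: 'X).
have cy : clim \oo yn z2.
  rewrite [X in clim _ _ X](_ : z2 = z2 * (1 - 0 * v)); last by ring.
  apply: climM; first exact: clim_cst.
  by apply: climB; [exact: clim_cst | apply: climM => //; exact: clim_cst].
have cl : clim \oo (fun n => z1 - z1 * h n ^+ m2.+1 * u) z1.
  rewrite [X in clim _ _ X](_ : z1 = z1 - z1 * 0 * u); last by ring.
  apply: climB; [exact: clim_cst | apply: climM; last exact: clim_cst].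
  by apply: climM => //; exact: clim_cst.
have cK : clim \oo (fun n => (K n).[u]) 0.
  have -> : (0 : C) = (z2 * (- z1) ^+ m1.+1) * (u ^+ m1.+1 * Q1.[z1])
     - (z1 * (- z2 * v) ^+ m2.+1 * Q2.[z2]) * (1 - 0 * u).
    by rewrite -bal exprMn; ring.
  rewrite /K; under eq_fun do rewrite hornerD hornerN 2!hornerZ hornerM hornerXn
    horner_comp !hornerD !hornerN !hornerC !hornerZ !hornerX.
  have cc (c : C) : clim \oo (fun=> c) c by exact: clim_cst.
  have cQ2 := clim_horner _ Q2 cy.
  have hu : clim \oo (fun n => h n ^+ m2.+1 * u) (0 * u) by exact: climM.
  have cQ1 := clim_horner _ Q1 cl.
  exact: (climB _ (climM _ (climM _ cy (cc _)) (climM _ (cc _) (cQ1 _)))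
    (climM _ (climM _ (cc _) (cQ2 _)) (climB _ (cc _) hu))).
have K'E n : (K n)^`().[u] = yn n * (- z1) ^+ m1.+1 *
     ((m1.+1)%:R * u ^+ m1 * Q1.[z1 - z1 * h n ^+ m2.+1 * u]
      - u ^+ m1.+1 * (Q1^`().[z1 - z1 * h n ^+ m2.+1 * u] * (z1 * h n ^+ m2.+1)))
   + z1 * (- z2 * v) ^+ m2.+1 * Q2.[yn n] * h n ^+ m2.+1.
  rewrite /K derivB !derivZ derivM derivXn deriv_comp !derivB !derivC !derivZ derivX.
  rewrite !(hornerD, hornerN, hornerZ, hornerM, horner_comp, hornerC, hornerX, hornerXn, hornerMn).
  by rewrite /= -mulr_natl; ring.
have cK' : clim \oo (fun n => (K n)^`().[u])
    (z2 * (- z1) ^+ m1.+1 * ((m1.+1)%:R * u ^+ m1 * Q1.[z1])).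
  under eq_fun do rewrite K'E.
  have -> : z2 * (- z1) ^+ m1.+1 * ((m1.+1)%:R * u ^+ m1 * Q1.[z1]) =
     z2 * (- z1) ^+ m1.+1 * ((m1.+1)%:R * u ^+ m1 * Q1.[z1]
     - u ^+ m1.+1 * (Q1^`().[z1] * (z1 * 0))) + z1 * (- z2 * v) ^+ m2.+1 * Q2.[z2] * 0.
    by ring.
  have cc (c : C) : clim \oo (fun=> c) c by exact: clim_cst.
  have cQ2 := clim_horner _ Q2 cy.
  have cQ1 := clim_horner _ Q1 cl.
  have cQ1' := clim_horner _ Q1^`() cl.
  exact: (climD _ (climM _ (climM _ cy (cc _)) (climB _ (climM _ (cc _) (cQ1 _))
    (climM _ (cc _) (climM _ (cQ1' _) (climM _ (cc _) (h0 m2))))))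
    (climM _ (climM _ (cc _) (cQ2 _)) (h0 m2))).
have u_neq0 : u != 0 by apply: contraTneq u0 => ->; rewrite /= ltxx.
have z10 := circle_neq0 nz1; have z20 := circle_neq0 nz2.
set K'0 := (X in clim _ _ X) in cK'.
have K'0_neq0 : K'0 != 0.
  by rewrite !mulf_neq0 ?expf_neq0 ?oppr_eq0 // pnatr_eq0.
pose B := nm K'0 / 2; have B0 : 0 < B by rewrite divr_gt0 ?nm_gt0.
(* A bound on the sizes of all [K n] at once, which makes the root estimate uniform in [n]. *)
pose N := (m1.+1 + size Q1 + 2)%N.
have sK n : (size (K n) <= N)%N.
  rewrite /K (leq_trans (size_polyD _ _)) // geq_max size_polyN.
  rewrite !(leq_trans (size_scale_leq _ _)) //.
    rewrite (leq_trans (size_polyD _ _)) // geq_max size_poly1 size_polyN.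
    by rewrite (leq_trans (size_scale_leq _ _)) ?size_polyX // /N leq_addl.
  rewrite (leq_trans (size_polyMleq _ _)) // size_polyXn.
  have H2 := size_comp_poly_leq Q1 (z1%:P - (z1 * h n ^+ m2.+1) *: 'X).
  have H1 : (size (z1%:P - (z1 * h n ^+ m2.+1) *: 'X : {poly C})%R <= 2)%N.
    rewrite (leq_trans (size_polyD _ _)) // geq_max size_polyN.
    by rewrite (leq_trans (size_polyC_leq1 _)) // (leq_trans (size_scale_leq _ _)) ?size_polyX.
  exact: aux H1 H2.
have s_ n : exists s, 0 < nm (K n)^`().[u] ->
    (K n).[s] = 0 /\ nm (s - u) <= N%:R * nm (K n).[u] / nm (K n)^`().[u].
  have [p|np] := ltP 0 (nm (K n)^`().[u]); last by exists 0.
  move: (p); rewrite nm_gt0 => /root_near_critical [xi /rootP rxi dxi].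
  exists xi => _; split=> //; apply: le_trans dxi _.
  by rewrite ler_pM2r ?invr_gt0 // ler_wpM2r ?nm_ge0 // ler_nat.
have [s sP] := choice s_.
have nearK' : \forall n \near \oo, B < nm (K n)^`().[u].
  by apply: (clim_nm_gt _ cK'); move: B0; rewrite /B; lra.
have cs : clim \oo s u.
  apply: (@clim_le _ _ _ (fun n => N%:R * nm (K n).[u] / B)).
    rewrite -[X in _ --> X](mul0r B^-1) -(mulr0 N%:R) -(nm0 R).
    by apply: cvgMl; apply: cvgMr; exact: clim_nm.
  near=> n; have Bn : B < nm (K n)^`().[u] by near: n.
  have Kn := lt_trans B0 Bn; have [_ /le_trans] := sP n Kn; apply.
  rewrite ler_wpM2l ?mulr_ge0 ?nm_ge0 ?ler0n // lef_pV2 ?posrE //; exact: ltW.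
pose xn n := z1 * (1 - h n ^+ m2.+1 * s n).
have cx : clim \oo xn z1.
  rewrite [X in clim _ _ X](_ : z1 = z1 * (1 - 0 * u)); last by ring.
  have cc (c : C) : clim \oo (fun=> c) c by exact: clim_cst.
  exact: (climM _ (cc _) (climB _ (cc _) (climM _ (h0 m2) cs))).
have E1 := near_disc m2 cs u0.
have E2 : \forall n \near \oo, nm (1 - h n ^+ m1.+1 * v) < 1.
  by apply: (near_disc m1 _ v0); exact: clim_cst.
(* Distinct base points separate the pair at once; over a common base point with [m1 = m2] the
   difference is a nonzero multiple of [s n - v], which tends to [u - v]. *)
have E3 : \forall n \near \oo, xn n != yn n.
  have [z12|z12] := eqVneq z1 z2; last first.
    have z12' : 0 < nm (z1 - z2) by rewrite nm_gt0 subr_eq0.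
    near=> n; have : 0 < nm (xn n - yn n).
      by near: n; apply: (clim_nm_gt _ (climB _ cx cy)).
    by rewrite nm_gt0 subr_eq0.
  case: dist => [|[m12 uv]]; first by rewrite z12 eqxx.
  have uv' : 0 < nm (u - v) by rewrite nm_gt0 subr_eq0.
  near=> n; have : 0 < nm (s n - v).
    by near: n; apply: (clim_nm_gt _ (climB _ cs (clim_cst _ v))).
  rewrite nm_gt0 subr_eq0; apply: contra_neq; rewrite /xn /yn -z12 -m12.
  move/(mulfI z10)/addrI/oppr_inj/mulfI; apply; rewrite expf_neq0 //.
  by rewrite -nm_gt0 /h nm_real ger0_norm ?invr_gt0 ?invr_ge0 ?ltr0n ?ler0n.
have [n [x1 y1 x0 y0 [xy Kn]]] : exists n,
    [/\ nm (xn n) < 1, nm (yn n) < 1, xn n != 0, yn n != 0 &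
        xn n != yn n /\ (K n).[s n] = 0].
  apply: (@filter_ex _ \oo); near=> n; split.
  - by rewrite nmM nz1 mul1r; near: n; exact: E1.
  - by rewrite nmM nz2 mul1r; near: n; exact: E2.
  - rewrite -nm_gt0; near: n; apply: (clim_nm_gt _ cx).
    by rewrite nz1 ltr01.
  - rewrite -nm_gt0; near: n; apply: (clim_nm_gt _ cy).
    by rewrite nz2 ltr01.
  - split; first by near: n; exact: E3.
    by have [] // := sP n; apply: lt_trans B0 _; near: n.
have E : h n ^+ (m1.+1 * m2.+1) * (K n).[s n] =
    yn n * (psi a w).[xn n] - xn n * (psi a w).[yn n].
  have -> : (psi a w).[xn n] = (xn n - z1) ^+ m1.+1 * Q1.[xn n].
    by rewrite psi1 hornerM horner_exp hornerXsubC.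
  have -> : (psi a w).[yn n] = (yn n - z2) ^+ m2.+1 * Q2.[yn n].
    by rewrite psi2 hornerM horner_exp hornerXsubC.
  rewrite /K hornerD hornerN 2!hornerZ hornerM hornerXn
    horner_comp !hornerD !hornerN !hornerC !hornerZ !hornerX.
  have -> : z1 - z1 * h n ^+ m2.+1 * s n = xn n by rewrite /xn; ring.
  have -> : xn n - z1 = h n ^+ m2.+1 * (- z1 * s n) by rewrite /xn; ring.
  have -> : yn n - z2 = h n ^+ m1.+1 * (- z2 * v) by rewrite /yn; ring.
  rewrite !exprMn -!exprM [(m2.+1 * m1.+1)%N]mulnC /xn.
  by move: (h n ^+ _) (h n ^+ _) (s n ^+ _) Q1.[_] => *; ring.
move: E; rewrite Kn mulr0 !psiE // => E.
have /eqP : (yn n - xn n) * gfun d a (xn n) (yn n) = 0.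
  by rewrite -phiB // [RHS]E; ring.
by rewrite mulf_eq0 subr_eq0 [yn n == _]eq_sym (negPf xy) (negPf (ua _ _ x1 y1 xy)).
Unshelve. all: by end_near. Qed.

End Tangency.

Section UnitCircle.
Variable R : realType.
Local Notation C := R[i].

Definition expi (t : R) : C := cos t +i* sin t.

Lemma expi0 : expi 0 = 1. Proof. by rewrite /expi cos0 sin0. Qed.
Lemma expiD s t : expi (s + t) = expi s * expi t.
Proof.
rewrite /expi cosD sinD; apply: complex_ext; rewrite ?ReM ?ImM //=.
by rewrite addrC.
Qed.
Lemma expi_pi : expi pi = -1.
Proof. by rewrite /expi cospi sinpi; apply: complex_ext => /=; rewrite ?oppr0. Qed.
Lemma nm_expi t : nm (expi t) = 1.
Proof. by rewrite /= cos2Dsin2 sqrtr1. Qed.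
Lemma expiX t n : expi t ^+ n = expi (n%:R * t).
Proof.
elim: n => [|n IH]; first by rewrite mul0r expi0.
by rewrite exprS IH -expiD -natr1 mulrDl mul1r addrC.
Qed.
Lemma expiN t : expi (- t) = (cj (expi t)).
Proof. by rewrite /expi cosN sinN. Qed.

(** Quotients of two points of the open right half-plane have every argument in [(-pi, pi)], so only
    the closed negative half-line is out of reach. *)
Lemma halfplane_rotation (B : C) : Im B != 0 \/ 0 < Re B ->
  exists2 u : C, 0 < Re u & 0 < Re (u * B).
Proof.
have [Im0 [//|B0]|ImB _] := eqVneq (Im B) 0.
  by exists 1; rewrite ?mul1r //= ltr01.
exists (1 +i* (- (1 + `|Re B|) / Im B)); first exact: ltr01.
rewrite ReM /= mul1r mulrAC mulfK //.
have := ler_norm (- Re B); rewrite normrN; lra.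
Qed.

(** Squares of half-plane points already have every argument in [(-pi, pi)]; the quarter turn of
    freedom in the target then reaches every nonzero [B]. This is the case of a cusp meeting a
    smooth branch. *)
Lemma halfplane_square (B : C) : B != 0 ->
  exists2 u : C, 0 < Re u & 0 < Re (u ^+ 2 * B).
Proof.
move=> B0.
have [ImB|ImB] := eqVneq (Im B) 0.
  have ReB : Re B != 0.
    by apply: contra_neq B0 => ReB; apply: complex_ext.
  have [Bp|Bn] := ltP 0 (Re B).
    by exists 1; rewrite ?expr1n ?mul1r //= ltr01.
  exists (1 +i* 2); first exact: ltr01.
  rewrite ReM expr2 ReM ImM /= ImB.
  have : Re B < 0 by rewrite lt_neqAle ReB Bn.
  lra.
have [Bp|Bn] := ltP 0 (Im B).
  exists (1 +i* (-1)); first exact: ltr01.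
  by rewrite ReM expr2 ReM ImM /=; lra.
exists (1 +i* 1); first exact: ltr01.
rewrite ReM expr2 ReM ImM /=.
have : Im B < 0 by rewrite lt_neqAle ImB Bn.
lra.
Qed.

(** The two square roots of [B] are not both on the negative half-line, so one of them is a quotient
    of half-plane points. This is the case of two cusps. *)
Lemma halfplane_sqrt (B : C) : B != 0 ->
  exists u v : C, [/\ 0 < Re u, 0 < Re v & v ^+ 2 = u ^+ 2 * B].
Proof.
move=> B0; set s := sqrtc B; have sB : s ^+ 2 = B := sqr_sqrtc B.
have key (t : C) : t ^+ 2 = B -> 0 < Re t ->
    exists u v : C, [/\ 0 < Re u, 0 < Re v & v ^+ 2 = u ^+ 2 * B].
  by move=> tB t0; exists 1, t; rewrite expr1n mul1r; split=> //=; exact: ltr01.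
have s0 : s != 0 by rewrite /s sqrtc_eq0.
have [sp|sn|sz] := ltgtP 0 (Re s); first exact: key sp.
  by apply: (key (- s)); rewrite ?sqrrN // ReN oppr_gt0.
have Ims : Im s != 0 by apply: contra_neq s0 => Ims; apply: complex_ext.
have key2 (t : C) : t ^+ 2 = B -> Re t = 0 -> 0 < Im t ->
    exists u v : C, [/\ 0 < Re u, 0 < Re v & v ^+ 2 = u ^+ 2 * B].
  move=> tB Ret Imt; exists (1 -i* 1), ((1 -i* 1) * t).
  by rewrite exprMn tB; split=> //; rewrite ?ReM ?Ret /= ?ltr01 //; lra.
have [ip|in_] := ltP 0 (Im s); first exact: key2 ip.
apply: (key2 (- s)); rewrite ?sqrrN // ?ReN -?sz ?oppr0 // ImN oppr_gt0.
by rewrite lt_neqAle Ims.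
Qed.

End UnitCircle.

Section BoundaryContact.
Variables (R : realType) (d : nat).
Local Notation C := R[i].
Variable a : nat -> C.
Hypothesis ua : univ d a.

Lemma psi_neq0 w : psi d a w != 0.
Proof.
apply: contra_neq (oner_neq0 C) => E.
have := congr1 (fun q => (q - 'X * q^`()).[0]) E.
by rewrite psi_pfun ppolyE pfun0 => ->; rewrite derivC mulr0 subr0 horner0.
Qed.

(** A zero of [psi] of order at least 3 would spread the half-plane of inward directions at [z] over
    an angle of at least [3 pi], so that two directions get the same image. Order 1 gives a smooth
    branch, order 2 a simple zero of [p]. *)
Lemma psi_order z : nm z = 1 ->
  exists m Q, [/\ psi d a (phi d a z) = ('X - z%:P) ^+ m.+1 * Q, Q.[z] != 0 &
    (m = 0%N /\ pfun d a z = - z * Q.[z]) \/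
    (m = 1%N /\ pfun d a z = 0 /\ (ppoly d a)^`().[z] != 0)].
Proof.
move=> nz; have z0 := circle_neq0 nz; set w := phi d a z.
have [m [q]] := multiplicity_XsubC (psi d a w) z.
rewrite psi_neq0 /= => qz; rewrite mulrC => E.
have {}qz : q.[z] != 0 by apply: contra qz => /eqP ?; apply/rootP.
case: m E => [|m] E.
  have : (psi d a w).[z] = 0 by rewrite psiE // subrr mulr0.
  by rewrite E expr0 mul1r => /eqP; rewrite (negPf qz).
exists m, q; split=> //.
have pE := psi_pfun d a w.
case: m E => [|[|m]] E; [left; split=> //|right; split=> //|exfalso].
- rewrite -ppolyE -pE E expr1 derivM derivXsubC mul1r.
  by rewrite !(hornerD, hornerM, hornerN, hornerX, hornerC); ring.
- have p'E : (ppoly d a)^`() = - ('X * (psi d a w)^`()^`()).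
    by rewrite -pE derivB derivM derivX; ring.
  split.
    rewrite -ppolyE -pE E expr2 !derivM derivXsubC mul1r mulr1.
    by rewrite !(hornerD, hornerM, hornerN, hornerX, hornerC); ring.
  rewrite p'E E expr2 !(derivXsubC, derivM, derivD, mul1r, mulr1, derivC).
  rewrite !(hornerD, hornerM, hornerN, hornerX, hornerC) subrr.
  rewrite !(mulr0, mul0r, add0r, addr0) oppr_eq0 -mulr2n -mulr_natl.
  by rewrite mulr1 !mulf_neq0 ?pnatr_eq0.
(* The powers of order [m + 3] of [expi t] and [expi (- t)] are both [-1]. The order being at least
   3 gives [t < pi / 2], which puts both in the open right half-plane. *)
- pose t : R := pi / (m.+3)%:R.
  have m0 : 0 < (m.+3)%:R^-1 :> R by rewrite invr_gt0 ltr0n.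
  have t0 : 0 < t by rewrite mulr_gt0 // pi_gt0.
  have t1 : t < pi / 2.
    by rewrite ltr_pM2l ?pi_gt0 // ltf_pV2 ?posrE ?ltr0n // ltr_nat.
  have cost : 0 < cos t by apply: cos_gt0_pihalf; rewrite t1 andbT; lra.
  have sint : 0 < sin t by apply: sin_gt0_pihalf; rewrite t0.
  have tm : (m.+3)%:R * t = pi by rewrite /t mulrC mulfVK // pnatr_eq0.
  apply: (univ_tangency (u := expi t) (v := expi (- t)) ua nz nz E E qz).
  - by [].
  - by rewrite /= cosN.
  - rewrite !exprMn !expiX mulrN tm expiN expi_pi.
    by rewrite (rmorphN1 (@conjc R)).
  - right; split=> //; rewrite expiN; apply/eqP => /(congr1 (@Im R)) /=; lra.
Qed.

(** Each smooth branch fills a half-plane of directions at the common value, and unless these are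
    opposite half-planes some directions coincide. A cusp fills a whole turn and so can meet no
    other branch, whence [p(z2) != 0]. *)
Lemma double_point_normals z1 z2 : nm z1 = 1 -> nm z2 = 1 -> z1 != z2 ->
  phi d a z1 = phi d a z2 ->
  pfun d a z2 != 0 /\
  exists2 r : R, r < 0 & pfun d a z1 / z1 = r%:C * (pfun d a z2 / z2).
Proof.
move=> n1 n2 z12 phi12.
have z10 := circle_neq0 n1; have z20 := circle_neq0 n2.
have [m1 [Q1 [E1 Q10 c1]]] := psi_order n1.
have [m2 [Q2 [E2 Q20 c2]]] := psi_order n2.
rewrite phi12 in E1.
have tan u v := @univ_tangency _ _ _ _ _ _ _ _ _ u v _ ua n1 n2 E1 E2 Q10.
have {}tan u v : 0 < Re u -> 0 < Re v -> z2 * (- z1 * u) ^+ m1.+1 * Q1.[z1] =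
   z1 * (- z2 * v) ^+ m2.+1 * Q2.[z2] -> False.
  by move=> u0 v0 E; apply: tan u0 v0 E _; left.
case: c1 c2 tan => [[-> p1]|[-> [p1 _]]] [[-> p2]|[-> [p2 _]]] tan.
- split; first by rewrite p2 mulNr oppr_eq0 mulf_neq0.
  pose B := Q1.[z1] / Q2.[z2].
  have B0 : B != 0 by rewrite mulf_neq0 ?invr_eq0.
  have nB : ~ (Im B != 0 \/ 0 < Re B).
    move=> /halfplane_rotation[u u0 uB]; apply: (tan u (u * B)) => //.
    by rewrite /B !expr1; field.
  have ImB : Im B = 0 by apply/eqP/negPn/negP => ?; apply: nB; left.
  exists (Re B).
    rewrite lt_neqAle leNgt; apply/andP; split; last by apply/negP => ?; apply: nB; right.
    by apply: contra_neq B0 => ReB; apply: complex_ext.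
  have -> : (Re B)%:C = B by apply: complex_ext.
  by rewrite p1 p2 /B; field; rewrite ?z10 ?z20 ?Q20.
- exfalso; have B0 : - z2 * Q2.[z2] / Q1.[z1] != 0.
    by rewrite !mulf_neq0 ?invr_eq0 ?oppr_eq0.
  have [v v0 vB] := halfplane_square B0; apply: (tan _ _ vB v0).
  by rewrite expr1; field.
- exfalso; have B0 : - z1 * Q1.[z1] / Q2.[z2] != 0.
    by rewrite !mulf_neq0 ?invr_eq0 ?oppr_eq0.
  have [u u0 uB] := halfplane_square B0; apply: (tan _ _ u0 uB).
  by rewrite expr1; field.
- exfalso; have B0 : z1 * Q1.[z1] / (z2 * Q2.[z2]) != 0.
    by rewrite !mulf_neq0 ?invr_eq0 ?mulf_neq0.
  have [u [v [u0 v0 uv]]] := halfplane_sqrt B0; apply: (tan _ _ u0 v0).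
  by rewrite !exprMn uv; field; rewrite ?z10 ?z20 ?Q20.
Qed.

End BoundaryContact.

(** * Self-reciprocity of the derivative *)

Section SelfReciprocal.
Variables (R : realType) (d : nat).
Local Notation C := R[i].
Implicit Types (a b : nat -> C) (x y z : C) (zs : seq C).

Lemma size_ppoly_sub a : (0 < d)%N -> a d = - (d%:R)^-1 ->
  (size (ppoly d a - 'X^(d.+1))%R <= d.+1)%N.
Proof.
move=> d0 ad; rewrite /ppoly big_nat_recr //= ad mulrN mulfV; last first.
  by rewrite pnatr_eq0 -lt0n.
rewrite scaleN1r opprD opprK addrA addrK.
rewrite (leq_trans (size_polyD _ _)) // geq_max size_poly1 size_polyN /=.
rewrite big_nat; apply: leq_trans (size_sum _ _ _) _.
apply/bigmax_leqP_seq => k _ /andP[k1 kd].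
by rewrite (leq_trans (size_scale_leq _ _)) // size_polyXn; lia.
Qed.

Lemma ppoly_monic a : (0 < d)%N -> a d = - (d%:R)^-1 ->
  size (ppoly d a) = d.+2 /\ lead_coef (ppoly d a) = 1.
Proof.
move=> d0 ad; have sz := size_ppoly_sub d0 ad.
have -> : ppoly d a = 'X^(d.+1) + (ppoly d a - 'X^(d.+1)) by rewrite addrC subrK.
rewrite size_polyDl ?size_polyXn ?ltnS // lead_coefDl ?size_polyXn ?ltnS //.
by rewrite lead_coefXn.
Qed.

Lemma prod_ge1_eq1 (rs : seq R) : all (fun r => 1 <= r) rs ->
  \prod_(r <- rs) r = 1 -> all (fun r => r == 1) rs.
Proof.
elim: rs => [//|r s IH] /= /andP[r1 s1]; rewrite big_cons.
have : 1 <= \prod_(t <- s) t.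
  elim: (s) s1 => [|t u IHu] /=; first by rewrite big_nil.
  by case/andP=> t1 u1; rewrite big_cons mulr_ege1 ?IHu.
move=> P1 E; have P : \prod_(t <- s) t = 1.
  by apply/eqP; rewrite eq_le P1 andbT; nra.
by rewrite IH // andbT; move: E; rewrite P mulr1 => ->.
Qed.

Lemma uniq_simple_roots zs :
  (forall z, z \in zs -> (\prod_(r <- zs) ('X - r%:P))^`().[z] != 0) -> uniq zs.
Proof.
elim: zs => [//|z s IH] H /=.
have E w : (\prod_(r <- z :: s) ('X - r%:P))^`().[w] =
  (\prod_(r <- s) ('X - r%:P)).[w] + (w - z) * (\prod_(r <- s) ('X - r%:P))^`().[w].
  by rewrite big_cons derivM derivXsubC mul1r hornerD hornerM hornerXsubC.
apply/andP; split.
  have := H z (mem_head _ _); rewrite E subrr mul0r addr0.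
  by apply: contra => zs; apply/eqP/rootP; rewrite root_prod_XsubC.
apply: IH => w ws; have := H w; rewrite in_cons ws orbT E => /(_ isT).
have /rootP -> : root (\prod_(r <- s) ('X - r%:P)) w by rewrite root_prod_XsubC.
by rewrite add0r; apply: contra_neq => ->; rewrite mulr0.
Qed.

Definition circle_roots a zs :=
  [/\ ppoly d a = \prod_(z <- zs) ('X - z%:P), size zs = d.+1 &
      forall z, z \in zs -> nm z = 1].

Lemma circle_rootsE a zs x : circle_roots a zs -> pfun d a x = \prod_(z <- zs) (x - z).
Proof.
case=> E _ _; rewrite -ppolyE E horner_prod.
by apply: eq_bigr => z _; rewrite hornerXsubC.
Qed.

(** [p] has no zero in the open disc, while [a d = -1/d] makes it monic with [p(0) = 1]; moduli at
    least 1 with product 1 are all 1. Simplicity comes from the bound on the order of contact. *)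
Lemma univ_circle_roots a : (0 < d)%N -> univ d a -> a d = - (d%:R)^-1 ->
  exists2 zs, circle_roots a zs & uniq zs.
Proof.
move=> d0 ua ad; have [sp lp] := ppoly_monic d0 ad.
have [zs] := closed_field_poly_normal (ppoly d a); rewrite lp scale1r => E.
have rt z : z \in zs -> pfun d a z = 0.
  by move=> zzs; rewrite -ppolyE; apply/rootP; rewrite E root_prod_XsubC.
have ge1 z : z \in zs -> 1 <= nm z.
  move=> zzs; rewrite leNgt; apply/negP => z1.
  by have := univ_neq0 ua z1 z1; rewrite gfun_diag rt // eqxx.
have eq1 : all (fun r => r == 1) [seq nm z | z <- zs].
  apply: prod_ge1_eq1; first by rewrite all_map; apply/allP => z /= /ge1.
  rewrite big_map; transitivity (nm (pfun d a 0)); last by rewrite pfun0 nm1.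
  rewrite -ppolyE E horner_prod nm_prod.
  by apply: eq_bigr => z _; rewrite hornerXsubC sub0r nmN.
have nz z : z \in zs -> nm z = 1.
  by move=> zzs; apply/eqP; move: eq1; rewrite all_map => /allP /(_ z zzs).
exists zs; first by split=> //; apply: succn_inj; rewrite -sp E size_prod_XsubC.
apply: uniq_simple_roots => z zzs; rewrite -E.
have [m [Q [_ Q0]]] := psi_order ua (nz z zzs).
case=> [[_ p0]|[_ [_ //]]]; move: (rt z zzs); rewrite p0 => /eqP.
by rewrite mulf_eq0 oppr_eq0 (negPf (circle_neq0 (nz z zzs))) (negPf Q0).
Qed.

Definition self_reciprocal a := forall x, x != 0 ->
  x ^+ d.+1 * (cj (pfun d a ((cj x))^-1)) = pfun d a x.

(** Reflection in the circle fixes each root, and the constant factor is 1 because the product of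
    the [- z] is [p(0) = 1]. *)
Lemma circle_roots_reciprocal a zs : circle_roots a zs -> self_reciprocal a.
Proof.
move=> cz x x0; have [_ szs nz] := cz.
have pE := circle_rootsE _ cz; rewrite !pE conjc_prod -szs.
have P0 : \prod_(z <- zs) (- z) = 1.
  transitivity (pfun d a 0); last exact: pfun0.
  by rewrite pE; apply: eq_bigr => z _; rewrite sub0r.
suff -> : x ^+ size zs * \prod_(z <- zs) (cj (((cj x))^-1 - z)) = \prod_(z <- zs) ((x - z) * (- z)^-1).
  by rewrite big_split /= prodfV P0 invr1 mulr1.
elim: (zs) nz => [|z s IH] nz; first by rewrite !big_nil expr0 mulr1.
rewrite !big_cons exprS mulrACA IH => [|w ws]; last by apply: nz; rewrite in_cons ws orbT.
congr (_ * _); have z1 := nz z (mem_head _ _).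
rewrite conjcB conjc_V conjcK (circle_conj z1).
by field; rewrite x0 circle_neq0.
Qed.

Lemma self_reciprocal_circle a x : self_reciprocal a -> nm x = 1 ->
  x ^+ d.+1 * (cj (pfun d a x)) = pfun d a x.
Proof.
move=> sr x1; have x0 := circle_neq0 x1.
by rewrite -[RHS]sr // (circle_conj x1) invrK.
Qed.

(** This is [- x phi'(x)], the derivative of [phi] along the inward radius; for [x] on the circle it
    is normal to the boundary curve and points into the image. *)
Definition normal a x : C := pfun d a x / x.

(** A nonzero normal thus has quotient [x^(d-1)] by its conjugate: the line it spans depends on [x]
    but not on [a]. Besides locating double points, this makes the normals of two such functions at
    [x] real multiples of each other. *)
Lemma normal_conj a x : (0 < d)%N -> self_reciprocal a -> nm x = 1 ->
  x ^+ d.-1 * (cj (normal a x)) = normal a x.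
Proof.
move=> d0 sr x1; have x0 := circle_neq0 x1; rewrite /normal.
rewrite -[in RHS](self_reciprocal_circle sr x1) conjcM conjc_V (circle_conj x1) invrK.
have -> : x ^+ d.+1 = x ^+ d.-1 * x * x by rewrite -!exprSr prednK.
by move: (cj _) => w; field.
Qed.

Lemma normal_parallel a x y (r : R) : (0 < d)%N -> self_reciprocal a -> nm x = 1 -> nm y = 1 ->
  normal a y != 0 -> normal a x = r%:C * normal a y -> r != 0 -> x ^+ d.-1 = y ^+ d.-1.
Proof.
move=> d0 sr x1 y1 ny E r0.
have r0' : r%:C != 0 by rewrite -nm_eq0 nm_real normr_eq0.
have ny' : (cj (normal a y)) != 0 by rewrite conjc_eq0.
have := normal_conj d0 sr x1; rewrite E conjcM conjc_real.
rewrite -[in RHS](normal_conj d0 sr y1) [LHS]mulrCA => /(mulfI r0') /(mulIf ny').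
exact.
Qed.

End SelfReciprocal.

(** * Double points do not cross *)

Section PrincipalSquareRoot.
Variable R : realType.
Local Notation C := R[i].
Implicit Types u s : C.

Lemma Re_sqrtc_ge0 u : 0 <= Re (sqrtc u).
Proof. by case: u => a b; exact: sqrtr_ge0. Qed.

Lemma nm_sqrtc u : nm (sqrtc u) ^+ 2 = nm u.
Proof. by rewrite -nmX sqr_sqrtc. Qed.

(** [0 <= Re u] with [u != 0] keeps [u] off the branch cut, so [Re s = 0] cannot occur. The weak
    inequality on [s] is wanted because it passes to limits. *)
Lemma sqrtc_uniq u s : s ^+ 2 = u -> 0 <= Re s -> 0 <= Re u -> u != 0 -> s = sqrtc u.
Proof.
move=> su s0 u0 un0; have := sqr_sqrtc u; rewrite -{2}su => /eqP.
rewrite eqf_sqr => /orP[/eqP //|/eqP E].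
have := Re_sqrtc_ge0 u; rewrite E ReN oppr_ge0 => s0'.
have Res : Re s = 0 by apply/eqP; rewrite eq_le s0'.
have : Im s ^+ 2 <= 0.
  by move: u0; rewrite -su expr2 ReM Res mul0r sub0r oppr_ge0.
rewrite le_eqVlt ltNge sqr_ge0 orbF expf_eq0 /= => /eqP Ims.
by move: un0; rewrite -su (_ : s = 0) ?expr0n ?eqxx //; apply: complex_ext.
Qed.

Lemma sqrtc_conj u : 0 <= Re u -> u != 0 -> sqrtc (cj u) = cj (sqrtc u).
Proof.
move=> u0 un0; apply/esym/sqrtc_uniq; rewrite ?Re_conjc ?Re_sqrtc_ge0 //.
  by rewrite -conjcX sqr_sqrtc.
by rewrite conjc_eq0.
Qed.

Lemma clim_sqrtc (U : set_system nat) (UU : UltraFilter U) (M : R) (un : nat -> C) u :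
  (forall n, nm (un n) <= M) -> (forall n, 0 <= Re (un n)) -> u != 0 ->
  clim U un u -> clim U (fun n => sqrtc (un n)) (sqrtc u).
Proof.
move=> bd ge0 u0 cu.
have [l cl] : exists l, clim U (fun n => sqrtc (un n)) l.
  apply: (@ultra_clim _ _ UU (1 + M)) => n.
  by have := nm_sqrtc (un n); have := bd n; have := nm_ge0 (sqrtc (un n)); nra.
suff <- : l = sqrtc u by [].
apply: sqrtc_uniq => //.
- apply: (@clim_uniq _ U _ un) => //.
  have : clim U (fun n => sqrtc (un n) ^+ 2) (l ^+ 2) by exact: climX.
  by under eq_fun do rewrite sqr_sqrtc.
- have [cre _] := cl; rewrite -(cvg_lim (@Rhausdorff R) cre).
  apply: limr_ge; first exact: cvgP cre.
  by apply: filterE => n; exact: Re_sqrtc_ge0.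
- have [cre _] := cu; rewrite -(cvg_lim (@Rhausdorff R) cre).
  apply: limr_ge; first exact: cvgP cre.
  by apply: filterE => n; exact: ge0.
Qed.

End PrincipalSquareRoot.

(** The supremum of the points satisfying [P] satisfies it by the first closure condition; were it
    below 1, points failing [P] would approach it from the right and contradict the second. *)
Lemma unit_interval_connected (R : realType) (P : R -> Prop) : P 0 ->
  (forall (en : nat -> R) (e : R), (forall n, 0 <= en n <= 1) -> 0 <= e <= 1 ->
     en @ \oo --> e -> (forall n, P (en n)) -> P e) ->
  (forall (en : nat -> R) (e : R), (forall n, 0 <= en n <= 1) -> 0 <= e <= 1 ->
     en @ \oo --> e -> (forall n, ~ P (en n)) -> ~ P e) ->
  P 1.
Proof.
move=> P0 Pcl nPcl; pose A := [set e : R | 0 <= e <= 1 /\ P e].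
have A0 : A 0 by split; rewrite ?lexx ?ler01.
have ubA : ubound A 1 by move=> e [/andP[]].
have hsA : has_sup A by split; [exists 0 | exists 1].
set s := sup A; have leA e : A e -> e <= s by exact: sup_upper_bound.
have s0 : 0 <= s by exact: leA.
have s1 : s <= 1 by apply: ge_sup => //; exists 0.
have hn n : 0 < (n.+1)%:R^-1 :> R by rewrite invr_gt0.
have en_ n : exists e, A e /\ s - (n.+1)%:R^-1 < e.
  by have [e Ae] := sup_adherent (hn n) hsA; exists e.
have [en enP] := choice en_.
have Ps : P s.
  apply: (Pcl en) => //; [by move=> n; have [[]] := enP n | by rewrite s0| |].
    apply/cvgrPdist_lt => e e0.
    have he : \forall n \near \oo, (n.+1)%:R^-1 < e.
      by have /cvgr_lt := @cvg_harmonic R; apply.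
    near=> n.
    have [Ae lt] := enP n; have le_s := leA _ Ae.
    rewrite ger0_norm ?subr_ge0 //.
    have lt2 : (n.+1)%:R^-1 < e by near: n.
    by rewrite ltrBlDr -ltrBlDl; apply: lt_trans lt; rewrite ltrD2l ltrN2.
  by move=> n; have [[]] := enP n.
move: s1; rewrite le_eqVlt => /orP[/eqP <- //|s1].
exfalso; apply: (nPcl (fun n => s + (1 - s) * (n.+1)%:R^-1) s) Ps => //.
- move=> n; have h1 := hn n; have : (n.+1)%:R^-1 <= 1 :> R by rewrite invf_le1 // ler1n.
  by move: h1; move: (_^-1) => h *; nra.
- by rewrite s0 ltW.
- have E : s = s + (1 - s) * 0 by rewrite mulr0 addr0.
  rewrite [X in _ --> X]E.
  apply: cvgD; first exact: cvg_cst.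
  by apply: cvgMr; exact: cvg_harmonic.
- move=> n Pn; have h1 := hn n.
  have h2 : (n.+1)%:R^-1 <= 1 :> R by rewrite invf_le1 // ler1n.
  have : s + (1 - s) * (n.+1)%:R^-1 <= s.
    apply: leA; split=> //; move: h1 h2; move: (_^-1) => h *; nra.
  by rewrite gerDl leNgt mulr_gt0 // subr_gt0.
Unshelve. all: by end_near. Qed.

Section NonCrossing.
Variables (R : realType) (d : nat) (a : nat -> R[i]).
Local Notation C := R[i].
Implicit Types (x y : C) (e : R).

Lemma linear_factors_uniq (s t : seq C) : size s = size t ->
  (forall x, \prod_(w <- s) (1 - w * x) = \prod_(w <- t) (1 - w * x)) -> perm_eq s t.
Proof.
move=> st E; apply: prod_XsubC_eq.
have F (r : seq C) x : x != 0 ->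
    (\prod_(w <- r) ('X - w%:P)).[x] = x ^+ size r * \prod_(w <- r) (1 - w * x^-1).
  move=> x0; elim: r => [|w r IH]; first by rewrite !big_nil hornerC mulr1.
  by rewrite !big_cons hornerM hornerXsubC IH /= exprS mulrACA; congr (_ * _); field.
apply/eqP; rewrite -subr_eq0; set p := _ - _; apply/negP => /negP p0.
pose rs := [seq ((i.+1)%:R : C) | i <- iota 0 (size p)].
have : (size rs < size p)%N.
  apply: max_poly_roots => //.
    apply/allP => _ /mapP[i _ ->]; have i0 : (i.+1)%:R != 0 :> C by rewrite pnatr_eq0.
    by apply/rootP; rewrite /p hornerD hornerN !F // E st subrr.
  rewrite map_inj_uniq ?iota_uniq // => i j /eqP.
  by rewrite eqr_nat eqSS => /eqP.
by rewrite size_map size_iota ltnn.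
Qed.

(** The order of the list is an arbitrary choice and need not vary continuously with [y]; the
    arguments below use products over the whole list. *)
Definition omega y : seq C := projT1 (cid (gfun_factor d a y)).

Lemma size_omega y : size (omega y) = d.
Proof. by rewrite /omega; case: cid => ? []. Qed.

Lemma omegaE x y : gfun d a x y = \prod_(w <- omega y) (1 - w * x).
Proof. by rewrite /omega; case: cid => ? []. Qed.

Lemma omega_nth (F : C -> C) y :
  \prod_(w <- omega y) F w = \prod_(0 <= i < d) F (nth 0 (omega y) i).
Proof. by rewrite (big_nth 0) size_omega. Qed.

(* The branch of the square root of [g] in the first variable that tends to 1
   at the centre of the disc. *)
Definition sqrt_gfun y x : C := \prod_(w <- omega y) sqrtc (1 - w * x).

Lemma sqr_sqrt_gfun x y : sqrt_gfun y x ^+ 2 = gfun d a x y.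
Proof.
rewrite omegaE /sqrt_gfun -prodrXl.
by apply: eq_bigr => w _; rewrite sqr_sqrtc.
Qed.

Hypothesis ua : univ d a.

(** [1/w] is a zero of [g(., y)], hence outside the open disc. So [1 - w x] stays in the closed
    right half-plane for [nm x <= 1], where the principal root is continuous away from 0. *)
Lemma omega_le1 y w : nm y <= 1 -> w \in omega y -> nm w <= 1.
Proof.
move=> y1 wo; rewrite leNgt; apply/negP => w1.
have w0 : w != 0 by rewrite -nm_gt0 (lt_trans ltr01).
have iw : nm w^-1 < 1 by rewrite nmV invf_lt1 // (lt_trans ltr01).
move: (univ_neq0_closed ua iw y1); rewrite omegaE prodf_seq_neq0.
by move=> /allP /(_ w wo) /=; rewrite mulfV // subrr eqxx.
Qed.

Lemma omega_nth_le1 y i : nm y <= 1 -> nm (nth 0 (omega y) i) <= 1.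
Proof.
move=> y1; have [lt_id|ge_id] := ltnP i (size (omega y)).
  exact: omega_le1 y1 (mem_nth _ _).
by rewrite nth_default // nm0 ler01.
Qed.

Lemma nm_dilate e x : 0 <= e <= 1 -> nm x <= 1 -> nm (e%:C * x) <= 1.
Proof.
move=> /andP[e0 e1] x1; rewrite nmM nm_real ger0_norm //.
by rewrite mulr_ile1 ?nm_ge0.
Qed.

(** Along an ultrafilter each entry of the lists [omega] converges, and uniqueness of the
    factorisation identifies the list of limits with [omega] at the limit point, up to order. *)
Lemma clim_sqrt_gfun (U : set_system nat) (UU : UltraFilter U) x y (en : nat -> R) e :
  nm x <= 1 -> nm y <= 1 -> (forall n, 0 <= en n <= 1) -> 0 <= e <= 1 -> en @ U --> e ->
  gfun d a (e%:C * x) (e%:C * y) != 0 ->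
  clim U (fun n => sqrt_gfun ((en n)%:C * y) ((en n)%:C * x))
    (sqrt_gfun (e%:C * y) (e%:C * x)).
Proof.
move=> x1 y1 en01 e01 ce gn0.
have W_ i : exists l, clim U (fun n => nth 0 (omega ((en n)%:C * y)) i) l.
  apply: (@ultra_clim _ _ UU 1) => n.
  by apply: omega_nth_le1; exact: nm_dilate.
have [W cW] := choice W_.
have cc (c : C) : clim U (fun=> c) c by exact: clim_cst.
have cec := clim_real _ ce.
have WE z : \prod_(0 <= i < d) (1 - W i * z) = gfun d a z (e%:C * y).
  apply: (@clim_uniq _ U _ (fun n => gfun d a z ((en n)%:C * y))).
    under eq_fun do rewrite omegaE omega_nth.
    by apply: clim_prod => i; exact: (climB _ (cc _) (climM _ (cW i) (cc _))).
  apply: clim_gfun => //; exact: (climM _ (cec _) (cc _)).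
have perm : perm_eq (mkseq W d) (omega (e%:C * y)).
  apply: linear_factors_uniq => [|z]; first by rewrite size_mkseq size_omega.
  by rewrite -omegaE -WE /mkseq big_map /index_iota subn0.
rewrite /sqrt_gfun -(perm_big _ perm) /= /mkseq big_map.
under eq_fun do rewrite omega_nth /index_iota subn0.
have le1 i n : nm (nth 0 (omega ((en n)%:C * y)) i * ((en n)%:C * x)) <= 1.
  rewrite nmM mulr_ile1 ?nm_ge0 ?nm_dilate //.
  by apply: omega_nth_le1; exact: nm_dilate.
have key (s : seq nat) : (forall i, i \in s -> (i < d)%N) ->
    clim U (fun n => \prod_(i <- s) sqrtc (1 - nth 0 (omega ((en n)%:C * y)) i * ((en n)%:C * x)))
      (\prod_(i <- s) sqrtc (1 - W i * (e%:C * x))).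
  elim: s => [|i s IH] sd.
    by under eq_fun do rewrite big_nil; rewrite big_nil.
  under eq_fun do rewrite big_cons; rewrite big_cons.
  apply: climM; last by apply: IH => j js; apply: sd; rewrite in_cons js orbT.
  apply: (@clim_sqrtc _ _ UU 2).
  - by move=> n; rewrite (le_trans (nmB _ _)) // nm1; have := le1 i n; lra.
  - by move=> n; exact: nm1B_le1.
  - move: gn0; rewrite -WE prodf_seq_neq0 => /allP /(_ i).
    by rewrite mem_index_iota /= sd ?mem_head //; apply.
  - exact: (climB _ (cc _) (climM _ (cW i) (climM _ (cec _) (cc _)))).
by apply: key => i; rewrite mem_iota.
Qed.

Lemma gfun_dilate_neq0 x y e : nm x = 1 -> nm y = 1 -> gfun d a x y != 0 ->
  0 <= e <= 1 -> gfun d a (e%:C * x) (e%:C * y) != 0.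
Proof.
move=> x1 y1 g0 /andP[e0]; rewrite le_eqVlt => /orP[/eqP ->|e1].
  by rewrite rmorph1 !mul1r.
by apply: univ_neq0 => //; rewrite nmM nm_real ger0_norm // ?x1 ?y1 mulr1.
Qed.

(** Both sides are square roots of [g(x, y)], so they agree up to sign. Along the segment
    [(e x, e y)] the value of [g] stays nonzero, which keeps the sign constant, and at [e = 0] both
    are 1. *)
Lemma sqrt_gfun_sym x y : nm x = 1 -> nm y = 1 -> gfun d a x y != 0 ->
  sqrt_gfun y x = sqrt_gfun x y.
Proof.
move=> x1 y1 g0; have g0' : gfun d a y x != 0 by rewrite gfun_sym.
pose P (e : R) := sqrt_gfun (e%:C * y) (e%:C * x) = sqrt_gfun (e%:C * x) (e%:C * y).
suff : P 1 by rewrite /P rmorph1 !mul1r.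
have [U [UU sU]] := ultraFilterLemma eventually_filter.
have lims (en : nat -> R) e (H : forall n, 0 <= en n <= 1) (He : 0 <= e <= 1) :
    en @ \oo --> e ->
    clim U (fun n => sqrt_gfun ((en n)%:C * y) ((en n)%:C * x))
      (sqrt_gfun (e%:C * y) (e%:C * x)) /\
    clim U (fun n => sqrt_gfun ((en n)%:C * x) ((en n)%:C * y))
      (sqrt_gfun (e%:C * x) (e%:C * y)).
  move=> ce; have ceU : en @ U --> e by apply: cvg_trans ce; exact: cvg_app.
  have x1' : nm x <= 1 by rewrite x1.
  have y1' : nm y <= 1 by rewrite y1.
  split.
    by apply: (clim_sqrt_gfun UU x1' y1' H He ceU); exact: gfun_dilate_neq0.
  by apply: (clim_sqrt_gfun UU y1' x1' H He ceU); exact: gfun_dilate_neq0.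
apply: unit_interval_connected => [|en e H He ce Pn|en e H He ce Pn Pe].
- rewrite /P /sqrt_gfun !big1 // => w _;
  by rewrite rmorph0 mul0r mulr0 subr0 sqrtc1.
- have [c1 c2] := lims en e H He ce.
  apply: (@clim_uniq _ U _ _ _ _ c1).
  by under eq_fun do rewrite Pn.
- have [c1 c2] := lims en e H He ce.
  have : sqrt_gfun (e%:C * y) (e%:C * x) = - sqrt_gfun (e%:C * x) (e%:C * y).
    apply: (@clim_uniq _ U _ _ _ _ c1).
    have E n : sqrt_gfun ((en n)%:C * y) ((en n)%:C * x) =
               - sqrt_gfun ((en n)%:C * x) ((en n)%:C * y).
      have /eqP : sqrt_gfun ((en n)%:C * y) ((en n)%:C * x) ^+ 2 =
                  sqrt_gfun ((en n)%:C * x) ((en n)%:C * y) ^+ 2.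
        by rewrite !sqr_sqrt_gfun gfun_sym.
      by rewrite eqf_sqr => /orP[/eqP /Pn //|/eqP].
    by under eq_fun do rewrite E; exact: climN.
  rewrite -Pe => /eqP; rewrite -addr_eq0 -mulr2n mulrn_eq0 /= => /eqP S0.
  have := gfun_dilate_neq0 x1 y1 g0 He.
  by rewrite -sqr_sqrt_gfun S0 expr0n eqxx.
Qed.

(** [(1 - z/y) g(z, y) = z (phi(z) - phi(y))] depends on [y] only through [phi(y)], so at a double
    point the two lists of factors, each completed by its own [1/y], coincide. *)
Lemma sqrt_gfun_swap x1 x2 x : x1 != 0 -> x2 != 0 -> phi d a x1 = phi d a x2 ->
  sqrtc (1 - x1^-1 * x) * sqrt_gfun x1 x = sqrtc (1 - x2^-1 * x) * sqrt_gfun x2 x.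
Proof.
move=> x10 x20 phi12.
have E y z : y != 0 -> z != 0 -> (1 - y^-1 * z) * gfun d a z y = z * (phi d a z - phi d a y).
  move=> y0 z0; apply: (mulfI y0); rewrite mulrA [RHS]mulrA [y * z]mulrC phiB //.
  by congr (_ * _); field.
have perm : perm_eq (x1^-1 :: omega x1) (x2^-1 :: omega x2).
  apply: linear_factors_uniq => [|z]; first by rewrite /= !size_omega.
  rewrite !big_cons -!omegaE; have [->|z0] := eqVneq z 0.
    by rewrite !gfun0 !mulr0.
  by rewrite !E // phi12.
have : \prod_(w <- x1^-1 :: omega x1) sqrtc (1 - w * x) =
       \prod_(w <- x2^-1 :: omega x2) sqrtc (1 - w * x) by exact: perm_big.
by rewrite !big_cons.
Qed.

(** Here [s y x] is the root of [1 - x/y], and exchanging its arguments conjugates it. The four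
    relations obtained by viewing each endpoint from the other pair, with the symmetry of the
    branch, show that [X] is real; its square is the cross ratio, whose positivity says that the
    chords do not cross. *)
Lemma cross_ratio_positive x1 x2 x3 x4 :
  nm x1 = 1 -> nm x2 = 1 -> nm x3 = 1 -> nm x4 = 1 ->
  phi d a x1 = phi d a x2 -> phi d a x3 = phi d a x4 -> phi d a x1 != phi d a x3 ->
  exists2 r : R, 0 < r & (x2 - x3) * (x1 - x4) = r%:C * ((x1 - x3) * (x2 - x4)).
Proof.
move=> n1 n2 n3 n4 p12 p34 p13.
have z1 := circle_neq0 n1; have z2 := circle_neq0 n2.
have z3 := circle_neq0 n3; have z4 := circle_neq0 n4.
pose s y x := sqrtc (1 - y^-1 * x).
have ne y x : phi d a y != phi d a x -> y != x by apply: contra_neq => ->.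
have [d13 d14 d23 d24] : [/\ x1 != x3, x1 != x4, x2 != x3 & x2 != x4].
  by split; apply: ne; rewrite -?p12 -?p34.
have g0 y x : nm y = 1 -> nm x = 1 -> phi d a y != phi d a x -> gfun d a y x != 0.
  move=> y1 x1' yx; have y0 := circle_neq0 y1; have x0 := circle_neq0 x1'.
  by rewrite -phi_eq // ne.
have sym y x : nm y = 1 -> nm x = 1 -> phi d a y != phi d a x ->
    sqrt_gfun x y = sqrt_gfun y x.
  by move=> y1 x1' yx; apply: sqrt_gfun_sym => //; exact: g0.
have Sn0 y x : nm y = 1 -> nm x = 1 -> phi d a y != phi d a x -> sqrt_gfun y x != 0.
  move=> y1 x1' yx; have := g0 _ _ y1 x1' yx; rewrite gfun_sym -sqr_sqrt_gfun.
  by rewrite expf_eq0.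
have sn0 y x : nm y = 1 -> y != x -> s y x != 0.
  move=> y1 yx; have y0 := circle_neq0 y1; rewrite /s sqrtc_eq0 subr_eq0.
  by apply: contra_neq yx => E; rewrite -[y]mulr1 E mulrA mulfV // mul1r.
have sJ y x : nm y = 1 -> nm x = 1 -> y != x -> s x y = cj (s y x).
  move=> y1 x1' yx; rewrite /s -sqrtc_conj.
  - congr sqrtc; rewrite conjcB conjc_1 conjcM conjc_V !circle_conj // invrK.
    by rewrite mulrC.
  - by apply: nm1B_le1; rewrite nmM nmV y1 x1' invr1 mulr1.
  - by move: (sn0 _ _ y1 yx); rewrite /s sqrtc_eq0.
have E13 := sqrt_gfun_swap x3 z1 z2 p12; have E14 := sqrt_gfun_swap x4 z1 z2 p12.
have E31 := sqrt_gfun_swap x1 z3 z4 p34; have E32 := sqrt_gfun_swap x2 z3 z4 p34.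
rewrite -!/(s _ _) in E13 E14 E31 E32.
have q13 := p13; have q14 : phi d a x1 != phi d a x4 by rewrite -p34.
have q23 : phi d a x2 != phi d a x3 by rewrite -p12.
have q24 : phi d a x2 != phi d a x4 by rewrite -p12 -p34.
rewrite (sym x1 x3) // (sym x1 x4) // (sJ x1 x3) // (sJ x1 x4) // in E31.
rewrite (sym x2 x3) // (sym x2 x4) // (sJ x2 x3) // (sJ x2 x4) // in E32.
pose X := s x2 x3 * s x1 x4 / (s x1 x3 * s x2 x4).
have [S13 S14 S23 S24] : [/\ sqrt_gfun x1 x3 != 0, sqrt_gfun x1 x4 != 0,
    sqrt_gfun x2 x3 != 0 & sqrt_gfun x2 x4 != 0] by split; exact: Sn0.
have [s13 s14 s23 s24] : [/\ s x1 x3 != 0, s x1 x4 != 0, s x2 x3 != 0 & s x2 x4 != 0].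
  by split; exact: sn0.
have [c13 c24] : cj (s x1 x3) != 0 /\ cj (s x2 x4) != 0 by rewrite !conjc_eq0.
have Xreal : cj X = X.
  transitivity (sqrt_gfun x1 x3 * sqrt_gfun x2 x4 / (sqrt_gfun x1 x4 * sqrt_gfun x2 x3)).
    rewrite /X !(conjcM, conjc_V).
    apply/eqP; rewrite eqr_div ?mulf_neq0 //; apply/eqP.
    transitivity ((cj (s x1 x4) * sqrt_gfun x1 x4) * (cj (s x2 x3) * sqrt_gfun x2 x3)).
      by ring.
    by rewrite -E31 E32; ring.
  rewrite /X; apply/eqP; rewrite eqr_div ?mulf_neq0 //; apply/eqP.
  transitivity ((s x1 x3 * sqrt_gfun x1 x3) * (s x2 x4 * sqrt_gfun x2 x4)); first by ring.
  by rewrite E13 -E14; ring.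
have X0 : X != 0 by rewrite !mulf_neq0 ?invr_neq0 ?mulf_neq0.
have XE : X = (Re X)%:C.
  apply: complex_ext => //=; have := congr1 (@complex.Im R) Xreal; rewrite Im_conjc; lra.
exists (Re X ^+ 2).
  by rewrite exprn_even_gt0 //=; apply: contra_neq X0 => E; rewrite XE E.
rewrite rmorphXn /= -XE /X expr_div_n !exprMn /s !sqr_sqrtc.
have u13 : 1 - x1^-1 * x3 != 0 by move: s13; rewrite /s sqrtc_eq0.
have u24 : 1 - x2^-1 * x4 != 0 by move: s24; rewrite /s sqrtc_eq0.
have -> : x2 - x3 = x2 * (1 - x2^-1 * x3) by field.
have -> : x1 - x4 = x1 * (1 - x1^-1 * x4) by field.
have -> : x1 - x3 = x1 * (1 - x1^-1 * x3) by field.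
have -> : x2 - x4 = x2 * (1 - x2^-1 * x4) by field.
move: (1 - x1^-1 * x3) (1 - x2^-1 * x4) u13 u24 => p q p0 q0.
by field; rewrite ?p0 ?q0 ?z1 ?z2.
Qed.

End NonCrossing.

(** * Counting double points *)

Section Chords.
Variable R : realType.
Implicit Types (c : R * R) (L : seq (R * R)).

Definition noncrossing c c' :=
  [\/ c.2 < c'.1, c'.2 < c.1, c.1 < c'.1 /\ c'.2 < c.2 | c'.1 < c.1 /\ c.2 < c'.2].

Lemma leftmost_chord L : L != [::] -> exists2 c, c \in L & {in L, forall c', c.1 <= c'.1}.
Proof.
elim: L => [//|c L IH] _; have [->|/IH[m mL mP]] := eqVneq L [::].
  by exists c; rewrite ?mem_head // => c'; rewrite inE => /eqP ->.
have [cm|mc] := leP c.1 m.1; [exists c|exists m]; rewrite ?inE ?eqxx ?mL ?orbT //.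
  move=> c'; rewrite inE => /orP[/eqP -> //|/mP]; exact: le_trans.
by move=> c'; rewrite inE => /orP[/eqP ->|/mP //]; exact: ltW.
Qed.

(* Cutting along the chord with the leftmost endpoint splits the remaining ones
   into those under it and those to its right. *)
Lemma noncrossing_count L (x y : R) : uniq L -> x < y ->
  {in L, forall c, [/\ x <= c.1, c.1 < c.2, c.2 < y & exists n : nat, c.2 - c.1 = n%:R]} ->
  {in L &, forall c c', c != c' -> noncrossing c c'} ->
  (size L)%:R < y - x.
Proof.
have [N] := ubnP (size L); elim: N L x y => // N IH L x y; rewrite ltnS => LN.
move=> uL xy LP Lnc; have [->|L0] := eqVneq L [::]; first by rewrite subr_gt0.
have [c cL cmin] := leftmost_chord L0.
have [xc1 c12 c2y [n cn]] := LP c cL.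
pose L' := rem c L; have uL' : uniq L' by exact: rem_uniq.
have L'P c' : c' \in L' -> [/\ c' \in L & c' != c].
  by rewrite mem_rem_uniq // inE => /andP[].
have sL : size L = (size L').+1.
  by rewrite size_rem // prednK //; case: (L) cL.
pose I := [seq c' <- L' | c'.2 < c.2]; pose J := [seq c' <- L' | ~~ (c'.2 < c.2)].
have IJ : size L' = (size I + size J)%N by rewrite !size_filter count_predC.
have nc c' : c' \in L' -> c.2 < c'.1 \/ (c.1 < c'.1 /\ c'.2 < c.2).
  move=> /L'P[c'L c'c]; have := Lnc c c' cL c'L; rewrite eq_sym => /(_ c'c).
  have [_ c'12 _ _] := LP c' c'L; have le1 := cmin c' c'L.
  by case=> [?|?|?|[? ?]]; [left|lra|right|lra].
have subL (p : pred (R * R)) c' : c' \in [seq e <- L' | p e] -> c' \in L /\ c' \in L' /\ p c'.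
  by rewrite mem_filter => /andP[pc c'L']; have [] := L'P _ c'L'.
have HI : (size I)%:R < c.2 - c.1.
  apply: (IH I) => //; rewrite ?filter_uniq //.
  - by apply: leq_trans LN; rewrite sL ltnS IJ leq_addr.
  - move=> c' /subL[c'L [c'L' c'2]]; have [_ c'12 _ c'n] := LP c' c'L.
    by split=> //; case: (nc c' c'L'); lra.
  - by move=> e e' /subL[eL _] /subL[e'L _]; exact: Lnc.
have HJ : (size J)%:R < y - c.2.
  apply: (IH J) => //; rewrite ?filter_uniq //.
  - by apply: leq_trans LN; rewrite sL ltnS IJ leq_addl.
  - move=> c' /subL[c'L [c'L' c'2]]; have [_ c'12 c'y c'n] := LP c' c'L.
    split=> //; case: (nc c' c'L'); first exact: ltW.
    by case=> _ H; rewrite H in c'2.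
  - by move=> e e' /subL[eL _] /subL[e'L _]; exact: Lnc.
(* Integrality: the length of [c] is an integer exceeding the number of chords under it, so it also
   accounts for [c] itself. *)
have {}HI : (size I).+1%:R <= c.2 - c.1 by move: HI; rewrite cn ltr_nat ler_nat.
rewrite sL IJ -addSn natrD.
move: HI HJ; move: ((size I).+1%:R) ((size J)%:R) => p q *; lra.
Qed.

End Chords.

Section DoublePointCount.
Variable R : realType.
Local Notation C := R[i].

Lemma circle_expi (z : C) : nm z = 1 -> exists t : R, [/\ 0 <= t, t < 2 * pi & z = expi t].
Proof.
move=> z1; have E : Re z ^+ 2 + Im z ^+ 2 = 1 by rewrite -nm_sqr z1 expr1n.
have pi0 := @pi_gt0 R.
have rz : -1 <= Re z <= 1 by rewrite -ler_norml -z1 absRe_le.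
have a0 := acos_ge0 rz; have api := acos_lepi rz.
have sq : Num.sqrt (1 - Re z ^+ 2) = `|Im z|.
  by rewrite -E addrAC subrr add0r sqrtr_sqr.
have [im0|im0] := leP 0 (Im z).
  exists (acos (Re z)); split=> //; first by lra.
  apply: complex_ext; rewrite /= ?acosK // sin_acos // sq ger0_norm //.
have a_gt0 : 0 < acos (Re z).
  rewrite lt_neqAle a0 andbT eq_sym; apply/eqP => H.
  have : Re z = 1 by rewrite -[LHS]acosK // H cos0.
  by move=> H1; move: E; rewrite H1; nra.
exists (2 * pi - acos (Re z)); split; [lra|lra|].
have e2 : 2 * pi = pi *+ 2 :> R by rewrite mulr_natl.
apply: complex_ext; rewrite /= e2.
  by rewrite addrC cosD2pi cosN acosK.
by rewrite addrC sinD2pi sinN sin_acos // sq ltr0_norm // opprK.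
Qed.

Lemma sin_half_gt0 (u : R) : 0 < u < 2 * pi -> 0 < sin (u / 2).
Proof. by move=> /andP[? ?]; apply: sin_gt0_pi; lra. Qed.

Lemma expi_eq1 (u : R) : 0 <= u -> expi u = 1 -> exists n : nat, u = 2 * pi * n%:R.
Proof.
move=> u0 eu; have pi0 := @pi_gt0 R; have p2 : 0 < 2 * pi :> R by lra.
have /andP[n1 n2] := Num.Theory.truncn_itv (divr_ge0 u0 (ltW p2)).
set n := Num.truncn _ in n1 n2; exists n.
pose r := u - 2 * pi * n%:R.
have r0 : 0 <= r by rewrite subr_ge0 -ler_pdivlMl // mulrC.
have r1 : r < 2 * pi.
  move: n2; rewrite ltr_pdivrMr // -natr1 mulrDl mul1r /r; lra.
have er : expi r = 1.
  have e2pi : expi (2 * pi * n%:R) = 1 :> C.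
    have -> : 2 * pi * n%:R = n%:R * (2%:R * pi) :> R by ring.
    by rewrite -!expiX expi_pi sqrrN !expr1n.
  have : expi (r + 2 * pi * n%:R) = 1 by rewrite /r subrK.
  by rewrite expiD e2pi mulr1.
suff : r = 0 by rewrite /r => /eqP; rewrite subr_eq0 => /eqP.
apply/eqP; rewrite eq_le r0 andbT leNgt; apply/negP => rpos.
have s0 : 0 < sin (r / 2) by apply: sin_half_gt0; rewrite rpos.
have := congr1 (@complex.Re R) er; rewrite /= {1}(_ : r = r / 2 + r / 2); last by field.
rewrite cosD; have := cos2Dsin2 (r / 2); nra.
Qed.

Lemma expiB (s t : R) :
  expi s - expi t = 2%:R * 'i%C * (sin ((s - t) / 2))%:C * expi ((s + t) / 2).
Proof.
set u := (s + t) / 2; set v := (s - t) / 2.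
have -> : expi s = expi u * expi v.
  by rewrite -expiD; congr expi; rewrite /u /v; field.
have -> : expi t = expi u * cj (expi v).
  by rewrite -expiN -expiD; congr expi; rewrite /u /v; field.
rewrite /expi.
by apply: complex_ext; rewrite !(ReD, ImD, ReN, ImN, ReM, ImM) /=; ring.
Qed.

(** Each difference is a sine of a half-angle times a factor of constant modulus, and these factors
    cancel since all four angles enter both sides. In [[0, 2 pi)] the sine of [(s - t)/2] has the
    sign of [s - t], and crossing chords would give the two products opposite signs. *)
Lemma expi_noncrossing (t1 t2 t3 t4 r : R) :
  0 <= t1 -> t1 < t2 -> t2 < 2 * pi -> 0 <= t3 -> t3 < t4 -> t4 < 2 * pi -> 0 < r ->
  [/\ t1 != t3, t1 != t4, t2 != t3 & t2 != t4] ->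
  (expi t2 - expi t3) * (expi t1 - expi t4) =
    r%:C * ((expi t1 - expi t3) * (expi t2 - expi t4)) ->
  noncrossing (t1, t2) (t3, t4).
Proof.
move=> h1 h12 h2 h3 h34 h4 r0 [n13 n14 n23 n24]; rewrite !expiB => E.
have {}E : sin ((t2 - t3) / 2) * sin ((t1 - t4) / 2) =
    r * (sin ((t1 - t3) / 2) * sin ((t2 - t4) / 2)).
  apply: complexI; rewrite !rmorphM /=.
  have e0 : expi ((t2 + t3) / 2) * expi ((t1 + t4) / 2) =
            expi ((t1 + t3) / 2) * expi ((t2 + t4) / 2).
    by rewrite -!expiD; congr expi; field.
  have n0 : (2%:R * 'i%C) ^+ 2 * (expi ((t2 + t3) / 2) * expi ((t1 + t4) / 2)) != 0 :> C.
    rewrite mulf_neq0 ?expf_neq0 ?mulf_neq0 ?pnatr_eq0 ?circle_neq0 ?nm_expi //.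
    by rewrite /= expr0n expr1n add0r sqrtr1.
  apply: (mulfI n0); move: E; rewrite {2}e0 => E.
  transitivity (2%:R * 'i%C * (sin ((t2 - t3) / 2))%:C * expi ((t2 + t3) / 2) *
     (2%:R * 'i%C * (sin ((t1 - t4) / 2))%:C * expi ((t1 + t4) / 2)) : C).
    by ring.
  by rewrite E; ring.
have pos (u : R) : 0 < u -> u < 2 * pi -> 0 < sin (u / 2).
  by move=> ? ?; apply: sin_half_gt0; apply/andP.
have neg (u : R) : u < 0 -> - u < 2 * pi -> sin (u / 2) < 0.
  by move=> ? ?; rewrite -oppr_gt0 -sinN -mulNr; apply: pos; lra.
rewrite /noncrossing /=.
have [l23|l32|e23] := ltgtP t2 t3; last by rewrite e23 eqxx in n23.
  by constructor 1.
have [l41|l14|e14] := ltgtP t4 t1; last by rewrite e14 eqxx in n14.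
  by constructor 2.
have s23 : 0 < sin ((t2 - t3) / 2) by apply: pos; lra.
have s14 : sin ((t1 - t4) / 2) < 0 by apply: neg; lra.
have L0 : sin ((t2 - t3) / 2) * sin ((t1 - t4) / 2) < 0 by rewrite pmulr_rlt0.
have [l13|l31|e13] := ltgtP t1 t3; last by rewrite e13 eqxx in n13.
  have s13 : sin ((t1 - t3) / 2) < 0 by apply: neg; lra.
  constructor 3; split=> //; rewrite ltNge; apply/negP => l24.
  have l24' : t2 < t4 by rewrite lt_neqAle n24.
  have s24 : sin ((t2 - t4) / 2) < 0 by apply: neg; lra.
  have : 0 < r * (sin ((t1 - t3) / 2) * sin ((t2 - t4) / 2)).
    by rewrite mulr_gt0 // nmulr_lgt0.
  by rewrite -E; lra.
have s13 : 0 < sin ((t1 - t3) / 2) by apply: pos; lra.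
constructor 4; split=> //; rewrite ltNge; apply/negP => l42.
have l42' : t4 < t2 by rewrite lt_neqAle eq_sym n24.
have s24 : 0 < sin ((t2 - t4) / 2) by apply: pos; lra.
have : 0 < r * (sin ((t1 - t3) / 2) * sin ((t2 - t4) / 2)) by rewrite !mulr_gt0.
by rewrite -E; lra.
Qed.

Variables (d : nat) (a : nat -> C).

Definition double_value (w : C) := exists x y,
  [/\ nm x = 1, nm y = 1, x != y, w = phi d a x & w = phi d a y].

Hypotheses (d2 : (2 <= d)%N) (ua : univ d a) (ra : self_reciprocal d a).

Lemma double_value_power x y : nm x = 1 -> nm y = 1 -> x != y ->
  phi d a x = phi d a y -> x ^+ d.-1 = y ^+ d.-1.
Proof.
move=> x1 y1 xy pxy.
have [py [r r0 E]] := double_point_normals ua x1 y1 xy pxy.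
have d0 : (0 < d)%N by lia.
have ny : normal d a y != 0 by rewrite mulf_neq0 // invr_neq0 // circle_neq0.
by apply: (normal_parallel d0 ra x1 y1 ny E); rewrite lt_eqF.
Qed.

Lemma double_value_chord w : double_value w -> exists c : R * R,
  [/\ 0 <= c.1, c.1 < c.2, c.2 < 2 * pi, w = phi d a (expi c.1) & w = phi d a (expi c.2)].
Proof.
move=> [x [y [x1 y1 xy wx wy]]].
have [s [s0 s1 xs]] := circle_expi x1; have [t [t0 t1 yt]] := circle_expi y1.
have [st|ts|E] := ltgtP s t; [exists (s, t)|exists (t, s)|].
- by rewrite /= -xs -yt.
- by rewrite /= -xs -yt.
- by rewrite xs yt E eqxx in xy.
Qed.

Lemma double_value_count (ws : seq C) : uniq ws -> (forall w, w \in ws -> double_value w) ->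
  (size ws <= d - 2)%N.
Proof.
move=> uw dw; have pi0 := @pi_gt0 R; have p2 : 0 < 2 * pi :> R by lra.
have ch_ (w : C) : exists c : R * R, double_value w ->
  [/\ 0 <= c.1, c.1 < c.2, c.2 < 2 * pi, w = phi d a (expi c.1) & w = phi d a (expi c.2)].
  have [/double_value_chord[c cP]|nw] := pselect (double_value w); first by exists c.
  by exists (0, 0) => /nw.
have [ch chP] := choice ch_.
have d1 : 0 < (d.-1)%:R :> R by rewrite ltr0n; lia.
(* A full turn is rescaled to length [d - 1]: since the two endpoints have the same power [d - 1],
   every chord gets integer length. *)
pose q : R := (d.-1)%:R / (2 * pi); have q0 : 0 < q by rewrite divr_gt0.
pose sc w := (q * (ch w).1, q * (ch w).2) : R * R.
have inj : {in ws &, injective sc}.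
  move=> w w' wws w'ws [] /(mulfI (lt0r_neq0 q0)) E _.
  have [_ _ _ -> _] := chP w (dw w wws); have [_ _ _ -> _] := chP w' (dw w' w'ws).
  by rewrite E.
suff : (size (map sc ws))%:R < (d.-1)%:R - 0 :> R.
  by rewrite size_map subr0 ltr_nat; lia.
apply: noncrossing_count => //.
- by rewrite map_inj_in_uniq.
- move=> _ /mapP[w wws ->]; have [c0 c12 c2 E1 E2] := chP w (dw w wws).
  rewrite /sc /=; split.
  + by rewrite mulr_ge0 // ltW.
  + by rewrite ltr_pM2l.
  + by rewrite /q mulrAC ltr_pdivrMr // ltr_pM2l.
  have ne : expi (ch w).2 != expi (ch w).1.
    rewrite -subr_eq0 expiB mulf_neq0 ?(circle_neq0 (nm_expi _)) // mulf_neq0 //.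
      by rewrite mulf_neq0 ?pnatr_eq0 // circle_neq0 //= expr0n expr1n add0r sqrtr1.
    by rewrite -nm_eq0 nm_real normr_eq0 lt0r_neq0 // sin_half_gt0 //; lra.
  have := double_value_power (nm_expi _) (nm_expi _) ne _.
  rewrite -E1 -E2 => /(_ erefl); rewrite !expiX => E.
  have [n nE] : exists n : nat, (d.-1)%:R * ((ch w).2 - (ch w).1) = 2 * pi * n%:R.
    apply: expi_eq1; first by rewrite mulr_ge0 ?subr_ge0 ?ltW.
    by rewrite mulrBr expiD E -expiD subrr expi0.
  exists n; rewrite -mulrBr /q mulrAC nE.
  by rewrite [LHS]mulrC mulKf // gt_eqF.
- move=> _ _ /mapP[w wws ->] /mapP[w' w'ws ->] ne.
  have ww' : w != w' by apply: contra_neq ne => ->.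
  have [c0 c12 c2 E1 E2] := chP w (dw w wws).
  have [c0' c12' c2' E1' E2'] := chP w' (dw w' w'ws).
  have dist s t : w = phi d a (expi s) -> w' = phi d a (expi t) -> s != t.
    by move=> Es Et; apply/eqP => st; move: ww'; rewrite Es Et st eqxx.
  have [|||r r0 E] := @cross_ratio_positive _ _ _ ua _ _ _ _ (nm_expi (ch w).1)
    (nm_expi (ch w).2) (nm_expi (ch w').1) (nm_expi (ch w').2).
  + by rewrite -E1 -E2.
  + by rewrite -E1' -E2'.
  + by rewrite -E1 -E1'.
  have := expi_noncrossing c0 c12 c2 c0' c12' c2' r0 _ E.
  rewrite /noncrossing /= !ltr_pM2l //; apply.
  by split; [exact: dist E1 E1'|exact: dist E1 E2'|exact: dist E2 E1'|exact: dist E2 E2'].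
Qed.

End DoublePointCount.

(** * First contact and local convexity *)

Section Dilation.
Variables (R : realType) (d : nat).
Local Notation C := R[i].
Implicit Types (a : nat -> C) (x y : C).

(** These are the coefficients of [r phi(r x)]; the outer factor [r] keeps the leading term
    [1/x]. *)
Definition dilate (r : R) a : nat -> C := fun k => a k * r%:C ^+ k.+1.

Lemma gfun_dilate r a x y : gfun d (dilate r a) x y = gfun d a (r%:C * x) (r%:C * y).
Proof.
congr (1 - _); apply: eq_bigr => k _; rewrite /dilate -mulrA; congr (_ * _).
rewrite mulr_sumr; apply: eq_bigr => i _.
rewrite !exprMn (_ : k.+1 = i.+1 + (k - i))%N ?exprD; last by have := ltn_ord i; lia.
by ring.
Qed.

Lemma pfun_dilate r a x : pfun d (dilate r a) x = pfun d a (r%:C * x).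
Proof. by rewrite -!gfun_diag gfun_dilate. Qed.

(* An extremal failure of univalence: on the first circle where injectivity
   fails the two boundary branches touch with opposite normals. *)
Lemma not_univ_contact a : ~ univ d a -> (forall x, nm x < 1 -> pfun d a x != 0) ->
  exists x y (r : R), [/\ x != y, nm x = nm y, nm x < 1, gfun d a x y = 0 &
    r < 0 /\ normal d a x = r%:C * normal d a y].
Proof.
move=> nu pn0.
have [x0 [y0 [x01 y01 g0]]] : exists x y, [/\ nm x < 1, nm y < 1 & gfun d a x y = 0].
  apply: contrapT => nex; apply: nu => x y x1 y1 _; apply/eqP => g0.
  by apply: nex; exists x, y.
(* The infimum [s] of these radii is the first one at which [g] vanishes on the closed bidisc; it is
   attained by compactness and positive because [g(0, y) = 1]. *)
pose A := [set m : R | 0 <= m < 1 /\ exists x y, [/\ nm x <= m, nm y <= m & gfun d a x y = 0]].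
have max1 x y : nm x < 1 -> nm y < 1 -> gfun d a x y = 0 -> A (Num.max (nm x) (nm y)).
  move=> x1 y1 gxy; split; first by rewrite le_max nm_ge0 gt_max x1.
  by exists x, y; rewrite !le_max !lexx orbT.
have hiA : has_inf A.
  by split; [exists (Num.max (nm x0) (nm y0)); exact: max1 | exists 0 => m [/andP[]]].
set s := inf A.
have leA m : A m -> s <= m by apply: ge_inf; case: hiA.
have s0 : 0 <= s by apply: lb_le_inf; [case: hiA | move=> m [/andP[]]].
have s1 : s < 1.
  by apply: le_lt_trans (leA _ (max1 _ _ x01 y01 g0)) _; rewrite gt_max x01.
have hn n : 0 < (n.+1)%:R^-1 :> R by rewrite invr_gt0.
have en_ n : exists xy : C * C, [/\ nm xy.1 < 1, nm xy.2 < 1, nm xy.1 <= s + (n.+1)%:R^-1,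
    nm xy.2 <= s + (n.+1)%:R^-1 & gfun d a xy.1 xy.2 = 0].
  have [m [/andP[m0 m1] [x [y [xm ym gxy]]]] ms] := inf_adherent (hn n) hiA.
  exists (x, y); split=> //=; first [exact: le_lt_trans m1 | exact: le_trans (ltW ms)].
have [xy xyP] := choice en_.
have [U [UU sU]] := ultraFilterLemma eventually_filter.
have [x cx] : exists l, clim U (fun n => (xy n).1) l.
  by apply: (@ultra_clim _ _ UU 1) => n; have [/ltW] := xyP n.
have [y cy] : exists l, clim U (fun n => (xy n).2) l.
  by apply: (@ultra_clim _ _ UU 1) => n; have [_ /ltW] := xyP n.
have lim_le z (zn : nat -> C) : clim U zn z -> (forall n, nm (zn n) <= s + (n.+1)%:R^-1) -> nm z <= s.
  move=> cz zs; apply/ler_addgt0Pr => e e0.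
  have he : \forall n \near \oo, (n.+1)%:R^-1 < e.
    by have /cvgr_lt := @cvg_harmonic R; apply.
  apply: (clim_nm_le _ cz); apply: sU; near=> n.
  apply: le_trans (zs n) _; rewrite lerD2l ltW //; near: n; exact: he.
have xs : nm x <= s by apply: (lim_le _ _ cx) => n; have [] := xyP n.
have ys : nm y <= s by apply: (lim_le _ _ cy) => n; have [] := xyP n.
have gxy : gfun d a x y = 0.
  apply: (@clim_uniq _ U _ (fun n => gfun d a (xy n).1 (xy n).2)).
    by apply: clim_gfun => // k; exact: clim_cst.
  have -> : (fun n => gfun d a (xy n).1 (xy n).2) = (fun=> 0).
    by apply/funext => n; have [] := xyP n.
  exact: clim_cst.
have sp : 0 < s.
  rewrite lt_neqAle s0 andbT eq_sym; apply/eqP => s00; move: xs; rewrite s00.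
  move=> x00; have /eqP : nm x = 0 by apply/eqP; rewrite eq_le x00 nm_ge0.
  by rewrite nm_eq0 => /eqP x0'; move: gxy; rewrite x0' gfun0 => /eqP; rewrite oner_eq0.
pose a' := dilate s a.
have sc0 : s%:C != 0 :> C by rewrite -nm_eq0 nm_real normr_eq0 gt_eqF.
have nms z : nm (s%:C^-1 * z) = nm z / s.
  by rewrite nmM nmV nm_real ger0_norm ?ltW // mulrC.
(* By minimality of [s] the rescaled function is injective on the unit disc, so the boundary results
   apply to it at [X] and [Y]. *)
have ua' : univ d a'.
  move=> u v u1 v1 _; rewrite gfun_dilate; apply/eqP => g.
  have su z : nm z < 1 -> nm (s%:C * z) < s.
    by move=> z1; rewrite nmM nm_real ger0_norm ?ltW // gtr_pMr.
  have := leA _ (max1 _ _ (lt_trans (su u u1) s1) (lt_trans (su v v1) s1) g).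
  by apply/negP; rewrite -ltNge gt_max !su.
pose X := s%:C^-1 * x; pose Y := s%:C^-1 * y.
have sX : s%:C * X = x by rewrite /X mulVKf.
have sY : s%:C * Y = y by rewrite /Y mulVKf.
have X1 : nm X <= 1 by rewrite nms ler_pdivrMr // mul1r.
have Y1 : nm Y <= 1 by rewrite nms ler_pdivrMr // mul1r.
have gXY : gfun d a' X Y = 0 by rewrite gfun_dilate sX sY.
have nX : nm X = 1.
  apply/eqP; rewrite eq_le X1 leNgt; apply/negP => X1'.
  by have := univ_neq0_closed ua' X1' Y1; rewrite gXY eqxx.
have nY : nm Y = 1.
  apply/eqP; rewrite eq_le Y1 leNgt; apply/negP => Y1'.
  by have := univ_neq0_closed ua' Y1' X1; rewrite gfun_sym gXY eqxx.
have nx : nm x = s by rewrite -sX nmM nX mulr1 nm_real ger0_norm.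
have ny : nm y = s by rewrite -sY nmM nY mulr1 nm_real ger0_norm.
have xy0 : x != y.
  apply/eqP => E; move: gxy; rewrite -E gfun_diag => px.
  by have := pn0 x; rewrite px eqxx nx => /(_ s1).
have XY : X != Y by apply: contra_neq xy0 => E; rewrite -sX -sY E.
have ph : phi d a' X = phi d a' Y.
  by apply/eqP; rewrite phi_eq ?circle_neq0 //; apply/eqP.
have [_ [r r0]] := double_point_normals ua' nX nY XY ph.
rewrite !pfun_dilate sX sY => E.
have [X0 Y0] : X != 0 /\ Y != 0 by rewrite !circle_neq0.
exists x, y, r; split; rewrite ?nx ?ny //; split=> //.
have xV : x^-1 = s%:C^-1 * X^-1 by rewrite -invfM sX.
have yV : y^-1 = s%:C^-1 * Y^-1 by rewrite -invfM sY.
rewrite /normal xV yV mulrCA E; ring.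
Unshelve. all: by end_near. Qed.

End Dilation.

Section LocalConvexity.
Variables (R : realType) (d : nat).
Local Notation C := R[i].
Implicit Types (a : nat -> C) (x s : C).

(** [nm (1 - s) < 1] says [Re s > |s|^2 / 2]. In nearly tangential directions [k s^2] costs about
    [Re k |s|^2], and [(3 - d)/4 <= 1/4], so at least [|s|^2 / 4] is left against the cubic
    errors. *)
Lemma cubic_positivity (K B : R) : (2 <= d)%N -> 0 <= K -> 0 <= B ->
  exists2 delta : R, 0 < delta & forall k s e : C,
    Re k = (3%:R - d%:R) / 4%:R -> nm k <= K -> nm e <= B ->
    nm s < delta -> nm (1 - s) < 1 -> 0 < Re (s + k * s ^+ 2 + e * s ^+ 3).
Proof.
move=> d2 K0 B0; have D0 : 0 < 8 * (4 * K + B + 1) by lra.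
(* This makes [4 K |s| < 1] and [(2 K + B) |s| <= 1/4], the bounds behind [a2] and [a3]. *)
exists (8 * (4 * K + B + 1))^-1; first by rewrite invr_gt0.
move=> k s e kE kK eB; rewrite -[X in _ < X -> _]mul1r ltr_pdivlMr // => sd s1.
have d2' : 2 <= d%:R :> R by rewrite (ler_nat _ 2).
have es : Re (e * s ^+ 3) >= - (B * nm s ^+ 3).
  have := absRe_le (e * s ^+ 3); rewrite ler_norml => /andP[+ _].
  by apply: le_trans; rewrite lerN2 nmM nmX ler_wpM2r // exprn_ge0 // nm_ge0.
have ik : `|Im k| <= K := le_trans (absIm_le k) kK.
have rk : `|Re k| <= K := le_trans (absRe_le k) kK.
have u0 : 0 < Re s - nm s ^+ 2 / 2.
  have : nm (1 - s) ^+ 2 < 1 by rewrite expr_lt1 ?nm_ge0.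
  by rewrite !nm_sqr ReD ImD ReN ImN /=; nra.
have bs := absIm_le s; have as_ := absRe_le s; have q0 := nm_ge0 s.
have qE := nm_sqr s.
have k2 : Re (k * s ^+ 2) = Re k * (Re s * Re s - Im s * Im s) -
    Im k * (Re s * Im s + Im s * Re s) by rewrite ReM expr2 ReM ImM.
rewrite 2!ReD k2; move: (Re (e * s ^+ 3)) es => t es {k2 s1 eB kK}.
move: (nm s) (Re s) (Im s) (Re k) (Im k) kE ik rk u0 bs as_ q0 qE sd es.
move=> q al be rho sig kE ik rk u0 bs as_ q0 qE sd es.
set u := al - q ^+ 2 / 2 in u0.
have al0 : 0 < al by rewrite /u in u0; nra.
have cross : `|2 * al * (rho * al - sig * be)| <= 4 * K * q * al.
  rewrite normrM ger0_norm; last by lra.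
  have : `|rho * al - sig * be| <= 2 * K * q.
    apply: le_trans (ler_normB _ _) _; rewrite !normrM.
    have h1 : `|rho| * `|al| <= K * q by apply: ler_pM.
    have h2 : `|sig| * `|be| <= K * q by apply: ler_pM.
    by lra.
  by nra.
move: cross; rewrite ler_norml => /andP[cross _].
have E : al + (rho * (al * al - be * be) - sig * (al * be + be * al)) =
   u + q ^+ 2 * (2^-1 - rho) + 2 * al * (rho * al - sig * be).
  have H : be * be = q ^+ 2 - al ^+ 2 by lra.
  by rewrite /u H; lra.
rewrite E.
have a1 : 4 * K * q * al = 4 * K * q * u + 2 * K * q ^+ 3 by rewrite /u; field.
have a2 : 0 < u * (1 - 4 * K * q) by apply: mulr_gt0 => //; nra.
have a3 : 0 <= q ^+ 2 * ((2^-1 - rho) - (2 * K + B) * q).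
  by apply: mulr_ge0; [exact: sqr_ge0 | rewrite kE; nra].
by lra.
Qed.

End LocalConvexity.

Section Expansion.
Variables (R : realType) (d : nat).
Local Notation C := R[i].
Implicit Types (a : nat -> C) (x s e z : C) (zs : seq C).

Lemma one_sub_pow k : exists B : R, 0 <= B /\ forall s, nm s <= 1 ->
  exists e, nm e <= B /\
    (1 - s) ^+ k = 1 - k%:R * s + ('C(k, 2))%:R * s ^+ 2 + e * s ^+ 3.
Proof.
elim: k => [|k [B [B0 IH]]].
  exists 0; split=> // s _; exists 0; split; first by rewrite nm0.
  by rewrite expr0 bin0n /=; ring.
exists (B * 2 + ('C(k, 2))%:R); split; first by rewrite addr_ge0 ?mulr_ge0.
move=> s s1; have [e [eB E]] := IH s s1.
exists (e * (1 - s) - ('C(k, 2))%:R); split.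
  apply: le_trans (nmB _ _) _; rewrite nm_nat lerD2r nmM ler_pM ?nm_ge0 //.
  by apply: le_trans (nmB _ _) _; rewrite nm1; lra.
by rewrite exprSr E binS bin1 natrD -natr1; ring.
Qed.

(** This is [x^2 phi''(x) / 2], the quadratic coefficient of [phi (x (1 - s))] in [s]. *)
Definition curv a x : C := x^-1 + \sum_(1 <= k < d.+1) ('C(k, 2))%:R * a k * x ^+ k.

Lemma phi_expansion (A : R) : exists B : R, 0 <= B /\ forall a x s,
  (forall k, nm (a k) <= A) -> nm x = 1 -> nm s <= 2^-1 ->
  exists e, nm e <= B /\
    phi d a (x * (1 - s)) = phi d a x + normal d a x * s + curv a x * s ^+ 2 + e * s ^+ 3.
Proof.
have [Bk BkP] := choice one_sub_pow.
have Bk0 k : 0 <= Bk k by have [] := BkP k.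
pose B := 2 + \sum_(1 <= k < d.+1) `|A| * Bk k.
exists B; split.
  by rewrite addr_ge0 // sumr_ge0 // => k _; rewrite mulr_ge0.
move=> a x s aA x1 s2; have x0 := circle_neq0 x1.
have s1 : nm s <= 1 by apply: le_trans s2 _; rewrite invf_le1 // ler1n.
have ek_ k : exists e, nm e <= Bk k /\
    (1 - s) ^+ k = 1 - k%:R * s + ('C(k, 2))%:R * s ^+ 2 + e * s ^+ 3.
  by have [_ /(_ s s1)] := BkP k.
have [ek ekP] := choice ek_.
have q1 : 2^-1 <= nm (1 - s).
  by have := nmD (1 - s) s; rewrite subrK nm1; lra.
have q0 : 1 - s != 0 by rewrite -nm_gt0; apply: lt_le_trans q1; rewrite invr_gt0.
exists (x^-1 * (1 - s)^-1 + \sum_(1 <= k < d.+1) a k * x ^+ k * ek k); split.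
  apply: le_trans (nmD _ _) _; rewrite /B lerD //.
    rewrite nmM !nmV x1 invr1 mul1r -[2]invrK lef_pV2 ?posrE ?invr_gt0 //.
    by apply: lt_le_trans q1; rewrite invr_gt0.
  apply: le_trans (nm_sum _ _) _; apply: ler_sum => k _.
  rewrite !nmM nmX x1 expr1n mulr1 ler_pM ?nm_ge0 //; last by have [] := ekP k.
  exact: le_trans (aA k) (ler_norm A).
have Esum : \sum_(1 <= k < d.+1) a k * (x * (1 - s)) ^+ k =
    \sum_(1 <= k < d.+1) a k * x ^+ k - (\sum_(1 <= k < d.+1) k%:R * a k * x ^+ k) * s
    + (\sum_(1 <= k < d.+1) ('C(k, 2))%:R * a k * x ^+ k) * s ^+ 2
    + (\sum_(1 <= k < d.+1) a k * x ^+ k * ek k) * s ^+ 3.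
  rewrite !mulr_suml -sumrB -!big_split /=; apply: eq_bigr => k _.
  by rewrite exprMn (proj2 (ekP k)); ring.
have Enorm : normal d a x = x^-1 - \sum_(1 <= k < d.+1) k%:R * a k * x ^+ k.
  rewrite /normal /pfun mulrBl mul1r; congr (_ - _); rewrite mulr_suml.
  by apply: eq_bigr => k _; rewrite exprSr mulrA mulfK.
rewrite /phi Esum Enorm /curv.
move: (\sum_(_ <= k < _) _) (\sum_(_ <= k < _) _) (\sum_(_ <= k < _) _) (\sum_(_ <= k < _) _).
by move=> S1 S2 S3 S4; field; rewrite x0 q0.
Qed.

Lemma deriv_ppolyE a x :
  (ppoly d a)^`().[x] = - \sum_(1 <= k < d.+1) (k * k.+1)%:R * a k * x ^+ k.
Proof.
rewrite /ppoly derivB derivC sub0r hornerN linear_sum horner_sum; congr (- _).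
apply: eq_bigr => k _; rewrite /= derivZ derivXn hornerZ hornerMn hornerXn /=.
by rewrite -mulr_natr natrM; ring.
Qed.

(** [x p'/p] is the sum of [x/(x - z)] over the [d + 1] zeros, and each term has real part [1/2]
    when [x] and [z] lie on the circle. As [curv = normal - p'/2], this gives
    [Re k = 1 - (d + 1)/4]. *)
Lemma curv_normal a zs x : circle_roots d a zs -> nm x = 1 -> pfun d a x != 0 ->
  exists2 k, Re k = (3%:R - d%:R) / 4%:R & curv a x = normal d a x * k.
Proof.
move=> cz x1 px; have x0 := circle_neq0 x1; have [pE szs nz] := cz.
have xz z : z \in zs -> x - z != 0.
  move=> zzs; apply: contra_neq px => xz.
  by rewrite (circle_rootsE _ cz); apply/eqP; rewrite prodf_seq_eq0; apply/hasP; exists z; rewrite ?xz ?eqxx.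
have xzs : x \notin zs by apply/negP => /xz; rewrite subrr eqxx.
pose S := \sum_(z <- zs) x * (x - z)^-1.
have ReS : Re S = (d.+1)%:R / 2%:R.
  have half z : z \in zs -> Re (x * (x - z)^-1) = 2^-1.
    move=> zzs; have z0 := circle_neq0 (nz z zzs); have xz0 := xz z zzs.
    have E : x * (x - z)^-1 + cj (x * (x - z)^-1) = 1.
      rewrite conjcM conjc_V conjcB (circle_conj x1) (circle_conj (nz z zzs)).
      have zx : z - x != 0 by rewrite -opprB oppr_eq0.
      have -> : x^-1 - z^-1 = (z - x) / (x * z) by field; rewrite z0 x0.
      by field; rewrite zx x0 z0 xz0.
    have := congr1 (@complex.Re R) E; rewrite ReD Re_conjc /=; lra.
  rewrite /S -szs; elim: (zs) half => [|z s IH] half.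
    by rewrite big_nil mul0r.
  rewrite big_cons ReD half ?mem_head // IH => [|w ws]; last first.
    by apply: half; rewrite in_cons ws orbT.
  by rewrite /= -natr1; lra.
exists (1 - 2%:R^-1 * S).
  rewrite ReD ReN ReM ReS -natr1.
  have -> : Re (2%:R^-1 : C) = 2^-1 by rewrite -(rmorph_nat (real_complex R)) -fmorphV.
  have -> : Im (2%:R^-1 : C) = 0 by rewrite -(rmorph_nat (real_complex R)) -fmorphV.
  by rewrite mul0r subr0 /=; lra.
have p'E : (ppoly d a)^`().[x] = pfun d a x * \sum_(z <- zs) (x - z)^-1.
  by rewrite pE deriv_prod_XsubC // -(circle_rootsE _ cz).
have E : curv a x = normal d a x - 2%:R^-1 * (ppoly d a)^`().[x].
  rewrite deriv_ppolyE mulrN opprK /curv /normal /pfun mulrBl mul1r -addrA; congr (_ + _).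
  rewrite mulr_suml mulr_sumr -sumrN -big_split /=; apply: eq_bigr => k _.
  rewrite exprSr mulrA mulfK //.
  have h2 : (k * k.-1 = 2 * 'C(k, 2))%N by rewrite -mul_bin_diag bin1.
  have : (k * k.+1 = 2 * 'C(k, 2) + 2 * k)%N by rewrite -h2; nia.
  move/(congr1 (fun n => n%:R : C)) => ->; rewrite natrD !natrM.
  by field; rewrite ?pnatr_eq0.
rewrite E p'E /normal /S -mulr_sumr.
by move: (\sum_(_ <- _) _) => T; field; rewrite x0 ?pnatr_eq0.
Qed.

Lemma clim_normal (F : set_system nat) (FF : ProperFilter F)
    (an : nat -> nat -> C) a x : x != 0 ->
  (forall k, clim F (fun n => an n k) (a k)) ->
  clim F (fun n => normal d (an n) x) (normal d a x).
Proof.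
move=> x0 ha; apply: climM; last exact: clim_cst.
by apply: clim_pfun => //; exact: clim_cst.
Qed.

(** The normals at [x] of [an n] and of [a] span the same line by self-reciprocity, so [cj N * Nn]
    is real, and eventually positive. What remains is the cubic inequality for the expansion at [x],
    with constants uniform in [n]. *)
Lemma local_convexity (F : set_system nat) (FF : ProperFilter F)
    (an : nat -> nat -> C) (a : nat -> C) (A : R) (xn : nat -> C) x :
  (2 <= d)%N -> (forall k, clim F (fun n => an n k) (a k)) ->
  (forall n k, nm (an n k) <= A) ->
  (\forall n \near F, exists zs, circle_roots d (an n) zs) ->
  self_reciprocal d a -> nm x = 1 -> pfun d a x != 0 ->
  clim F xn x -> (forall n, nm (xn n) < 1) ->
  \forall n \near F, 0 < Re (cj (normal d a x) * (phi d (an n) (xn n) - phi d (an n) x)).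
Proof.
move=> d2 ca bA croots ra x1 px cx xn1; have x0 := circle_neq0 x1.
have d0 : (0 < d)%N by lia.
set N := normal d a x; have N0 : N != 0 by rewrite mulf_neq0 // invr_neq0.
have cN := clim_normal _ x0 ca.
have nN : 0 < nm N by rewrite nm_gt0.
have [B [B0 BP]] := phi_expansion A.
pose M := 1 + \sum_(1 <= k < d.+1) ('C(k, 2))%:R * `|A|.
have M0 : 0 <= M by rewrite addr_ge0 // sumr_ge0 // => k _; rewrite mulr_ge0.
have c0 : 0 < nm N / 2 by rewrite divr_gt0.
have [delta delta0 dP] := @cubic_positivity _ d (M / (nm N / 2)) (B / (nm N / 2)) d2
  (divr_ge0 M0 (ltW c0)) (divr_ge0 B0 (ltW c0)).
have cs : clim F (fun n => 1 - xn n / x) 0.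
  have -> : (0 : C) = 1 - x / x by rewrite mulfV // subrr.
  exact: (climB _ (clim_cst _ _) (climM _ cx (clim_cst _ _))).
have cNN : clim F (fun n => cj N * normal d (an n) x) (cj N * N).
  exact: (climM _ (clim_cst _ _) (cN _)).
have E1 : \forall n \near F, nm N / 2 < nm (normal d (an n) x).
  by apply: (clim_nm_gt _ (cN _)); rewrite -/N; lra.
have E2 : \forall n \near F, nm (1 - xn n / x) < delta.
  by apply: (clim_nm_lt _ cs); rewrite nm0.
have E3 : \forall n \near F, nm (1 - xn n / x) < 2^-1.
  by apply: (clim_nm_lt _ cs); rewrite nm0 invr_gt0.
have E4 : \forall n \near F, 0 < Re (cj N * normal d (an n) x).
  by apply: (clim_Re_gt _ cNN); rewrite mulrC mulcJ /= exprn_gt0.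
near=> n.
have [zs cz] : exists zs, circle_roots d (an n) zs by near: n.
have N1 : nm N / 2 < nm (normal d (an n) x) by near: n.
have s1 : nm (1 - xn n / x) < delta by near: n.
have s2 : nm (1 - xn n / x) < 2^-1 by near: n.
have RN : 0 < Re (cj N * normal d (an n) x) by near: n.
have rn := circle_roots_reciprocal cz.
set s := 1 - xn n / x in s1 s2; set Nn := normal d (an n) x in N1 RN.
have Nn0 : Nn != 0 by rewrite -nm_gt0; lra.
have pn0 : pfun d (an n) x != 0.
  by apply: contra_neq Nn0 => E; rewrite /Nn /normal E mul0r.
have xs : xn n = x * (1 - s) by rewrite /s subKr mulrCA mulfV // mulr1.
have [k kE cE] := curv_normal cz x1 pn0.
have [e [eB phiE]] := BP (an n) x s (bA n) x1 (ltW s2).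
rewrite -/Nn in cE phiE.
have -> : phi d (an n) (xn n) - phi d (an n) x = Nn * (s + k * s ^+ 2 + e / Nn * s ^+ 3).
  by rewrite [in LHS]xs phiE cE; field.
have IN : Im (cj N * Nn) = 0.
  have : cj (cj N * Nn) = cj N * Nn.
    have NJ : x ^+ d.-1 * cj N = N := normal_conj d0 ra x1.
    have NnJ : x ^+ d.-1 * cj Nn = Nn := normal_conj d0 rn x1.
    by rewrite conjcM conjcK -[in LHS]NJ -[in RHS]NnJ; ring.
  by move/(congr1 (@complex.Im R)); rewrite Im_conjc; lra.
rewrite mulrA ReM IN mul0r subr0 mulr_gt0 //; apply: dP => //.
- have cM : nm (curv (an n) x) <= M.
    apply: le_trans (nmD _ _) _; rewrite nmV x1 invr1 lerD2l.
    apply: le_trans (nm_sum _ _) _; apply: ler_sum => i _.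
    rewrite !nmM nmX x1 expr1n mulr1 nm_nat ler_wpM2l //.
    exact: le_trans (bA n i) (ler_norm A).
  have kM : nm Nn * nm k <= M by rewrite -nmM -cE.
  rewrite ler_pdivlMr //; apply: le_trans kM; rewrite mulrC ler_wpM2r ?nm_ge0 //.
  exact: ltW.
- rewrite nmM nmV ler_pM ?nm_ge0 ?invr_ge0 ?nm_ge0 //.
  by rewrite lef_pV2 ?posrE ?ltW //; lra.
- by rewrite /s subKr nmM nmV x1 invr1 mulr1.
Unshelve. all: by end_near. Qed.

End Expansion.

(** * Rigidity of cusps *)

Section CuspContact.
Variable R : realType.
Local Notation C := R[i].
Implicit Types (x y z v : C) (s : seq C).

Lemma pow_near_one v (tau : R) j : nm v = 1 -> nm (v - 1) <= tau ->
  nm (v ^+ j - 1) <= j%:R * tau.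
Proof.
move=> v1 vt; elim: j => [|j IH]; first by rewrite expr0 subrr nm0 mul0r.
have -> : v ^+ j.+1 - 1 = v * (v ^+ j - 1) + (v - 1) by rewrite exprS; ring.
apply: le_trans (nmD _ _) _; rewrite nmM v1 mul1r -natr1 mulrDl mul1r.
exact: lerD.
Qed.

Lemma Re_near_one z (e : R) : nm (z - 1) <= e -> 1 - e <= Re z.
Proof.
move=> ze; have := absRe_le (z - 1); rewrite ler_norml ReD ReN /= => /andP[+ _].
by lra.
Qed.

Lemma Im_pow_lower v j : 0 < Im v -> (forall i, (i <= j.+1)%N -> 2^-1 <= Re (v ^+ i)) ->
  Im v <= Im (v ^+ j.+1).
Proof.
move=> h0; elim: j => [|j IH] Rv; first by rewrite expr1.
rewrite exprS ImM; have := IH (fun i ij => Rv i (leqW ij)).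
have := Rv 1%N isT; rewrite expr1 => r1.
have := Rv j.+1 (leqnSn _); move: (Re (v ^+ _)) (Im (v ^+ _)) => p q; nra.
Qed.

Lemma ratio_sub_one x y z v : v != 0 -> y != z -> x = y * v ^+ 2 ->
  (x - z) / (v * (y - z)) - 1 = (v - 1) * (v * y + z) / (v * (y - z)).
Proof. by move=> v0 yz ->; rewrite -subr_eq0 in yz; field; rewrite v0 yz. Qed.

(** As [v] is half the rotation from [y] to [x], the quotient would be real if [y] too were on the
    circle. Inside the disc it acquires an imaginary part of sign opposite to [Im v], small when [y]
    is near the circle and away from [z]. *)
Lemma ratio_Im x y z v : nm v = 1 -> nm z = 1 -> y != z -> x = y * v ^+ 2 ->
  Im ((x - z) / (v * (y - z))) = - ((1 - nm y ^+ 2) * Im v) / nm (y - z) ^+ 2.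
Proof.
move=> v1 z1 yz xE; have v0 := circle_neq0 v1; have z0 := circle_neq0 z1.
have q0 : y - z != 0 by rewrite subr_eq0.
have n0 : nm (y - z) ^+ 2 != 0 by rewrite expf_neq0 // nm_eq0.
have E : (x - z) / (v * (y - z)) =
    ((nm (y - z) ^+ 2)^-1)%:C * ((x - z) * cj v * cj (y - z)).
  have -> : ((nm (y - z) ^+ 2)^-1)%:C = ((y - z) * cj (y - z))^-1.
    by rewrite mulcJ fmorphV.
  have q0' : cj (y - z) != 0 by rewrite conjc_eq0.
  by rewrite (circle_conj v1); move: (y - z) (cj _) q0 q0' => p p' *; field; rewrite v0; apply/and3P.
rewrite E ImM /= mul0r addr0.
have -> : (x - z) * cj v * cj (y - z) =
    (nm y ^+ 2)%:C * v - (y * v * cj z + cj (y * v * cj z)) + cj v.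
  have e1 : v * cj v = 1 by rewrite mulcJ v1 expr1n.
  have e2 : z * cj z = 1 by rewrite mulcJ z1 expr1n.
  rewrite -mulcJ !conjcM conjcK conjcB xE.
  transitivity (y * v * (v * cj v) * (cj y - cj z) - z * cj v * cj y + (z * cj z) * cj v).
    by ring.
  by rewrite e1 e2; ring.
rewrite !(ImD, ImN, ImM, Im_conjc, ReM, Re_conjc) /= mulrC.
by congr (_ / _); ring.
Qed.

(** The normals at [x] and [y] have quotient [rho z0 * w] with [w = v^(d-1) P], where [P] collects
    the zeros away from the contact. These turn the argument only slightly, so [Im w > 0], whereas
    [Im (rho z0) < 0]; a negative real product would give both imaginary parts the same sign. *)
Lemma cusp_contact_oriented (d : nat) (c : R) x y z0 s v (r : R) :
  (2 <= d)%N -> 0 < c -> c <= 1 -> size s = d -> nm z0 = 1 -> (forall z, z \in s -> nm z = 1) ->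
  (forall z, z \in s -> c <= nm (y - z)) -> nm x = nm y -> nm y < 1 -> y != 0 ->
  nm v = 1 -> x = y * v ^+ 2 -> 0 < Im v ->
  nm (v - 1) * (4 * (d * 2 ^ d)%:R) <= c ->
  (1 - nm y ^+ 2) * (4 * (d * 2 ^ d)%:R) <= c ^+ 2 ->
  r < 0 ->
  (x - z0) * \prod_(z <- s) (x - z) / x = r%:C * ((y - z0) * \prod_(z <- s) (y - z) / y) ->
  False.
Proof.
move=> d2; have dE : d.-1 = (d.-2).+1 by lia.
have d0 : (0 < d)%N by lia.
move=> c0 c1 sd z01 s1 ys xy y1 y0 v1 xE h0 small1 small2 r0 E.
have v0 := circle_neq0 v1; set h := Im v in h0.
have Dd : (d * 2 <= d * 2 ^ d)%N.
  by rewrite leq_mul2l -{1}(expn1 2) leq_exp2l // (leq_trans _ d2) ?orbT.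
have D4 : 4 <= (d * 2 ^ d)%:R :> R by rewrite (ler_nat _ 4); apply: leq_trans Dd; lia.
have Dd' : d%:R * 2 <= (d * 2 ^ d)%:R :> R by rewrite -natrM ler_nat.
set D := (d * 2 ^ d)%:R in small1 small2 D4 Dd'.
set tau := nm (v - 1) in small1; have tau0 : 0 <= tau := nm_ge0 _.
have tauD : d%:R * tau <= 2^-1 by nra.
have yz z : nm z = 1 -> y != z by move=> z1; apply: contraTneq y1 => ->; rewrite z1 ltxx.
pose rho z := (x - z) / (v * (y - z)).
have rho1 z : z \in s -> nm (rho z - 1) <= 2 * tau / c.
  move=> zs; have z1 := s1 z zs.
  rewrite /rho ratio_sub_one ?yz // nmM nmM nmV nmM v1 mul1r -/tau [2 * tau]mulrC.
  have q0 : 0 < nm (y - z) by apply: lt_le_trans (ys z zs).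
  apply: ler_pM; [by apply: mulr_ge0 => //; exact: nm_ge0|by rewrite invr_ge0 nm_ge0| |].
    rewrite ler_wpM2l //; apply: le_trans (nmD _ _) _.
    by rewrite nmM v1 z1; lra.
  by rewrite lef_pV2 ?posrE // ys.
have rhoI z : z \in s -> `|Im (rho z)| <= (1 - nm y ^+ 2) / c ^+ 2 * h.
  move=> zs; have z1 := s1 z zs; rewrite /rho ratio_Im ?yz //.
  have q0 : 0 < nm (y - z) by apply: lt_le_trans (ys z zs).
  have p0 : 0 <= 1 - nm y ^+ 2 by have := nm_ge0 y; nra.
  rewrite mulNr normrN ger0_norm; last first.
    by apply: divr_ge0; [apply: mulr_ge0 => //; exact: ltW | exact: sqr_ge0].
  rewrite mulrAC ler_wpM2r ?(ltW h0) // ler_wpM2l // lef_pV2 ?posrE ?exprn_gt0 //.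
  by rewrite ler_pXn2r ?nnegrE ?nm_ge0 ?(ltW c0) // ys.
set theta := 2 * tau / c in rho1; set eta := (1 - nm y ^+ 2) / c ^+ 2 in rhoI.
have theta0 : 0 <= theta by rewrite divr_ge0 ?mulr_ge0 // ltW.
have eta0 : 0 <= eta by rewrite divr_ge0 ?sqr_ge0 //; have := nm_ge0 y; nra.
have thD : D * theta <= 2^-1.
  rewrite /theta mulrA ler_pdivrMr //; nra.
have etD : D * eta <= 4^-1.
  by rewrite /eta mulrA ler_pdivrMr ?exprn_gt0 //; lra.
have th1 : theta <= 1 by nra.
(* [B] solves [B (k+1) = 2 B k + 2^(k+1)], the growth of the error in a product of factors of
   modulus at most 2. This is the origin of [d * 2 ^ d]. *)
pose B (k : nat) : R := (k * 2 ^ k)%:R.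
have hn (k : nat) : (k.+1 * 2 ^ k.+1 = 2 * (k * 2 ^ k) + 2 ^ k.+1)%N.
  by rewrite mulSn addnC expnS mulnCA.
have prodB t : {subset t <= s} ->
   [/\ nm (\prod_(z <- t) rho z) <= (2 ^ size t)%:R,
       nm (\prod_(z <- t) rho z - 1) <= B (size t) * theta &
       `|Im (\prod_(z <- t) rho z)| <= B (size t) * (eta * h)].
  elim: t => [|z t IH] ts.
    rewrite big_nil subrr nm1 nm0 /B /size mul0n !mul0r; split=> //.
    by rewrite /= normr0.
  have zs : z \in s by apply: ts; rewrite mem_head.
  have [|P1 P2 P3] := IH; first by move=> w wt; apply: ts; rewrite in_cons wt orbT.
  rewrite big_cons; set P := \prod_(z <- t) rho z in P1 P2 P3 *.
  have r2 : nm (rho z) <= 2.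
    by have := nmD (rho z - 1) 1; rewrite subrK nm1; have := rho1 z zs; lra.
  have rI := rhoI z zs; have rr1 := rho1 z zs.
  have e0 : 0 <= eta * h by rewrite mulr_ge0 // ltW.
  have B1 : B (size (z :: t)) = 2 * B (size t) + (2 ^ (size t).+1)%:R.
    by rewrite /B [size (z :: t)]/= hn natrD natrM.
  have B2 : (2 ^ (size t).+1)%:R = 2 * (2 ^ size t)%:R :> R by rewrite expnS natrM.
  have two1 : 1 <= (2 ^ size t)%:R :> R by rewrite (ler_nat _ 1) expn_gt0.
  have BB : 0 <= B (size t) by rewrite ler0n.
  split.
  - by rewrite nmM /= B2 ler_pM ?nm_ge0.
  - have -> : rho z * P - 1 = rho z * (P - 1) + (rho z - 1) by ring.
    apply: le_trans (nmD _ _) _; rewrite nmM B1 B2 mulrDl.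
    have : nm (rho z) * nm (P - 1) <= 2 * (B (size t) * theta) by apply: ler_pM; rewrite ?nm_ge0.
    by nra.
  - rewrite ImM B1 B2 mulrDl; apply: le_trans (ler_normD _ _) _; rewrite !normrM.
    have : `|Re (rho z)| * `|Im P| <= 2 * (B (size t) * (eta * h)).
      by apply: ler_pM => //; apply: le_trans r2; exact: absRe_le.
    have : `|Im (rho z)| * `|Re P| <= (eta * h) * (2 ^ size t)%:R.
      by apply: ler_pM => //; apply: le_trans P1; exact: absRe_le.
    by nra.
have [//|_ P2 P3] := prodB s; rewrite sd /B -/D in P2 P3.
set P := \prod_(z <- s) rho z in P2 P3.
have ReP : 2^-1 <= Re P by have := Re_near_one P2; lra.
have ImP : - (4^-1 * h) <= Im P.
  move: P3; rewrite ler_norml => /andP[+ _]; apply: le_trans; rewrite lerN2 mulrA.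
  by rewrite ler_wpM2r // ltW.
have Rv i : (i <= d)%N -> 2^-1 <= Re (v ^+ i).
  move=> id_; have := pow_near_one i v1 (lexx _); rewrite -/tau => /Re_near_one.
  have : i%:R * tau <= d%:R * tau by rewrite ler_wpM2r // ler_nat.
  by lra.
pose w := v ^+ d.-1 * P.
have Imw : 0 < Im w.
  have vI : h <= Im (v ^+ d.-1).
    rewrite dE; apply: Im_pow_lower => // i; rewrite -dE => id_; apply: Rv.
    exact: leq_trans id_ (leq_pred d).
  have vR : Re (v ^+ d.-1) <= 1.
    by apply: le_trans (Re_le_nm _) _; rewrite nmX v1 expr1n.
  have vR' : 2^-1 <= Re (v ^+ d.-1) by apply: Rv; exact: leq_pred.
  rewrite /w ImM; move: (Re (v ^+ _)) (Im (v ^+ _)) (Re P) (Im P) vI vR vR' ReP ImP.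
  by move=> p q p' q' *; nra.
have rE : rho z0 * w = r%:C.
  have q0 z : nm z = 1 -> y - z != 0 by move=> /yz; rewrite subr_eq0.
  have PY : \prod_(z <- s) (y - z) != 0.
    by rewrite prodf_seq_neq0; apply/allP => z zs; rewrite /= q0 // s1.
  have PE : P = \prod_(z <- s) (x - z) / (v ^+ d * \prod_(z <- s) (y - z)).
    rewrite /P -sd; elim: (s) => [|z t IH]; first by rewrite !big_nil expr0 mulr1 invr1 mulr1.
    by rewrite !big_cons IH /rho exprS !invfM; ring.
  have x0 : x != 0 by rewrite xE mulf_neq0 // expf_neq0.
  have z0' := q0 z0 z01.
  have E2 : (x - z0) * \prod_(z <- s) (x - z) =
     x * (r%:C * ((y - z0) * \prod_(z <- s) (y - z) / y)) by rewrite -E; field.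
  have -> : rho z0 * w = v ^+ d.-1 * ((x - z0) * \prod_(z <- s) (x - z)) /
     (v * v ^+ d * (y - z0) * \prod_(z <- s) (y - z)).
    by rewrite /w PE /rho !invfM; ring.
  rewrite E2 xE (_ : v ^+ d = v * v ^+ d.-1); last by rewrite -exprS prednK.
  have vd : v ^+ d.-1 != 0 by rewrite expf_neq0.
  move: (v ^+ d.-1) (\prod_(z <- s) (y - z)) (y - z0) vd PY z0' => p q t p0 q0' t0.
  by field; rewrite p0 q0' t0 y0 v0.
have w0 : 0 < nm w ^+ 2.
  by rewrite exprn_gt0 // nm_gt0; apply: contraTneq Imw => ->; rewrite ltxx.
have Irho : Im (rho z0) < 0.
  have q0 : 0 < nm (y - z0) by rewrite nm_gt0 subr_eq0 yz.
  rewrite /rho ratio_Im ?yz // mulNr oppr_lt0; apply: divr_gt0; last exact: exprn_gt0.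
  apply: mulr_gt0 => //; have := nm_ge0 y; move: y1; clear; nra.
have : rho z0 * (nm w ^+ 2)%:C = r%:C * cj w by rewrite -rE -mulcJ; ring.
move: (rho z0) (nm w ^+ 2) Irho w0 => q n2 Irho w0.
move/(congr1 (@complex.Im R)); rewrite !ImM Im_conjc /= mulr0 mul0r add0r addr0 => H.
have : Im q * n2 < 0 by rewrite nmulr_rlt0.
by rewrite H mulrN oppr_lt0 nmulr_rgt0 // ltNge ltW.
Qed.

(** For [v] the principal root of [x / y], the case [Im v < 0] becomes the oriented one by
    exchanging [x] and [y], which conjugates [v] and inverts [r]. *)
Lemma cusp_contact (d : nat) (c : R) x y z0 s (r : R) :
  (2 <= d)%N -> 0 < c -> c <= 1 -> size s = d -> nm z0 = 1 -> (forall z, z \in s -> nm z = 1) ->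
  (forall z, z \in s -> c <= nm (x - z)) ->
  (forall z, z \in s -> c <= nm (y - z)) -> nm x = nm y -> nm y < 1 -> y != 0 -> x != y ->
  nm (x / y - 1) * (4 * (d * 2 ^ d)%:R) <= c ->
  (1 - nm y ^+ 2) * (4 * (d * 2 ^ d)%:R) <= c ^+ 2 ->
  r < 0 ->
  (x - z0) * \prod_(z <- s) (x - z) / x = r%:C * ((y - z0) * \prod_(z <- s) (y - z) / y) ->
  False.
Proof.
move=> d2 c0 c1 sd z01 s1 xs ys xy y1 y0 xny small1 small2 r0 E.
have x0 : x != 0 by rewrite -nm_gt0 xy nm_gt0.
pose v := sqrtc (x / y); have v2 : v ^+ 2 = x / y := sqr_sqrtc _.
have v1 : nm v = 1.
  have : nm v ^+ 2 = 1 by rewrite -nmX v2 nmM nmV xy mulfV // nm_eq0.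
  by move/eqP; rewrite sqrp_eq1 ?nm_ge0 // => /eqP.
have Rv : 0 <= Re v := Re_sqrtc_ge0 _.
have v0 := circle_neq0 v1.
have vt : nm (v - 1) <= nm (x / y - 1).
  rewrite -v2 (_ : v ^+ 2 - 1 = (v - 1) * (v + 1)); last by ring.
  rewrite nmM ler_peMr ?nm_ge0 //; apply: le_trans (Re_le_nm _).
  by rewrite ReD /=; lra.
have D0 : 0 <= 4 * (d * 2 ^ d)%:R :> R by rewrite mulr_ge0.
have small1' : nm (v - 1) * (4 * (d * 2 ^ d)%:R) <= c.
  by apply: le_trans small1; rewrite ler_wpM2r.
have [im|im|im] := ltgtP 0 (Im v).
- apply: (@cusp_contact_oriented d c x y z0 s v r) => //.
  by rewrite v2 mulrCA mulfV // mulr1.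
- apply: (@cusp_contact_oriented d c y x z0 s (cj v) r^-1) => //.
  + by rewrite xy.
  + by rewrite nmJ.
  + rewrite (circle_conj v1) exprVn v2 invf_div mulrCA mulfV // mulr1 //.
  + by rewrite Im_conjc oppr_gt0.
  + by rewrite -{1}(conjc_1 R) -conjcB nmJ.
  + by rewrite xy.
  + by rewrite invr_lt0.
  + rewrite E mulrA fmorphV mulVf ?mul1r //.
    by rewrite -nm_eq0 nm_real normr_eq0 lt_eqF.
- have v1' : v = 1.
    have : Re v ^+ 2 = 1 by rewrite -[RHS](expr1n _ 2) -v1 nm_sqr -im expr0n addr0.
    move/eqP; rewrite sqrp_eq1 // => /eqP rv; apply: complex_ext => //=.
  move: v2; rewrite v1' expr1n => /esym /divr1_eq xyE.
  by move: xny; rewrite xyE eqxx.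
Qed.

End CuspContact.

(** * Perturbation *)

Section Perturbation.
Variables (R : realType) (d : nat).
Local Notation C := R[i].
Implicit Types (a b : nat -> C) (x y z : C) (zs : seq C).

Lemma near_seq (F : set_system nat) (FF : Filter F) (T : eqType) (s : seq T) (P : T -> nat -> Prop) :
  (forall t, t \in s -> \forall n \near F, P t n) ->
  \forall n \near F, forall t, t \in s -> P t n.
Proof.
elim: s => [|z s IH] H; first by apply: filterE => n z; rewrite in_nil.
have H1 := H z (mem_head _ _).
have H2 : \forall n \near F, forall t, t \in s -> P t n.
  by apply: IH => w ws; apply: H; rewrite in_cons ws orbT.
near=> n => w; rewrite in_cons => /orP[/eqP ->|ws]; first by near: n.
by move: w ws; near: n.
Unshelve. all: by end_near. Qed.

Lemma separated_points x zs : x \notin zs ->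
  exists2 c : R, 0 < c & forall z, z \in zs -> c <= nm (z - x).
Proof.
elim: zs => [|z s IH]; first by exists 1 => // z; rewrite in_nil.
rewrite in_cons negb_or => /andP[xz /IH[c c0 cP]].
exists (Num.min c (nm (z - x))).
  by rewrite lt_min c0 nm_gt0 subr_eq0 eq_sym.
move=> w; rewrite in_cons => /orP[/eqP ->|/cP cw]; first by rewrite ge_min lexx orbT.
by rewrite ge_min cw.
Qed.

Lemma clim_deriv_ppoly (F : set_system nat) (FF : ProperFilter F)
    (an : nat -> nat -> C) a x :
  (forall k, clim F (fun n => an n k) (a k)) ->
  clim F (fun n => (ppoly d (an n))^`().[x]) (ppoly d a)^`().[x].
Proof.
move=> ca; rewrite deriv_ppolyE.
under eq_fun do rewrite deriv_ppolyE.
apply: climN; apply: clim_sum => k.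
exact: (climM _ (climM _ (clim_cst _ _) (ca k)) (clim_cst _ _)).
Qed.

Lemma circle_root_simple a zs z : circle_roots d a zs -> uniq zs -> z \in zs ->
  (ppoly d a)^`().[z] != 0.
Proof.
move=> [E _ _] uz zzs; rewrite E (big_rem z) //= derivM derivXsubC mul1r.
rewrite hornerD hornerM hornerXsubC subrr mul0r addr0.
apply/eqP => /rootP; rewrite root_prod_XsubC.
by rewrite mem_rem_uniq // inE eqxx.
Qed.

(* A simple zero on the circle cannot leave it: its reflection would be a
   second zero nearby. *)
Lemma circle_roots_persist (F : set_system nat) (FF : ProperFilter F)
    (an : nat -> nat -> C) a zs (c : R) :
  (0 < d)%N -> (forall k, clim F (fun n => an n k) (a k)) ->
  (forall n, an n d = - (d%:R)^-1) -> (forall n, self_reciprocal d (an n)) ->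
  circle_roots d a zs -> uniq zs -> 0 < c ->
  \forall n \near F, exists2 h : C -> C, circle_roots d (an n) (map h zs) &
    forall z, z \in zs -> nm (h z - z) < c.
Proof.
move=> d0 ca and_ rn cz uz c0; have [pE szs nz] := cz.
have [c1 c10 c1P] : exists2 c1 : R, 0 < c1 & forall z w, z \in zs -> w \in zs -> z != w ->
    c1 <= nm (z - w).
  have sep z : exists c1 : R, z \in zs -> 0 < c1 /\ forall w, w \in zs -> w != z -> c1 <= nm (w - z).
    have [zzs|nz'] := boolP (z \in zs); last by exists 0.
    have zr : z \notin rem z zs by rewrite mem_rem_uniq // inE eqxx.
    have [c1 c10 c1P] := separated_points zr; exists c1 => _; split=> // w wzs wz.
    by apply: c1P; rewrite mem_rem_uniq // inE wz.
  have [f fP] := choice sep.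
  have : exists2 c1 : R, 0 < c1 & forall z, z \in zs -> c1 <= f z.
    have fpos z : z \in zs -> 0 < f z by move=> /fP[].
    elim: (zs) fpos => [|z s IH] fpos; first by exists 1.
    have [|c1 c10 c1P] := IH; first by move=> w ws; apply: fpos; rewrite in_cons ws orbT.
    exists (Num.min c1 (f z)); first by rewrite lt_min c10 fpos ?mem_head.
    move=> w; rewrite in_cons => /orP[/eqP ->|/c1P cw]; first by rewrite ge_min lexx orbT.
    by rewrite ge_min cw.
  case=> c1 c10 c1P; exists c1 => // z w zzs wzs zw.
  by apply: le_trans (c1P w wzs) _; have [_] := fP w wzs; apply.
(* [e <= c1 / 4] keeps the discs about distinct zeros disjoint even if one radius is doubled;
   [e <= 1/4] gives [nm xi >= 3/4], so that the reflection of [xi] is within [2 e] of [z]. *)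
pose e := Num.min c (Num.min (c1 / 4) 4^-1).
have e0 : 0 < e by rewrite !lt_min c0; apply/andP; split; lra.
have ec : e <= c by rewrite ge_min lexx.
have e1 : e <= c1 / 4 by rewrite !ge_min lexx !orbT.
have e4 : e <= 4^-1 by rewrite !ge_min lexx !orbT.
have near_z z : z \in zs -> \forall n \near F, exists2 xi, pfun d (an n) xi = 0 & nm (xi - z) < e.
  move=> zzs; have p'z := circle_root_simple cz uz zzs.
  have pz : pfun d a z = 0 by rewrite -ppolyE; apply/rootP; rewrite pE root_prod_XsubC.
  have cp : clim F (fun n => pfun d (an n) z) 0.
    by rewrite -pz; apply: clim_pfun => //; exact: clim_cst.
  have cp' := clim_deriv_ppoly _ z ca.
  pose B := nm (ppoly d a)^`().[z] / 2; have B0 : 0 < B by rewrite divr_gt0 ?nm_gt0.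
  have E1 : \forall n \near F, B < nm (ppoly d (an n))^`().[z].
    by apply: (clim_nm_gt _ (cp' _)); move: B0; rewrite /B; lra.
  have N0 : 0 < (d.+2)%:R :> R by rewrite ltr0n.
  have E2 : \forall n \near F, nm (pfun d (an n) z) < e * B / (d.+2)%:R.
    have t0 : 0 < e * B / (d.+2)%:R by apply: divr_gt0 => //; exact: mulr_gt0.
    by apply: (clim_nm_lt _ cp); rewrite nm0.
  near=> n.
  have b1 : B < nm (ppoly d (an n))^`().[z] by near: n.
  have b2 : nm (pfun d (an n) z) < e * B / (d.+2)%:R by near: n.
  have q0 : (ppoly d (an n))^`().[z] != 0 by rewrite -nm_gt0; exact: lt_trans b1.
  have [xi /rootP rxi dxi] := root_near_critical q0.
  exists xi; first by rewrite -ppolyE.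
  apply: le_lt_trans dxi _; have [-> _] := ppoly_monic d0 (and_ n).
  rewrite ppolyE ltr_pdivrMr; last exact: lt_trans b1.
  move: b2; rewrite ltr_pdivlMr // => b2; rewrite mulrC; apply: lt_trans b2 _.
  by rewrite ltr_pM2l.
have H := near_seq _ near_z.
near=> n.
have Hn : forall z, z \in zs -> exists2 xi, pfun d (an n) xi = 0 & nm (xi - z) < e.
  by near: n; exact: H.
have h_ z : exists xi, z \in zs -> pfun d (an n) xi = 0 /\ nm (xi - z) < e.
  have [/Hn[xi ? ?]|_] := boolP (z \in zs); last by exists 0.
  by exists xi.
have [h hP] := choice h_.
have close z w t : z \in zs -> w \in zs -> nm (t - z) < 2 * e -> nm (t - w) < e -> z = w.
  move=> zzs wzs tz tw; apply/eqP/negPn/negP => zw.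
  have := c1P z w zzs wzs zw; have := nmB (t - w) (t - z).
  have -> : t - w - (t - z) = z - w by ring.
  by lra.
have uh : uniq (map h zs).
  rewrite map_inj_in_uniq // => z w zzs wzs hzw.
  have [_ hz] := hP z zzs; have [_ hw] := hP w wzs.
  by apply: (close z w (h z)) => //; [lra | rewrite hzw].
have [sp lp] := ppoly_monic d0 (and_ n).
have prodE : ppoly d (an n) = \prod_(z <- map h zs) ('X - z%:P).
  have := @all_roots_prod_XsubC _ (ppoly d (an n)) (map h zs).
  rewrite lp scale1r; apply.
  - by rewrite sp size_map szs.
  - by apply/allP => _ /mapP[z zzs ->]; apply/rootP; rewrite ppolyE; have [] := hP z zzs.
  - by rewrite uniq_rootsE.
exists h; last by move=> z zzs; have [_ hz] := hP z zzs; exact: lt_le_trans hz ec.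
split=> //; first by rewrite size_map.
move=> _ /mapP[z zzs ->]; have [p0 hz] := hP z zzs; have z1 := nz z zzs.
set xi := h z in p0 hz *.
have xi34 : 3 / 4 <= nm xi.
  by have := nmB xi (xi - z); rewrite subKr z1; lra.
have xi0 : xi != 0 by rewrite -nm_gt0; lra.
have cxi0 : cj xi != 0 by rewrite conjc_eq0.
pose eta := (cj xi)^-1.
have eta_root : pfun d (an n) eta = 0.
  have eta0 : eta != 0 by rewrite invr_eq0.
  rewrite -(rn n eta eta0) {2}/eta conjc_V conjcK invrK p0.
  by rewrite (rmorph0 (@conjc R)) mulr0.
have eta_close : nm (eta - z) < 2 * e.
  have -> : eta - z = z * cj (z - xi) / cj xi.
    rewrite conjcB mulrBr (_ : z * cj z = 1) ?mulcJ ?z1 ?expr1n // /eta.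
    by field.
  rewrite nmM nmV nmM z1 mul1r !nmJ nm_distC ltr_pdivrMr; last by lra.
  by apply: lt_le_trans hz _; nra.
have : eta \in map h zs by rewrite -root_prod_XsubC -prodE; apply/rootP; rewrite ppolyE.
case/mapP => w wzs etaE; have [_ hw] := hP w wzs.
have zw : z = w by apply: (close z w eta) => //; rewrite etaE.
have xe : xi = eta by rewrite etaE -zw.
have : xi * cj xi = 1 by rewrite {1}xe /eta mulVf.
rewrite mulcJ => /complexI; move/eqP; rewrite sqrp_eq1 ?nm_ge0 // => /eqP.
exact.
Unshelve. all: by end_near. Qed.

(** Index [k] contributes to [x^(k+1)] in [p], which self-reciprocity pairs with [x^(d-k)], that is,
    with index [d-1-k]. Index [d-1] is paired with the absent linear term, and [b d = 0] keeps [a d]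
    fixed. *)
Definition palindromic b :=
  (forall k, (k == 0)%N || (d.-1 <= k)%N -> b k = 0) /\
  (forall k, (0 < k < d.-1)%N -> k%:R * b k = cj ((d.-1 - k)%:R * b (d.-1 - k)%N)).

Lemma palindromic_reciprocal a b (e : R) : (2 <= d)%N -> self_reciprocal d a -> palindromic b ->
  self_reciprocal d (fun k => a k + e%:C * b k).
Proof.
move=> d2 ra [b0 bs] x x0.
pose hb t := \sum_(1 <= k < d.-1) (k%:R * b k) * t ^+ k.+1.
have pE t : pfun d (fun k => a k + e%:C * b k) t = pfun d a t - e%:C * hb t.
  have -> : hb t = \sum_(1 <= k < d.+1) (k%:R * b k) * t ^+ k.+1.
    rewrite /hb [RHS](@big_cat_nat _ _ _ d.-1) /=; [|lia|lia].
    rewrite [X in _ + X]big_nat_cond [X in _ + X]big1 ?addr0 // => k.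
    by rewrite andbT => /andP[k1 _]; rewrite b0 ?k1 ?orbT // mulr0 mul0r.
  rewrite /pfun -addrA -opprD; congr (1 - _).
  by rewrite mulr_sumr -big_split /=; apply: eq_bigr => k _; ring.
have hE : x ^+ d.+1 * cj (hb (cj x)^-1) = hb x.
  rewrite /hb conjc_sum mulr_sumr big_nat_rev /=; apply: eq_big_nat => k /andP[k1 kd].
  have -> : (1 + d.-1 - k.+1 = d.-1 - k)%N by lia.
  rewrite conjcM -bs ?k1 // conjcX conjc_V conjcK.
  have -> : d.+1 = (k.+1 + (d.-1 - k).+1)%N by lia.
  rewrite mulrCA; congr (_ * _); rewrite exprD -mulrA -exprMn mulfV // expr1n mulr1 //.
rewrite !pE conjcB mulrBr ra //; congr (_ - _).
by rewrite conjcM conjc_real mulrCA hE.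
Qed.

End Perturbation.

Section OpenCondition.
Variables (R : realType) (d : nat).
Local Notation C := R[i].
Implicit Types (a b : nat -> C) (x y z : C).

Definition gam b x : C := \sum_(1 <= k < d.+1) b k * x ^+ k.

Lemma phi_perturb a b (e : R) x :
  phi d (fun k => a k + e%:C * b k) x = phi d a x + e%:C * gam b x.
Proof.
rewrite /phi /gam -addrA; congr (_ + _); rewrite mulr_sumr -big_split /=.
by apply: eq_bigr => k _; ring.
Qed.

(* Displacements that keep the two branches at every double point at the same
   height over their common tangent preserve univalence to both sides, because
   the image is locally convex there and cusps cannot open. *)
Lemma univ_perturb a b : (2 <= d)%N -> univ d a -> a d = - (d%:R)^-1 ->
  (forall k, (d < k)%N -> a k = 0) -> palindromic d b ->
  (forall x y, nm x = 1 -> nm y = 1 -> x != y -> phi d a x = phi d a y ->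
     Re (cj (normal d a x) * (gam b x - gam b y)) = 0) ->
  exists2 e0 : R, 0 < e0 & forall e, `|e| < e0 -> univ d (fun k => a k + e%:C * b k).
Proof.
move=> d2 ua ad azero pal disp; have d0 : (0 < d)%N by lia.
have bz k : (d.-1 <= k)%N -> b k = 0 by case: pal => bz _ dk; rewrite bz ?dk ?orbT.
apply: contrapT => nex.
have hn n : 0 < (n.+1)%:R^-1 :> R by rewrite invr_gt0.
have en_ n : exists e : R, `|e| < (n.+1)%:R^-1 /\ ~ univ d (fun k => a k + e%:C * b k).
  apply: contrapT => H; apply: nex; exists (n.+1)%:R^-1 => // e he.
  by apply: contrapT => nu; apply: H; exists e.
have [en enP] := choice en_.
pose an n k := a k + (en n)%:C * b k.
have [zs cz uz] := univ_circle_roots d0 ua ad.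
have ra := circle_roots_reciprocal cz.
have rn n : self_reciprocal d (an n) by apply: palindromic_reciprocal.
have and_ n : an n d = - (d%:R)^-1 by rewrite /an bz ?leq_pred // mulr0 addr0.
have en1 n : `|en n| <= 1.
  have [/ltW /le_trans + _] := enP n; apply.
  by rewrite invf_le1 // ler1n.
have [U [UU sU]] := ultraFilterLemma eventually_filter.
have ce : clim U (fun n => (en n)%:C) 0.
  have che : (fun n => (n.+1)%:R^-1 : R) @ U --> (0 : R).
    by apply: cvg_trans (@cvg_harmonic R); exact: cvg_app.
  apply: (clim_le _ che); apply: filterE => n.
  by rewrite subr0 nm_real; have [/ltW] := enP n.
have ca k : clim U (fun n => an n k) (a k).
  rewrite -[X in clim _ _ X]addr0 -[X in clim _ _ (_ + X)](mul0r (b k)).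
  exact: (climD _ (clim_cst _ _) (climM _ ce (clim_cst _ _))).
pose A := \sum_(0 <= k < d.+1) (nm (a k) + nm (b k)).
have bA n k : nm (an n k) <= A.
  have A0 : 0 <= A by apply: sumr_ge0 => i _; rewrite addr_ge0 ?nm_ge0.
  have [kd|dk] := ltnP k d.+1; last first.
    by rewrite /an azero // bz ?mulr0 ?addr0 ?nm0 //; lia.
  have kI : k \in index_iota 0 d.+1 by rewrite mem_index_iota kd.
  rewrite /A (bigD1_seq k kI (iota_uniq _ _)) /=.
  apply: le_trans (_ : _ <= nm (a k) + nm (b k)) _.
    apply: le_trans (nmD _ _) _; rewrite lerD2l nmM nm_real.
    by rewrite ler_piMl ?nm_ge0.
  by rewrite lerDl sumr_ge0 // => i _; rewrite addr_ge0 ?nm_ge0.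
have persist c : 0 < c -> \forall n \near U, exists2 h : C -> C, circle_roots d (an n) (map h zs) &
    forall z, z \in zs -> nm (h z - z) < c.
  by move=> c0; exact: circle_roots_persist.
have contact_ n : exists t : C * C * R, [/\ nm t.1.1 < 1, nm t.1.2 < 1 &
   (exists zs', circle_roots d (an n) zs') -> [/\ t.1.1 != t.1.2, nm t.1.1 = nm t.1.2,
     gfun d (an n) t.1.1 t.1.2 = 0, t.2 < 0 &
     normal d (an n) t.1.1 = (t.2)%:C * normal d (an n) t.1.2]].
  (* [(0, 0, 0)] is a placeholder for those [n] whose [p] has zeros off the circle; by [croots] this
     eventually does not happen. *)
  have [[zs' cz']|ncz] := pselect (exists zs', circle_roots d (an n) zs'); last first.
    by exists (0, 0, 0); rewrite nm0 ltr01; split=> // /ncz.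
  have pn0 x : nm x < 1 -> pfun d (an n) x != 0.
    move=> x1; rewrite (circle_rootsE _ cz') prodf_seq_neq0; apply/allP => z zs'z /=.
    rewrite subr_eq0; apply: contraTneq x1 => ->; have [_ _ ->] := cz' => //.
    by rewrite ltxx.
  have [_ nu] := enP n; have [x [y [r [xy nxy x1 g0 [r0 E]]]]] := not_univ_contact nu pn0.
  by exists (x, y, r); split=> //=; rewrite -nxy.
have [t tP] := choice contact_.
pose xn n := (t n).1.1; pose yn n := (t n).1.2.
have xn1 n : nm (xn n) < 1 by have [] := tP n.
have yn1 n : nm (yn n) < 1 by have [] := tP n.
have [x cx] : exists l, clim U xn l by apply: (@ultra_clim _ _ UU 1) => n; exact: ltW.
have [y cy] : exists l, clim U yn l by apply: (@ultra_clim _ _ UU 1) => n; exact: ltW.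
have croots : \forall n \near U, exists zs', circle_roots d (an n) zs'.
  by near=> n; have [h ? _] : exists2 h : C -> C, circle_roots d (an n) (map h zs) &
    forall z, z \in zs -> nm (h z - z) < 1 by [near: n; exact: persist]; exists (map h zs).
have good : \forall n \near U, [/\ xn n != yn n, nm (xn n) = nm (yn n),
     gfun d (an n) (xn n) (yn n) = 0, (t n).2 < 0 &
     normal d (an n) (xn n) = ((t n).2)%:C * normal d (an n) (yn n)].
  by near=> n; have [_ _] := tP n; apply; near: n.
have gxy : gfun d a x y = 0.
  have cg := clim_gfun d _ ca cx cy; apply: (@clim_uniq _ U _ _ _ _ (cg _)).
  have c00 : (fun=> 0 : R) @ U --> (0 : R) by exact: cvg_cst.
  apply: (clim_le _ c00); near=> n; have [_ _ -> _ _] : [/\ xn n != yn n, nm (xn n) = nm (yn n),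
     gfun d (an n) (xn n) (yn n) = 0, (t n).2 < 0 &
     normal d (an n) (xn n) = ((t n).2)%:C * normal d (an n) (yn n)] by near: n.
  by rewrite subrr nm0.
have nx1 : nm x <= 1 by apply: (clim_nm_le _ cx); apply: filterE => n; exact: ltW.
have ny1 : nm y <= 1 by apply: (clim_nm_le _ cy); apply: filterE => n; exact: ltW.
have nx : nm x = 1.
  apply/eqP; rewrite eq_le nx1 leNgt; apply/negP => x1.
  by have := univ_neq0_closed ua x1 ny1; rewrite gxy eqxx.
have ny : nm y = 1.
  apply/eqP; rewrite eq_le ny1 leNgt; apply/negP => y1.
  by have := univ_neq0_closed ua y1 nx1; rewrite gfun_sym gxy eqxx.
have x0 := circle_neq0 nx; have y0 := circle_neq0 ny.
(* If the contact points merge, their limit is a zero of [p], that is, a cusp; otherwise it is a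
   double point of the original curve. *)
have [xy|xy] := eqVneq x y.
  have [pE szs nz] := cz.
  have xzs : x \in zs.
    rewrite -root_prod_XsubC -pE; apply/rootP; rewrite ppolyE -gfun_diag.
    by rewrite [in X in gfun _ _ _ X]xy gxy.
  have xr : x \notin rem x zs by rewrite mem_rem_uniq // inE eqxx.
  have [c1 c10 c1P] := separated_points xr.
  (* Zeros are at least [2 c] apart from [x]; the moving zero and the moving contact point use up
     [c / 2] each, which leaves [c]. The minimum with 1 provides [c <= 1]. *)
  pose c := Num.min c1 1 / 2.
  have m0 : 0 < Num.min c1 1 by rewrite lt_min c10 ltr01.
  have mc1 : Num.min c1 1 <= c1 by rewrite ge_min lexx.
  have m1 : Num.min c1 1 <= 1 by rewrite ge_min lexx orbT.
  have c0 : 0 < c by rewrite divr_gt0.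
  have c20 : 0 < c / 2 by rewrite divr_gt0.
  pose D : R := 4 * (d * 2 ^ d)%:R.
  have D0 : 0 < D by rewrite mulr_gt0 // ltr0n muln_gt0 d0 expn_gt0.
  have H1 := persist _ c20.
  have cy' : clim U yn x by rewrite xy.
  have H2 : \forall n \near U, nm (xn n - x) < c / 2 by exact: clim_near.
  have H3 : \forall n \near U, nm (yn n - x) < c / 2 by exact: clim_near.
  have H4 : \forall n \near U, nm (xn n / yn n - 1) < c / D.
    have cq : clim U (fun n => xn n / yn n) 1.
      by rewrite -(mulfV x0); apply: (climM _ cx); exact: climV.
    by apply: clim_near => //; exact: divr_gt0.
  have H5 : \forall n \near U, nm (1 - yn n * cj (yn n)) < c ^+ 2 / D.
    have cq : clim U (fun n => 1 - yn n * cj (yn n)) 0.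
      rewrite [X in clim _ _ X](_ : 0 = 1 - x * cj x); last first.
        by rewrite mulcJ nx expr1n subrr.
      exact: (climB _ (clim_cst _ _) (climM _ cy' (clim_conj _ cy'))).
    by apply: (clim_nm_lt _ cq); rewrite nm0 divr_gt0 ?exprn_gt0.
  have H6 : \forall n \near U, 0 < nm (yn n) by apply: (clim_nm_gt _ cy); rewrite ny.
  suff : \forall n \near U, False by move=> /filter_ex [].
  near=> n.
  have [h czn hclose] : exists2 h : C -> C, circle_roots d (an n) (map h zs) &
    forall z, z \in zs -> nm (h z - z) < c / 2 by near: n.
  have [G1 G2 G3 G4 G5] : [/\ xn n != yn n, nm (xn n) = nm (yn n),
     gfun d (an n) (xn n) (yn n) = 0, (t n).2 < 0 &
     normal d (an n) (xn n) = ((t n).2)%:C * normal d (an n) (yn n)] by near: n.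
  have K2 : nm (xn n - x) < c / 2 by near: n.
  have K3 : nm (yn n - x) < c / 2 by near: n.
  have K4 : nm (xn n / yn n - 1) < c / D by near: n.
  have K5 : nm (1 - yn n * cj (yn n)) < c ^+ 2 / D by near: n.
  have K6 : 0 < nm (yn n) by near: n.
  have [_ _ nzn] := czn.
  have far u z : nm (u - x) < c / 2 -> z \in rem x zs -> c <= nm (u - h z).
    move=> ux zr; have zzs : z \in zs by apply: mem_rem zr.
    have := c1P z zr; have := hclose z zzs.
    have := nmD (z - h z) (h z - u + (u - x)); rewrite (_ : _ + _ = z - x); last by ring.
    have := nmD (h z - u) (u - x); rewrite [nm (h z - u)]nm_distC [nm (z - h z)]nm_distC.
    move: ux; rewrite /c; lra.
  have pn u : pfun d (an n) u = (u - h x) * \prod_(z <- map h (rem x zs)) (u - z).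
    rewrite (circle_rootsE _ czn) !big_map (big_rem x) //=.
  apply: (@cusp_contact R d c (xn n) (yn n) (h x) (map h (rem x zs)) (t n).2) => //.
  - by rewrite /c; lra.
  - by rewrite size_map size_rem // szs.
  - by apply: nzn; exact: map_f.
  - by move=> _ /mapP[z zr ->]; apply: nzn; apply: map_f; exact: mem_rem zr.
  - by move=> _ /mapP[z zr ->]; exact: far.
  - by move=> _ /mapP[z zr ->]; exact: far.
  - by rewrite -nm_gt0.
  - by move: K4; rewrite ltr_pdivlMr // => /ltW.
  - move: K5; rewrite ltr_pdivlMr // mulcJ => K5.
    apply: le_trans (ltW K5); rewrite ler_wpM2r // ?(ltW D0) //.
    by rewrite -(rmorph1 (real_complex R)) -rmorphB nm_real ler_norm.
  - by move: G5; rewrite /normal !pn.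
have phxy : phi d a x = phi d a y by apply/eqP; rewrite phi_eq //; apply/eqP.
have [py [r r0 NE]] := double_point_normals ua nx ny xy phxy.
rewrite -!/(normal d a _) in NE.
have px : pfun d a x != 0.
  have Ny : normal d a y != 0 by rewrite mulf_neq0 // invr_neq0.
  have rC : r%:C != 0 :> C by rewrite -nm_eq0 nm_real normr_eq0 lt_eqF.
  by apply: contra_neq (mulf_neq0 rC Ny) => px; rewrite -NE /normal px mul0r.
have LX : \forall n \near U, 0 < Re (cj (normal d a x) * (phi d (an n) (xn n) - phi d (an n) x)).
  exact: (local_convexity _ d2 ca bA croots ra nx px cx xn1).
have LY : \forall n \near U, 0 < Re (cj (normal d a y) * (phi d (an n) (yn n) - phi d (an n) y)).
  exact: (local_convexity _ d2 ca bA croots ra ny py cy yn1).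
suff : \forall n \near U, False by move=> /filter_ex [].
near=> n.
have lx : 0 < Re (cj (normal d a x) * (phi d (an n) (xn n) - phi d (an n) x)) by near: n; exact: LX.
have ly : 0 < Re (cj (normal d a y) * (phi d (an n) (yn n) - phi d (an n) y)) by near: n; exact: LY.
have [G1 G2 G3 G4 G5] : [/\ xn n != yn n, nm (xn n) = nm (yn n),
     gfun d (an n) (xn n) (yn n) = 0, (t n).2 < 0 &
     normal d (an n) (xn n) = ((t n).2)%:C * normal d (an n) (yn n)] by near: n.
have yn0 : yn n != 0.
  by apply: contra_eqN G3 => /eqP ->; rewrite gfun_sym gfun0 oner_eq0.
have xn0 : xn n != 0.
  by apply: contra_eqN G3 => /eqP ->; rewrite gfun0 oner_eq0.
have phn : phi d (an n) (xn n) = phi d (an n) (yn n).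
  by apply/eqP; rewrite phi_eq //; apply/eqP.
have dz := disp x y nx ny xy phxy.
have ly' : Re (cj (normal d a x) * (phi d (an n) (yn n) - phi d (an n) y)) < 0.
  by rewrite NE conjcM conjc_real -mulrA ReM /= mul0r subr0 nmulr_rlt0.
(* The condition is linear in the displacement, so it holds for either sign of [en n]. *)
have mid : Re (cj (normal d a x) * (phi d (an n) x - phi d (an n) y)) = 0.
  rewrite !phi_perturb phxy (_ : _ + _ - _ = (en n)%:C * (gam b x - gam b y)); last by ring.
  by rewrite mulrCA ReM dz /= mul0r mulr0 subr0.
(* Going from [phi(y_n)] over [phi(y)] and [phi(x)] to [phi(x_n)], the heights along the normal sum
   to zero because the ends agree, yet the outer two contributions are positive and the middle one
   vanishes. *)
have : Re (cj (normal d a x) * (phi d (an n) (xn n) - phi d (an n) x)) +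
   Re (cj (normal d a x) * (phi d (an n) x - phi d (an n) y)) -
   Re (cj (normal d a x) * (phi d (an n) (yn n) - phi d (an n) y)) = 0.
  by rewrite -ReN -!ReD phn -!mulrN -!mulrDr (_ : _ + _ = 0) ?mulr0 //; ring.
by rewrite mid; lra.
Unshelve. all: by end_near. Qed.

End OpenCondition.

(** * The real linear system for admissible displacements *)

Section DisplacementSpace.
Variables (R : realType) (d : nat).
Local Notation C := R[i].

(* Real coordinates on the solutions of [k b_k = conj ((d-1-k) b_(d-1-k))]. *)
Definition palin_basis (i k : nat) : C :=
  if (0 < k < d.-1)%N then
    ((i.+1 == k)%:R * (1 + 'i%C) + (i.+1 == (d.-1 - k)%N)%:R * (1 - 'i%C)) / k%:R
  else 0.

Definition palin_comb (m : nat) (v : 'rV[R]_m) (k : nat) : C :=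
  \sum_(i < m) (v 0 i)%:C * palin_basis i k.

Lemma palin_comb_palindromic m (v : 'rV[R]_m) : palindromic d (palin_comb v).
Proof.
split=> k hk.
  rewrite /palin_comb big1 // => i _; rewrite /palin_basis.
  case: ifP => [/andP[k0 kd]|_]; last by rewrite mulr0.
  by move: hk; rewrite eqn0Ngt k0 leqNgt kd.
rewrite conjcM (_ : cj ((d.-1 - k)%:R) = (d.-1 - k)%:R); last exact: conjc_nat.
rewrite /palin_comb conjc_sum !mulr_sumr; apply: eq_bigr => i _.
rewrite conjcM conjc_real ![_ * (_%:C * _)]mulrCA; congr (_ * _).
have hk' : (0 < d.-1 - k < d.-1)%N by lia.
have nk (j : nat) : (0 < j)%N -> j%:R != 0 :> C by rewrite pnatr_eq0 -lt0n.
rewrite /palin_basis hk hk' subKn; last by lia.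
rewrite conjcM conjc_V (_ : cj ((d.-1 - k)%:R) = (d.-1 - k)%:R); last exact: conjc_nat.
have nk1 : k%:R != 0 :> C by apply: nk; lia.
have nk2 : (d.-1 - k)%:R != 0 :> C by apply: nk; lia.
rewrite mulrCA mulfV // mulr1 [RHS]mulrCA mulfV // mulr1.
rewrite conjcD !conjcM.
have cn (b : bool) : cj (b%:R : C) = b%:R by exact: conjc_nat.
rewrite !cn conjcD conjcB conjc_1 (_ : cj 'i%C = - 'i%C :> C); last first.
  by apply: complex_ext; rewrite /= ?oppr0.
by rewrite opprK addrC.
Qed.

(** For [k = i + 1] the real and imaginary parts of [k b_k] add up to twice the coordinate [v 0 i].
    The weights [1 + 'i] and [1 - 'i] are chosen for this, and they make a self-paired index an
    ordinary case. *)
Lemma palin_comb_neq0 (v : 'rV[R]_(d - 2)) : v != 0 -> exists k, palin_comb v k != 0.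
Proof.
move=> v0; have [i vi] : exists i, v 0 i != 0.
  apply: contrapT => nex; move/eqP: v0; apply; apply/rowP => i; rewrite mxE.
  by apply/eqP/negPn/negP => vi; apply: nex; exists i.
have id_ := ltn_ord i; exists i.+1; apply/eqP => E.
have hk : (0 < i.+1 < d.-1)%N by lia.
have nk : (i.+1)%:R != 0 :> C by rewrite pnatr_eq0.
have : \sum_(j < d - 2) (v 0 j)%:C *
    ((j.+1 == i.+1)%:R * (1 + 'i%C) + (j.+1 == (d.-1 - i.+1)%N)%:R * (1 - 'i%C)) = 0 :> C.
  transitivity (palin_comb v i.+1 * (i.+1)%:R); last by rewrite E mul0r.
  rewrite /palin_comb mulr_suml; apply: eq_bigr => j _.
  by rewrite /palin_basis hk -mulrA mulfVK.
set S := \sum_(_ < _) _ => S0.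
have H : \sum_(j < d - 2) v 0 j * (j.+1 == i.+1)%:R = 0.
  have ReS (F : 'I_(d - 2) -> C) : Re (\sum_j F j) = \sum_j Re (F j).
    by apply: (big_morph (@complex.Re R) (@ReD R)).
  have ImS (F : 'I_(d - 2) -> C) : Im (\sum_j F j) = \sum_j Im (F j).
    by apply: (big_morph (@complex.Im R) (@ImD R)).
  have : 2 * \sum_(j < d - 2) v 0 j * (j.+1 == i.+1)%:R = 0.
    transitivity (Re S + Im S); last by rewrite S0 /= addr0.
    rewrite ReS ImS -big_split mulr_sumr /=.
    apply: eq_bigr => j _.
    case: (j.+1 == i.+1); case: (j.+1 == _);
      rewrite !(ReM, ImM, ReD, ImD, ReN, ImN) /=; lra.
  by move/eqP; rewrite mulf_eq0 pnatr_eq0 => /eqP.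
move: H; rewrite (bigD1 i) //= eqxx mulr1 big1 ?addr0 => [H|j ji].
  by rewrite H eqxx in vi.
by rewrite eqSS (inj_eq val_inj) (negPf ji) mulr0.
Qed.

(** Each [j] imposes one real linear condition on [d - 2] real coordinates, and [n < d - 2] leaves a
    nonzero kernel. *)
Lemma exists_displacement (n : nat) (chx chy N : 'I_n -> C) : (n < d - 2)%N ->
  exists b, [/\ palindromic d b, exists k, b k != 0 &
    forall j, Re (cj (N j) * (gam d b (chx j) - gam d b (chy j))) = 0].
Proof.
move=> nd.
pose M := \matrix_(i < d - 2, j < n)
  Re (cj (N j) * (gam d (palin_basis i) (chx j) - gam d (palin_basis i) (chy j))).
have kM : kermx M != 0.
  rewrite -mxrank_eq0 mxrank_ker -lt0n subn_gt0.
  exact: leq_ltn_trans (rank_leq_col M) nd.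
have [v /sub_kermxP vM v0] := rowV0Pn kM.
exists (palin_comb v); split; [exact: palin_comb_palindromic | exact: palin_comb_neq0 |].
move=> j; have := congr1 (fun A : 'rV[R]_n => A 0 j) vM; rewrite !mxE => <-.
have gE x : gam d (palin_comb v) x = \sum_(i < d - 2) (v 0 i)%:C * gam d (palin_basis i) x.
  rewrite /gam /palin_comb.
  under eq_bigr do rewrite mulr_suml.
  rewrite exchange_big /=; apply: eq_bigr => i _; rewrite mulr_sumr.
  by apply: eq_bigr => k _; rewrite mulrA.
have ReS (F : 'I_(d - 2) -> C) : Re (\sum_j F j) = \sum_j Re (F j).
  by apply: (big_morph (@complex.Re R) (@ReD R)).
rewrite !gE -sumrB mulr_sumr ReS; apply: eq_bigr => i _; rewrite mxE.
by rewrite -mulrBr mulrCA [LHS]ReM /= mul0r subr0.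
Qed.

End DisplacementSpace.

(** * Return to the exterior domain and the exact counts *)

Section Conclusion.
Variables (R : realType) (d : nat).
Local Notation C := R[i].
Implicit Types (a : nat -> C) (x y z w : C).

Lemma laur_phi a z : laur d a z = phi d a z^-1.
Proof.
by rewrite /laur /phi invrK; congr (_ + _); apply: eq_bigr => k _; rewrite exprVn.
Qed.

Lemma laur'_pfun a z : laur' d a z = pfun d a z^-1.
Proof. by rewrite /laur' /pfun; congr (_ - _); apply: eq_bigr => k _; rewrite exprVn. Qed.

Lemma norm_gt1 z : (1 < `|z|) = (nm z^-1 < 1) && (z != 0).
Proof.
have -> : (1 < `|z|) = (1 < nm z) by rewrite -ltcR.
rewrite nmV; have [->|z0] := eqVneq z 0; first by rewrite nm0 ltr10 andbF.
by rewrite andbT invf_lt1 // nm_gt0.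
Qed.

Lemma univalent_univ a : univalent_Delta d a <-> univ d a.
Proof.
split=> [ua x y x1 y1 xy|ua z w].
  apply/eqP => g0.
  have x0 : x != 0 by apply: contra_eqN g0 => /eqP ->; rewrite gfun0 oner_eq0.
  have y0 : y != 0 by apply: contra_eqN g0 => /eqP ->; rewrite gfun_sym gfun0 oner_eq0.
  move/eqP: (xy); apply; apply: invr_inj; apply: ua.
  - by rewrite norm_gt1 invrK x1 invr_neq0.
  - by rewrite norm_gt1 invrK y1 invr_neq0.
  - by rewrite !laur_phi !invrK; apply/eqP; rewrite phi_eq //; apply/eqP.
rewrite !norm_gt1 => /andP[z1 z0] /andP[w1 w0]; rewrite !laur_phi => E.
apply: invr_inj; apply/eqP/negPn/negP => zw.
have := ua _ _ z1 w1 zw.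
by rewrite -phi_eq ?invr_neq0 // E eqxx.
Qed.

(** Two zeros of [p] cannot share a value, since no cusp lies on another branch; so the [d + 1]
    simple zeros give distinct cusps. *)
Lemma cusps_count a : (0 < d)%N -> univ d a -> a d = - (d%:R)^-1 ->
  has_exactly d.+1 (cusps d a).
Proof.
move=> d0 ua ad; have [zs cz uz] := univ_circle_roots d0 ua ad.
have [pE szs nz] := cz.
have rt z : (z \in zs) = (pfun d a z == 0).
  by rewrite -root_prod_XsubC -pE /root ppolyE.
exists (map (phi d a) zs); split; last split.
- rewrite map_inj_in_uniq // => z z' zzs z'zs pzz; apply/eqP/negPn/negP => zz.
  have [/eqP + _] := double_point_normals ua (nz z zzs) (nz z' z'zs) zz pzz.
  by apply; apply/eqP; rewrite -rt.
- by rewrite size_map.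
- move=> w; split=> [[zeta [z1 [/eqP p0 ->]]]|/mapP[z zzs ->]].
    by rewrite laur_phi; apply: map_f; rewrite rt -laur'_pfun.
  exists z^-1; rewrite laur_phi laur'_pfun invrK; split; last split=> //.
    by rewrite normE nmV nz // invr1.
  by apply/eqP; rewrite -rt.
Qed.

Lemma double_points_value a w : double_points d a w <-> double_value d a w.
Proof.
have n1 z : `|z| = 1 <-> nm z = 1 by rewrite normE; split=> [/complexI|->].
split=> [[x [y [/n1 x1 [/n1 y1 [xy [wx wy]]]]]]|[x [y [x1 y1 xy wx wy]]]].
  exists x^-1, y^-1; rewrite -!laur_phi !nmV x1 y1 invr1; split=> //.
  by apply/eqP => /invr_inj.
exists x^-1, y^-1; rewrite !laur_phi !invrK; do !split => //.
- by apply/n1; rewrite nmV x1 invr1.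
- by apply/n1; rewrite nmV y1 invr1.
- by move/invr_inj/eqP; rewrite (negPf xy).
Qed.

Lemma finite_enumeration (T : eqType) (P : T -> Prop) (N : nat) :
  (forall s : seq T, uniq s -> (forall t, t \in s -> P t) -> (size s <= N)%N) ->
  exists s : seq T, uniq s /\ forall t, P t <-> t \in s.
Proof.
move=> bound.
suff : forall m (s : seq T), (N - size s <= m)%N -> uniq s -> (forall t, t \in s -> P t) ->
    exists s : seq T, uniq s /\ forall t, P t <-> t \in s.
  by move/(_ N [::]); apply; rewrite ?subn0 // => t; rewrite in_nil.
elim=> [|m IH] s sm us sP.
all: have [sfull|] := pselect (forall t, P t -> t \in s); first by exists s; split=> // t; split; [exact: sfull|exact: sP].
all: move/existsNP => [t /not_implyP[Pt /negP ts]].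
all: have us' : uniq (t :: s) by rewrite /= ts.
all: have sP' u : u \in t :: s -> P u by rewrite in_cons => /orP[/eqP ->|/sP].
all: have := bound _ us' sP' => /= bs.
  by exfalso; lia.
by apply: (IH (t :: s)) => //=; lia.
Qed.

(** Three points over one value would have pairwise opposite normals, but the product of two
    negative factors is positive. Hence each double value costs one linear condition on
    displacements. *)
Lemma double_value_unique a x y u v : univ d a ->
  nm x = 1 -> nm y = 1 -> nm u = 1 -> nm v = 1 -> x != y -> u != v ->
  phi d a x = phi d a y -> phi d a u = phi d a v -> phi d a x = phi d a u ->
  (x = u /\ y = v) \/ (x = v /\ y = u).
Proof.
move=> ua x1 y1 u1 v1 xy uv pxy puv pxu.
have no3 r s t : nm r = 1 -> nm s = 1 -> nm t = 1 -> r != s -> s != t -> r != t ->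
    phi d a r = phi d a s -> phi d a s = phi d a t -> False.
  move=> r1 s1 t1 rs st rt prs pst.
  have [_ [k1 k10 E1]] := double_point_normals ua r1 s1 rs prs.
  have [pt [k2 k20 E2]] := double_point_normals ua s1 t1 st pst.
  have [_ [k3 k30 E3]] := double_point_normals ua r1 t1 rt (etrans prs pst).
  have Nt : pfun d a t / t != 0 by rewrite mulf_neq0 // invr_neq0 // circle_neq0.
  move: E1; rewrite E2 E3; move: (pfun d a t / t) Nt => n n0.
  rewrite mulrA -rmorphM => /(mulIf n0) /complexI.
  move=> H; have : 0 < k1 * k2 by rewrite nmulr_lgt0.
  by rewrite -H; lra.
have [xu|xu] := eqVneq x u.
  left; split=> //; apply/eqP/negPn/negP => yv.
  by apply: (no3 y u v) => //; rewrite -?xu // eq_sym.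
right; have xv : x = v.
  by apply/eqP/negPn/negP => xv; apply: (no3 x u v).
split=> //; apply/eqP/negPn/negP => yu.
by apply: (no3 y v u); rewrite -?xv // eq_sym.
Qed.

Lemma double_values_exact a : (2 <= d)%N -> extreme_Sigma_star d a ->
  univ d a -> a d = - (d%:R)^-1 -> (forall k, (k == 0)%N || (d < k)%N -> a k = 0) ->
  has_exactly (d - 2) (double_value d a).
Proof.
move=> d2 [_ ext] ua ad a0; have d0 : (0 < d)%N by lia.
have [zs cz uz] := univ_circle_roots d0 ua ad.
have ra := circle_roots_reciprocal cz.
have bound := double_value_count d2 ua ra.
have [s [us sP]] := finite_enumeration bound.
exists s; split=> //; split; last by [].
apply/eqP; rewrite eqn_leq bound //=; last by move=> w /sP.
rewrite leqNgt; apply/negP => small.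
have ch_ w : exists p : C * C, w \in s ->
    [/\ nm p.1 = 1, nm p.2 = 1, p.1 != p.2, w = phi d a p.1 & w = phi d a p.2].
  have [/sP[x [y H]]|_] := boolP (w \in s); last by exists (0, 0).
  by exists (x, y).
have [ch chP] := choice ch_.
have [b [pal [k0 bk0] disp]] := exists_displacement
  (fun j : 'I_(size s) => (ch (tnth (in_tuple s) j)).1)
  (fun j => (ch (tnth (in_tuple s) j)).2)
  (fun j => normal d a (ch (tnth (in_tuple s) j)).1) small.
have dispw w : w \in s ->
    Re (cj (normal d a (ch w).1) * (gam d b (ch w).1 - gam d b (ch w).2)) = 0.
  move=> ws; have /tnthP[j ->] : w \in in_tuple s by [].
  exact: disp.
have hdisp x y : nm x = 1 -> nm y = 1 -> x != y -> phi d a x = phi d a y ->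
    Re (cj (normal d a x) * (gam d b x - gam d b y)) = 0.
  move=> x1 y1 xy pxy.
  have [w pw ws] : exists2 w, phi d a x = w & w \in s.
    by exists (phi d a x) => //; apply/sP; exists x, y.
  have [u1 v1 uv wu wv] := chP _ ws; have D := dispw _ ws.
  have [[-> ->]//|[xv yu]] :=
    double_value_unique ua x1 y1 u1 v1 xy uv pxy (etrans (esym wu) wv) (etrans pw wu).
  (* Only one ordering of each pair was imposed; exchanging the ends multiplies the normal by a real
     factor and changes the sign of the difference. *)
  rewrite -yu -xv in D.
  have [_ [r r0]] := double_point_normals ua x1 y1 xy pxy.
  rewrite -!/(normal d a _) => ->; rewrite conjcM conjc_real -mulrA [LHS]ReM /= mul0r subr0.
  by rewrite -opprB mulrN ReN D oppr0 mulr0.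
have azero k : (d < k)%N -> a k = 0 by move=> dk; rewrite a0 // dk orbT.
have [e0 e00 eP] := univ_perturb d2 ua ad azero pal hdisp.
have bz k : (k == 0)%N || (d.-1 <= k)%N -> b k = 0 by case: pal => bz _; exact: bz.
have star e : `|e| < e0 -> Sigma_star d (fun k => a k + e%:C * b k).
  move=> /eP ue; split; last by rewrite bz ?leq_pred ?orbT // mulr0 addr0.
  split; last exact/univalent_univ.
  move=> k hk; rewrite a0 // bz ?mulr0 ?addr0 //.
  by case/orP: hk => [->//|dk]; apply/orP; right; lia.
have eh : `|e0 / 2| < e0 by rewrite gtr0_norm ?divr_gt0 //; lra.
have ehn : `|- (e0 / 2)| < e0 by rewrite normrN.
apply: ext; exists (fun k => a k + (e0 / 2)%:C * b k), (fun k => a k + (- (e0 / 2))%:C * b k).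
split; first exact: star.
split; first exact: star.
split.
  move=> /(congr1 (fun f => f k0)) /addrI; rewrite rmorphN mulNr => /eqP.
  rewrite -addr_eq0 -mulr2n mulrn_eq0 /= mulf_eq0 (negPf bk0) orbF.
  by rewrite -nm_eq0 nm_real normr_eq0 gt_eqF // divr_gt0.
by apply/funext => k; rewrite rmorphN; field; rewrite ?pnatr_eq0.
Qed.

End Conclusion.

Theorem theorem2p8 (R : realType) (d : nat) (a : nat -> R[i]) :
  (2 <= d)%N -> extreme_Sigma_star d a -> Suffridge d a.
Proof.
move=> d2 ext; have [[sig ad] _] := ext; have [a0 ud] := sig.
have ua : univ d a by apply/univalent_univ.
split=> //; split; first by apply: cusps_count => //; apply: leq_trans d2.
have [s [us [ss sP]]] := double_values_exact d2 ext ua ad a0.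
by exists s; split=> //; split=> // w; rewrite double_points_value.
Qed.
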